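(* Let $k$ be a finite field of characteristic $\ne 2$, $\overline C$ a smooth proper curve over $k$, and $C=\overline C\times \mathrm{Spec}(k[\epsilon]/(\epsilon^2))$. Let $A=H^0(\overline C,\omega_{\overline C}^2)$ and let $A'\subset A$ be the complement of the set $\{\eta^2:\eta\in H^0(\overline C,\omega_{\overline C})\}$. Then for every $\alpha\in A'$ having only simple zeros on $\overline C$, the characters of the group $HF_\alpha(k)$ form a basis of the space $\mathcal S(HF_\alpha(k))$ consisting of $\mathcal H_{\mathrm{PGL}_2,C}$-eigenvectors, where $\mathcal S(HF_\alpha(k))$ is regarded as an $\mathcal H_{\mathrm{PGL}_2,C}$-invariant summand of $V^1(C)$ via the decomposition $V^1(C)\simeq\bigoplus_{\alpha\in A'}\mathcal S(HF_\alpha(k))$.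
   Context: Adeles: $F$ is the stalk of $\mathcal O_C$ at the general point; for a closed point $p$, $\mathcal O_p$ is the completed local ring of $C$ at $p$, $F_p$ its total ring of fractions; $\mathbb A$ is the restricted product of the $F_p$ with respect to the $\mathcal O_p$, $\mathcal O=\prod_p\mathcal O_p$; $\mathcal N\mathbb A$, $\mathcal N_F$ are the nilradicals of $\mathbb A$, $F$. Put $G=\mathrm{PGL}_2$ with Lie algebra $\mathfrak g$, identified with its dual by the Killing form, and let $U$ be the unipotent upper triangular subgroup. $\mathrm{Bun}_G(C)=G(F)\backslash G(\mathbb A)/G(\mathcal O)$ is the set of isomorphism classes of $G$-bundles on $C$. $V^1(C)$ is the space of complex functions $f$ on $\mathrm{Bun}_G(C)$ that are strongly cuspidal: $\int_{U(\mathcal N_F)\backslash U(\mathcal N\mathbb A)}f(ug)\,du=0$ for all $g\in G(\mathbb A)$, where $U(\mathcal N\mathbb A)=\ker(U(\mathbb A)\to U(\mathbb A/\mathcal N\mathbb A))$, $U(\mathcal N_F)=\ker(U(F)\to U(F/\mathcal N_F))$. $\mathcal H_{\mathrm{PGL}_2,C}$ is the convolution algebra of compactly supported $G(\mathcal O)$-biinvariant measures on $G(\mathbb A)$, acting by $(h*f)(g)=\int f(gx)\,dh(x)$; it preserves $V^1(C)$. A Higgs $\mathrm{PGL}_2$-bundle on $\overline C$ is a pair $(P,\phi)$, $P$ a $\mathrm{PGL}_2$-bundle and $\phi\in H^0(\overline C,\mathfrak g_P\otimes\omega_{\overline C})$; concretely $P$ is given by a rank $2$ bundle $V$ up to twist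 by line bundles, and $\phi:V\to V\otimes\omega_{\overline C}$ is traceless. For $\alpha\in A$, $HF_\alpha$ is the Hitchin fiber $\{(P,\phi):-\det\phi=\alpha\}$, and $HF_\alpha(k)$ is the set of isomorphism classes of its $k$-points. $\mathcal S(X)$ denotes finitely supported complex functions on $X$. The decomposition $V^1(C)\simeq\bigoplus_{\alpha\in A'}\mathcal S(HF_\alpha(k))$ is as follows. Fix a nontrivial additive character $\psi:k\to\mathbb C^*$. A $G$-bundle $\widetilde P$ on $C$ with reduction $P$ on $\overline C$ differs from the constant extension $P\times\mathrm{Spec}(k[\epsilon]/(\epsilon^2))$ by a class $e\in H^1(\overline C,\mathfrak g_P)$ (up to $\mathrm{Aut}(P)$). To $s\in\mathcal S(HF_\alpha(k))$ one associates the function $f(\widetilde P)=\sum_{\phi}\psi(\langle e,\phi\rangle)s(P,\phi)$, the sum over $\phi\in H^0(\overline C,\mathfrak g_P\otimes\omega_{\overline C})$ with $-\det\phi=\alpha$, where $\langle\cdot,\cdot\rangle$ is the Serre duality pairing (with the Killing form). The summands are preserved by $\mathcal H_{\mathrm{PGL}_2,C}$. Group structure: if $\alpha\in A'$ has only simple zeros, the spectral curve $\pi:C_\alpha\to\overline C$, $\pi_*\mathcal O_{C_\alpha}=\mathcal O_{\overline C}\oplus\omega_{\overline C}^{-1}t$, $t^2=\alpha$, is smooth, and $M\mapsto(\pi_*M,\text{multiplication by }t)$ gives a bijection $\mathrm{Pic}(C_\alpha)/\pi^*\mathrm{Pic}(\overline C)\simeq HF_\alpha(k)$, through which $HF_\alpha(k)$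 is a finite abelian group. *)

(* Defs.v *)
From HB Require Import structures.
From mathcomp Require Import all_boot all_order all_algebra complex.
From mathcomp Require Import boolp classical_sets functions cardinality fsbigop.
From mathcomp Require Import reals.

Set Implicit Arguments.
Unset Strict Implicit.
Unset Printing Implicit Defensive.

Import Order.TTheory GRing.Theory Num.Theory.
Local Open Scope classical_set_scope.
Local Open Scope ring_scope.

(* Dual numbers: [Dual x y] is x + eps y with eps^2 = 0. *)
Record dual (R : Type) : Type := Dual { dre : R; deps : R }.

HB.instance Definition _ (R : Type) := gen_eqMixin (dual R).
HB.instance Definition _ (R : Type) := gen_choiceMixin (dual R).

Section DualRing.
Variable R : comPzRingType.
Implicit Types x y z : dual R.

Definition dual_zero : dual R := Dual 0 0.
Definition dual_opp x : dual R := Dual (- dre x) (- deps x).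
Definition dual_add x y : dual R := Dual (dre x + dre y) (deps x + deps y).
Definition dual_one : dual R := Dual 1 0.
Definition dual_mul x y : dual R :=
  Dual (dre x * dre y) (dre x * deps y + deps x * dre y).

Fact dual_addA : associative dual_add.
Proof. by move=> [a b] [c d] [e f]; rewrite /dual_add /= !addrA. Qed.
Fact dual_addC : commutative dual_add.
Proof. by move=> [a b] [c d]; rewrite /dual_add /= addrC [b + d]addrC. Qed.
Fact dual_add0 : left_id dual_zero dual_add.
Proof. by move=> [a b]; rewrite /dual_add /= !add0r. Qed.
Fact dual_addN : left_inverse dual_zero dual_opp dual_add.
Proof. by move=> [a b]; rewrite /dual_add /= !addNr. Qed.
HB.instance Definition _ :=
  GRing.isZmodule.Build (dual R) dual_addA dual_addC dual_add0 dual_addN.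

Fact dual_mulA : associative dual_mul.
Proof.
move=> [a b] [c d] [e f]; rewrite /dual_mul /= mulrA; congr Dual.
by rewrite mulrDr mulrDl !mulrA addrA.
Qed.
Fact dual_mulC : commutative dual_mul.
Proof.
move=> [a b] [c d]; rewrite /dual_mul /= [a * c]mulrC addrC.
by rewrite [a * d]mulrC [b * c]mulrC.
Qed.
Fact dual_mul1 : left_id dual_one dual_mul.
Proof. by move=> [a b]; rewrite /dual_mul /= !mul1r mul0r addr0. Qed.
Fact dual_mulD : left_distributive dual_mul dual_add.
Proof.
move=> [a b] [c d] [e f]; rewrite /dual_mul /dual_add /=; congr Dual.
  by rewrite mulrDl.
by rewrite !mulrDl addrACA.
Qed.
HB.instance Definition _ := GRing.Zmodule_isComPzRing.Build (dual R)
  dual_mulA dual_mulC dual_mul1 dual_mulD.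

(* S[eps] inside R[eps]. *)
Definition dual_set (S : set R) : set (dual R) :=
  [set x | S (dre x) /\ S (deps x)].

End DualRing.

Section Matrices.
Variable R : comPzRingType.

(* GL_2 of a subring S of R, as a subset of the 2 x 2 matrices over R. *)
Definition GL2 (S : set R) : set 'M[R]_2 :=
  [set g | exists h : 'M[R]_2, [/\ g *m h = 1%:M, h *m g = 1%:M,
     forall i j, S (g i j) & forall i j, S (h i j)]].

Definition units : set R := [set z | exists w, z * w = 1].

Definition mxinv (g : 'M[R]_2) : 'M[R]_2 :=
  xget 1%:M [set h | g *m h = 1%:M /\ h *m g = 1%:M].

Definition lie (X Y : 'M[R]_2) : 'M[R]_2 := X *m Y - Y *m X.

(* The trace of ad X o ad Y on gl_2.  As gl_2 -> pgl_2 has a central kernel,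
   this is the Killing form of pgl_2 = sl_2 on the images of X and Y. *)
Definition killing (X Y : 'M[R]_2) : R :=
  \sum_i \sum_j (lie X (lie Y (delta_mx i j))) i j.

(* The matrix of multiplication by x + y tau, where tau^2 = a, in the basis
   (1, tau) of R[tau]. *)
Definition spec_mx (a x y : R) : 'M[R]_2 :=
  \matrix_(i, j) (if i == j then x else if i == 0 then a * y else y).

End Matrices.

(* x = 0 or v x >= n. *)
Definition vge (L : fieldType) (v : L -> int) (n : int) (x : L) : Prop :=
  x = 0 \/ n <= v x.

(* The values of v away from 0 carry a valuation; v 0 is not constrained. *)
Definition is_valuation (L : fieldType) (v : L -> int) : Prop :=
  (forall x y, x != 0 -> y != 0 -> v (x * y) = v x + v y) /\
  (forall n x y, vge v n x -> vge v n y -> vge v n (x + y)).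

(* A connected smooth proper curve over the finite (hence perfect) field k is
   encoded by its function field, a finitely generated extension of k of
   transcendence degree 1: a finite extension of k(x), x transcendental. *)
Record curve (k : finFieldType) : Type := Curve {
  funfield : fieldType;
  const : {rmorphism k -> funfield};
  funfieldP : exists (x : funfield) (n : nat) (b : 'I_n -> funfield),
    (forall q : {poly k}, q != 0 -> (map_poly const q).[x] != 0) /\
    (forall y, exists (d : {poly k}) (c : 'I_n -> {poly k}), d != 0 /\
       y * (map_poly const d).[x] = \sum_i (map_poly const (c i)).[x] * b i)
}.

(* The closed points of the curve: the normalized discrete valuations of the
   function field that are trivial on k.  The convention pval 0 = 0 makes a
   closed point correspond to exactly one place. *)
Record place (k : finFieldType) (C : curve k) : Type := Place {
  pval : funfield C -> int;
  pval_valuation : is_valuation pval;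
  pval_const : forall c : k, pval (const C c) = 0;
  pval_onto : exists2 t, t != 0 & pval t = 1;
  pval0 : pval 0 = 0
}.

(* A completion of the function field at p; it is unique up to a unique
   isomorphism. *)
Record completion (k : finFieldType) (C : curve k) (p : place C) : Type :=
  Completion {
  cfield :> fieldType;
  cval : cfield -> int;
  cemb : {rmorphism funfield C -> cfield};
  cval_valuation : is_valuation cval;
  cval_emb : forall x, x != 0 -> cval (cemb x) = pval p x;
  cemb_dense : forall (x : cfield) (n : int),
    exists y, vge cval n (x - cemb y);
  cfield_complete : forall u : nat -> cfield,
    (forall n : int, exists N : nat, forall i j : nat,
       (N <= i)%N -> (N <= j)%N -> vge cval n (u i - u j)) ->
    exists l, forall n : int, exists N : nat, forall i : nat,
       (N <= i)%N -> vge cval n (u i - l)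
}.

Section Adeles.
Variables (k : finFieldType) (Cbar : curve k).
Variable hat : forall p : place Cbar, completion p.

Definition almost_integral (x : forall p, hat p) : Prop :=
  finite_set [set p | ~ vge (@cval _ _ _ (hat p)) 0 (x p)].

Record adele : Type := Adele {
  aval :> forall p, hat p;
  avalP : almost_integral aval
}.

HB.instance Definition _ := gen_eqMixin adele.
HB.instance Definition _ := gen_choiceMixin adele.

Lemma adele_ext (x y : adele) : (forall p, x p = y p) -> x = y.
Proof.
case: x y => [x xP] [y yP] /= xy.
have E : x = y by apply: functional_extensionality_dep.
by subst y; congr Adele; apply: Prop_irrelevance.
Qed.

Section ValuationFacts.
Variables (L : fieldType) (v : L -> int).
Hypothesis vv : is_valuation v.

Lemma valuation1 : v 1 = 0.
Proof.
have := vv.1 1 1 (oner_neq0 _) (oner_neq0 _); rewrite mulr1.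
by move/(congr1 (fun z => z - v 1)); rewrite addrK subrr.
Qed.

Lemma valuationN1 : v (- 1) = 0.
Proof.
have n0 : (- 1 : L) != 0 by rewrite oppr_eq0 oner_neq0.
have := vv.1 _ _ n0 n0; rewrite mulrNN mulr1 valuation1 => /esym/eqP.
by rewrite -mulr2n mulrn_eq0 /= => /eqP.
Qed.

Lemma vge_mul n m x y : vge v n x -> vge v m y -> vge v (n + m) (x * y).
Proof.
case: (eqVneq x 0) => [->|x0]; first by left; rewrite mul0r.
case: (eqVneq y 0) => [->|y0]; first by left; rewrite mulr0.
case=> [/eqP|nx]; first by rewrite (negPf x0).
case=> [/eqP|my]; first by rewrite (negPf y0).
by right; rewrite vv.1 // lerD.
Qed.

Lemma vge_opp n x : vge v n x -> vge v n (- x).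
Proof.
move=> nx; rewrite -mulN1r -[n]add0r; apply: vge_mul => //.
by right; rewrite valuationN1.
Qed.

End ValuationFacts.

Fact adele_zeroP : almost_integral (fun _ => 0).
Proof. by apply: sub_finite_set (finite_set0 _) => p; apply; left. Qed.

Fact adele_oneP : almost_integral (fun _ => 1).
Proof.
apply: sub_finite_set (finite_set0 _) => p; apply; right.
by rewrite valuation1 //; exact: cval_valuation.
Qed.

Fact adele_oppP (x : adele) : almost_integral (fun p => - x p).
Proof.
apply: sub_finite_set (avalP x) => p /= npx px; apply: npx.
by apply: vge_opp => //; exact: cval_valuation.
Qed.

Fact adele_addP (x y : adele) : almost_integral (fun p => x p + y p).
Proof.
have xyf : finite_set ([set p | ~ vge (@cval _ _ _ (hat p)) 0 (x p)] `|`
                       [set p | ~ vge (@cval _ _ _ (hat p)) 0 (y p)]).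
  by rewrite finite_setU; split; exact: avalP.
apply: sub_finite_set xyf => p /= nxy.
apply: contrapT => /not_orP[/contrapT px /contrapT py].
by apply: nxy; apply: (cval_valuation (hat p)).2.
Qed.

Fact adele_mulP (x y : adele) : almost_integral (fun p => x p * y p).
Proof.
have xyf : finite_set ([set p | ~ vge (@cval _ _ _ (hat p)) 0 (x p)] `|`
                       [set p | ~ vge (@cval _ _ _ (hat p)) 0 (y p)]).
  by rewrite finite_setU; split; exact: avalP.
apply: sub_finite_set xyf => p /= nxy.
apply: contrapT => /not_orP[/contrapT px /contrapT py].
apply: nxy; rewrite -[0 : int]addr0; apply: vge_mul => //.
exact: cval_valuation.
Qed.

Definition adele_zero : adele := Adele adele_zeroP.
Definition adele_one : adele := Adele adele_oneP.
Definition adele_opp (x : adele) : adele := Adele (adele_oppP x).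
Definition adele_add (x y : adele) : adele := Adele (adele_addP x y).
Definition adele_mul (x y : adele) : adele := Adele (adele_mulP x y).

Fact adele_addA : associative adele_add.
Proof. by move=> x y z; apply: adele_ext => p /=; rewrite addrA. Qed.
Fact adele_addC : commutative adele_add.
Proof. by move=> x y; apply: adele_ext => p /=; rewrite addrC. Qed.
Fact adele_add0 : left_id adele_zero adele_add.
Proof. by move=> x; apply: adele_ext => p /=; rewrite add0r. Qed.
Fact adele_addN : left_inverse adele_zero adele_opp adele_add.
Proof. by move=> x; apply: adele_ext => p /=; rewrite addNr. Qed.
HB.instance Definition _ :=
  GRing.isZmodule.Build adele adele_addA adele_addC adele_add0 adele_addN.

Fact adele_mulA : associative adele_mul.
Proof. by move=> x y z; apply: adele_ext => p /=; rewrite mulrA. Qed.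
Fact adele_mulC : commutative adele_mul.
Proof. by move=> x y; apply: adele_ext => p /=; rewrite mulrC. Qed.
Fact adele_mul1 : left_id adele_one adele_mul.
Proof. by move=> x; apply: adele_ext => p /=; rewrite mul1r. Qed.
Fact adele_mulD : left_distributive adele_mul adele_add.
Proof. by move=> x y z; apply: adele_ext => p /=; rewrite mulrDl. Qed.
HB.instance Definition _ := GRing.Zmodule_isComPzRing.Build adele
  adele_mulA adele_mulC adele_mul1 adele_mulD.

(* The function field, embedded diagonally in the adeles. *)
Definition principal : set adele :=
  [set x | exists c : funfield Cbar, forall p, x p = cemb (hat p) c].

Definition integral : set adele :=
  [set x | forall p, vge (@cval _ _ _ (hat p)) 0 (x p)].

(* The adeles of C = Cbar x Spec k[eps] are the restricted product of the
   F_p = K_p[eps] with respect to the O_p[eps], i.e. adele[eps]; the general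
   stalk is F = K[eps]. *)
Notation adeleC := (dual adele).
Definition principalC : set adeleC := dual_set principal.
Definition integralC : set adeleC := dual_set integral.

(* Rational sections of omega are taken to be Weil differentials: omega is
   used as the dualizing sheaf, and the Serre duality pairing (the sum of the
   local residues) is the evaluation of a differential on adeles. *)
Record weil_differential : Type := WeilDifferential {
  wfun :> adele -> k;
  wfunD : forall x y, wfun (x + y) = wfun x + wfun y;
  wfunZ : forall (c : k) (x y : adele),
    (forall p, y p = cemb (hat p) (const Cbar c) * x p) -> wfun y = c * wfun x;
  wfun_principal : forall x, principal x -> wfun x = 0;
  wfun_continuous : exists D : place Cbar -> int,
    finite_set [set p | D p != 0] /\
    forall x : adele, (forall p, vge (@cval _ _ _ (hat p)) (D p) (x p)) ->
    wfun x = 0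
}.

Section Differential.
(* All rational differentials are K-multiples of a fixed nonzero one, eta.
   Through eta, a rational section of omega^n is given by an element c of K,
   standing for c eta^n. *)
Variable eta : weil_differential.

(* Locally at p, eta lies in m_p^n omega_p. *)
Definition diff_vanishes (p : place Cbar) (n : int) : Prop :=
  forall x : adele, (forall q, q <> p -> x q = 0) ->
    vge (@cval _ _ _ (hat p)) (- n) (x p) -> eta x = 0.

Definition diff_order (p : place Cbar) (n : int) : Prop :=
  diff_vanishes p n /\ ~ diff_vanishes p (n + 1).

(* c eta is a section of omega at all closed points. *)
Definition regular_diff (c : adele) : Prop :=
  forall y, integral y -> eta (c * y) = 0.

(* a eta^2 belongs to A = H^0(omega^2). *)
Definition quad_diff (a : adele) : Prop :=
  principal a /\
  forall p, exists2 n, diff_order p n &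
    vge (@cval _ _ _ (hat p)) (- (n + n)) (a p).

(* a eta^2 belongs to A'. *)
Definition nonsquare_quad_diff (a : adele) : Prop :=
  quad_diff a /\
  forall b, principal b -> regular_diff b -> b * b <> a.

(* a eta^2 has order at most 1 at every closed point. *)
Definition simple_zeros (a : adele) : Prop :=
  forall p n, diff_order p n ->
    ~ vge (@cval _ _ _ (hat p)) (2 - (n + n)) (a p).

(* For a eta^2 in A: the pairs (P, phi) with - det phi = a eta^2, where P is
   the PGL_2-bundle on Cbar given by hg, in GL_2 of the adeles, and
   phi = hphi eta at the general point. *)
Record higgs (a : adele) : Type := Higgs {
  hg : 'M[adele]_2;
  hphi : 'M[adele]_2;
  hgP : GL2 setT hg;
  hphi_principal : forall i j, principal (hphi i j);
  hphi_traceless : \tr hphi = 0;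
  hphi_det : - \det hphi = a;
  hphi_regular : forall i j, regular_diff ((mxinv hg *m hphi *m hg) i j)
}.

HB.instance Definition _ (a : adele) := gen_eqMixin (higgs a).
HB.instance Definition _ (a : adele) := gen_choiceMixin (higgs a).

Definition higgs_iso (a : adele) (x y : higgs a) : Prop :=
  exists gamma z kappa, [/\ GL2 principal gamma, units z, GL2 integral kappa,
    hg y = gamma *m hg x *m z%:M *m kappa &
    hphi y *m gamma = gamma *m hphi x].

(* HF_alpha(k), for alpha = a eta^2: the isomorphism classes. *)
Definition HF (a : adele) : Type :=
  {c : set (higgs a) | exists x, c = [set y | higgs_iso x y]}.

Definition higgs_class (a : adele) (x : higgs a) : HF a :=
  exist _ [set y | higgs_iso x y] (ex_intro _ x erefl).

(* Ideles of the spectral curve: with t = tau eta, its function field is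
   K[tau], tau^2 = a, and a line bundle M is given by an invertible element
   x + y tau of adele[tau], encoded by its multiplication matrix. *)
Definition spec_idele (a : adele) : set 'M[adele]_2 :=
  [set m | GL2 setT m /\ exists x y, m = spec_mx a x y].

(* The integral adeles of the spectral curve, i.e. of O + omega^-1 t, in the
   basis (1, tau): the second coordinate u of f t, f in omega^-1, is f eta. *)
Definition spec_integral : set 'cV[adele]_2 :=
  [set w | integral (w 0 0) /\
           forall c, regular_diff c -> integral (w 1 0 * c)].

(* P is the class of (pi_* M, multiplication by t), M given by m. *)
Definition pushforward (a : adele) (m : 'M[adele]_2) (P : HF a) : Prop :=
  exists x : higgs a, [/\ P = higgs_class x,
    hphi x = spec_mx a 0 1 &
    [set hg x *m w | w in [set w : 'cV[adele]_2 | forall i, integral (w i 0)]]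
    = [set m *m w | w in spec_integral]].

Section Functions.
Variable R : realType.
Local Notation CC := (R[i]).

Definition finitely_supported (a : adele) : set (HF a -> CC) :=
  [set s | finite_set [set P | s P != 0]].

(* Characters of HF_alpha(k): the functions whose pull-back along
   the bijection from Pic(C_alpha) / pi^* Pic(Cbar) is a homomorphism to the
   nonzero complex numbers. *)
Definition HF_character (a : adele) : set (HF a -> CC) :=
  [set chi | (forall P, pushforward 1%:M P -> chi P = 1) /\
    forall m m' P P' Q, spec_idele a m -> spec_idele a m' ->
      pushforward m P -> pushforward m' P' -> pushforward (m *m m') Q ->
      chi Q = chi P * chi P'].

Definition is_basis (T : Type) (V X : set (T -> CC)) : Prop :=
  [/\ X `<=` V,
      forall (n : nat) (e : 'I_n -> T -> CC) (c : 'I_n -> CC),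
        injective e -> (forall i, X (e i)) ->
        (forall t, \sum_i c i * e i t = 0) -> forall i, c i = 0 &
      forall s, V s -> exists (n : nat) (e : 'I_n -> T -> CC) (c : 'I_n -> CC),
        (forall i, X (e i)) /\ forall t, s t = \sum_i c i * e i t].

(* Functions on Bun_G(C) = G(F) \ G(A) / G(O): functions on G(A), where
   PGL_2(A) = GL_2(A) / A^* and likewise for F and O (these are local rings,
   products of local rings, or restricted products of local rings).  Values
   at non-invertible matrices are irrelevant. *)
Definition bun_function (f : 'M[adeleC]_2 -> CC) : Prop :=
  forall gamma g z kappa, GL2 principalC gamma -> GL2 setT g -> units z ->
    GL2 integralC kappa -> f (gamma *m g *m z%:M *m kappa) = f g.

(* The Haar integral over the compact group K \ adele of a locally constant
   K-invariant function F: the average over the finite quotient of adele by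
   the open subgroup of the periods of F. *)
Definition periods (F : adele -> CC) : set adele :=
  [set b | forall x, F (x + b) = F x].

Definition period_cosets (F : adele -> CC) : set (set adele) :=
  [set c | exists x, c = [set x + b | b in periods F]].

Definition haar (F : adele -> CC) : CC :=
  (\sum_(c \in period_cosets F) (1 : CC))^-1 *
  \sum_(c \in period_cosets F) F (xget 0 c).

(* The nilradicals of A and F are eps adele and eps K, so that U(N_A), which
   consists of the nil_unip x, is identified with adele and U(N_F) with K. *)
Definition nil_unip (x : adele) : 'M[adeleC]_2 :=
  1%:M + Dual 0 x *: delta_mx 0 1.

Definition strongly_cuspidal (f : 'M[adeleC]_2 -> CC) : Prop :=
  bun_function f /\
  forall g, GL2 setT g -> haar (fun x => f (nil_unip x *m g)) = 0.

Definition GO_coset (x : 'M[adeleC]_2) : set 'M[adeleC]_2 :=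
  [set y | exists z kappa, [/\ units z, GL2 integralC kappa &
                               y = x *m z%:M *m kappa]].

Definition GA_mod_GO : set (set 'M[adeleC]_2) :=
  [set c | exists2 x, GL2 setT x & c = GO_coset x].

(* A compactly supported G(O)-biinvariant measure on G(A) is determined by
   the mass h x that it gives to each coset x G(O) (of the open compact
   subgroup G(O)): h is a G(O)-biinvariant function supported on finitely
   many cosets. *)
Definition hecke_measure (h : 'M[adeleC]_2 -> CC) : Prop :=
  (forall kappa x z kappa', GL2 integralC kappa -> GL2 setT x -> units z ->
     GL2 integralC kappa' -> h (kappa *m x *m z%:M *m kappa') = h x) /\
  finite_set [set c | GA_mod_GO c /\ exists2 x, c x & h x != 0].

(* (h * f)(g) = int f(g x) dh(x), for f right G(O)-invariant. *)
Definition hecke_act (h f : 'M[adeleC]_2 -> CC) (g : 'M[adeleC]_2) : CC :=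
  \sum_(c \in GA_mod_GO) h (xget 1%:M c) * f (g *m xget 1%:M c).

Definition hecke_eigenvector (f : 'M[adeleC]_2 -> CC) : Prop :=
  [/\ strongly_cuspidal f,
      exists2 g, GL2 setT g & f g != 0 &
      forall h, hecke_measure h -> exists lambda : CC,
        forall g, GL2 setT g -> hecke_act h f g = lambda * f g].

Definition nontrivial_character (psi : k -> CC) : Prop :=
  [/\ psi 0 = 1, forall x y, psi (x + y) = psi x * psi y &
      exists x, psi x != 1].

Definition mx_re (g : 'M[adeleC]_2) : 'M[adele]_2 := \matrix_(i, j) dre (g i j).
Definition mx_im (g : 'M[adeleC]_2) : 'M[adele]_2 :=
  \matrix_(i, j) deps (g i j).

(* The G-bundle on C given by g = (1 + eps Y) g0 restricts to the bundle P
   given by g0, and differs from the constant extension of P by the class e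
   of Y in H^1(Cbar, g_P) = g(K) \ g(adele) / Ad(g0) g(integral). *)
Definition bundle_class (g : 'M[adeleC]_2) : 'M[adele]_2 :=
  mx_im g *m mxinv (mx_re g).

(* The embedding S(HF_alpha(k)) -> V^1(C). *)
Definition hitchin_function (psi : k -> CC) (a : adele) (s : HF a -> CC)
    (g : 'M[adeleC]_2) : CC :=
  \sum_(x \in [set x : higgs a | hg x = mx_re g])
    psi (eta (killing (bundle_class g) (hphi x))) * s (higgs_class x).

End Functions.
End Differential.
End Adeles.

(* Main.v *)
(** Conjugating phi to the companion matrix S of t^2 = alpha turns every Higgs
    bundle of the Hitchin fiber into (m gL, S), where m is an idele of the
    spectral curve, gL = diag(1, u) and u is an idele with the order of eta.
    As alpha has simple zeros, the lattice O + O u t is a maximal order, and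
    this is the push-forward of the line bundle of m.  The fiber is finite: a
    Minkowski argument, which rests on strong approximation and counts in
    quotients of lattices instead of computing volumes, bounds m up to
    equivalence.  Hence its characters form a basis.

    For a character chi and a Hecke measure h, the coefficient of psi <e, phi>
    in h * f at a bundle with reduction g is
      sum_x h(x) psi <Ad g (e_x), phi> chi (g x_0, phi).
    Invariance of h under 1 + eps g(O) on the left makes it vanish unless
    (g, phi) is a Higgs bundle, and left invariance under G(O) makes it depend
    only on the normal form (m gL, S).  Ideles of the spectral curve commute
    with S, so replacing gL by m gL multiplies the sum by chi(m), and the sum
    at (gL, S) is the eigenvalue.  Cuspidality and nonvanishing follow by
    averaging over finitely many directions eps Y, which separate the Higgs
    fields; for the former, phi has a nonzero lower left entry because alpha
    is not a square. *)

Require Import Defs.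
From HB Require Import structures.
From mathcomp Require Import all_boot all_order all_algebra complex.
From mathcomp Require Import polyXY separable cyclotomic finmap.
From mathcomp Require Import boolp classical_sets functions cardinality fsbigop.
From mathcomp Require Import reals ring lra zify.

Set Implicit Arguments.
Unset Strict Implicit.
Unset Printing Implicit Defensive.

Import Order.TTheory GRing.Theory Num.Theory.
Local Open Scope ring_scope.

(** * Valuations and weak approximation *)

(** Two facts about K inside the adeles carry all finiteness statements. Every adele lies in K plus
    one fixed ball, which replaces compactness of the quotient by K. A ball contains only finitely
    many elements of K, because the nonzero differential [eta] separates them; this replaces
    Riemann-Roch. Both start from the presentation of K as a finite extension of k(x).
    Characteristic different from 2 enters at two places: in the choice of a local generator of a
    lattice over the spectral order, and through the factor 4 of the Killing form, which must be
    invertible for the pairing to separate Higgs fields. The Hitchin function sums over records that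
    contain proofs. It is rewritten as a sum over 2 x 2 matrices, with [chi] extended by 0, so that
    a bundle and its finitely many Hecke modifications share one finite index set and the sums over
    Higgs fields and over cosets can be exchanged. *)

Section Valuation.
Variables (L : fieldType) (v : L -> int).
Hypothesis vv : is_valuation v.

Lemma vge0 n : vge v n 0. Proof. by left. Qed.

Lemma vgeE n x : x != 0 -> vge v n x <-> n <= v x.
Proof. by move=> x0; split=> [[/eqP|//]|]; [rewrite (negPf x0)|right]. Qed.

Lemma vge_le m n x : m <= n -> vge v n x -> vge v m x.
Proof. by move=> mn [->|nx]; [left|right; apply: le_trans nx]. Qed.

Lemma vge_add n x y : vge v n x -> vge v n y -> vge v n (x + y).
Proof. exact: vv.2. Qed.

Lemma vge_sub n x y : vge v n x -> vge v n y -> vge v n (x - y).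
Proof. by move=> ? ?; apply: vge_add => //; apply: vge_opp. Qed.

Lemma vge_sum n (I : Type) (r : seq I) (P : pred I) (F : I -> L) :
  (forall i, P i -> vge v n (F i)) -> vge v n (\sum_(i <- r | P i) F i).
Proof.
move=> PF; elim/big_rec: _ => [|i x Pi]; first exact: vge0.
by apply: vge_add; apply: PF.
Qed.

Lemma vge_refl x : vge v (v x) x.
Proof. by right. Qed.

Lemma vge_mul0 n x y : vge v 0 x -> vge v n y -> vge v n (x * y).
Proof. by move=> x0 yn; rewrite -[n]add0r; apply: vge_mul. Qed.

Lemma valuM x y : x != 0 -> y != 0 -> v (x * y) = v x + v y.
Proof. exact: vv.1. Qed.

Lemma valuV x : x != 0 -> v x^-1 = - v x.
Proof.
move=> x0; apply/eqP; rewrite -addr_eq0 -valuM ?invr_eq0 // mulVf //.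
by rewrite valuation1.
Qed.

Lemma valuX x n : x != 0 -> v (x ^+ n) = v x *+ n.
Proof.
move=> x0; elim: n => [|n IH]; first by rewrite expr0 valuation1.
by rewrite exprS valuM ?expf_neq0 // IH mulrS.
Qed.

Lemma valuXz x (n : int) : x != 0 -> v (x ^ n) = v x * n.
Proof.
move=> x0; case: n => n; first by rewrite -exprnP valuX // -mulr_natr natz.
by rewrite NegzE -exprnN valuV ?expf_neq0 // valuX // -mulr_natr natz mulrN.
Qed.

Lemma valuN x : v (- x) = v x.
Proof.
have [->|x0] := eqVneq x 0; first by rewrite oppr0.
by rewrite -mulN1r valuM ?oppr_eq0 ?oner_eq0 // valuationN1 // add0r.
Qed.

Lemma valuD_neq0 x y : x != 0 -> vge v (v x + 1) y -> x + y != 0.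
Proof.
move=> x0 yx; apply/eqP => /eqP; rewrite addr_eq0 => /eqP xy.
have y0 : y != 0 by rewrite -oppr_eq0 -xy.
have : v x + 1 <= v y by apply/vgeE.
by rewrite xy valuN; lia.
Qed.

Lemma valuD x y : x != 0 -> vge v (v x + 1) y -> v (x + y) = v x.
Proof.
move=> x0 yx; have xy0 := valuD_neq0 x0 yx; apply/eqP; rewrite eq_le.
apply/andP; split; last first.
  apply/vgeE => //; apply: vge_add; first exact: vge_refl.
  by apply: vge_le yx; lia.
rewrite leNgt; apply/negP => lt.
have : v x + 1 <= v x; last lia.
apply/vgeE => //; have -> : vge v (v x + 1) x = vge v (v x + 1) (x + y - y).
  by rewrite addrK.
by apply: vge_sub => //; right; rewrite lezD1.
Qed.

End Valuation.

HB.instance Definition _ (k : finFieldType) (C : curve k) :=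
  gen_eqMixin (place C).
HB.instance Definition _ (k : finFieldType) (C : curve k) :=
  gen_choiceMixin (place C).

Section Places.
Variables (k : finFieldType) (C : curve k).
Local Notation K := (funfield C).
Implicit Types (p q : place C) (x y z f : K).

Lemma place_ext p q : (forall x, x != 0 -> pval p x = pval q x) -> p = q.
Proof.
move=> pq; have {}pq : pval p = pval q.
  apply: functional_extensionality_dep => x.
  by have [->|/pq//] := eqVneq x 0; rewrite !pval0.
case: p q pq => [v v1 v2 v3 v4] [w w1 w2 w3 w4] /= vw; subst w.
by congr Place; apply: Prop_irrelevance.
Qed.

(** If the valuation ring of [p] lies in that of [q], units at [p] are units at [q], so [pval q] is
    [pval q t] times [pval p] for a uniformizer [t] of [p]. Since [pval q] takes the value 1, this
    factor is 1 and the places coincide. *)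
Lemma place_separated p q : p <> q ->
  exists x, [/\ x != 0, 0 <= pval p x & pval q x < 0].
Proof.
move=> npq; apply: contrapT => nx; apply: npq; apply: place_ext.
have pq x : x != 0 -> 0 <= pval p x -> 0 <= pval q x.
  move=> x0 px; rewrite leNgt; apply/negP => qx; apply: nx.
  by exists x.
have vp := pval_valuation p; have vq := pval_valuation q.
have [t t0 pt] := pval_onto p.
have [s s0 qs] := pval_onto q.
have E x : x != 0 -> pval q x = pval q t * pval p x.
  move=> x0; have t0' : t ^ (pval p x) != 0 by rewrite expfz_neq0.
  pose y := x / t ^ (pval p x).
  have y0 : y != 0 by rewrite mulf_neq0 ?invr_eq0.
  have yp : pval p y = 0.
    by rewrite valuM ?invr_eq0 // valuV // valuXz // pt mul1r subrr.
  have yq : pval q y = 0.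
    apply/eqP; rewrite eq_le pq ?yp // andbT.
    by rewrite -oppr_ge0 -valuV // pq ?invr_eq0 // valuV // yp oppr0.
  move: yq; rewrite valuM ?invr_eq0 // valuV // valuXz //.
  by move/eqP; rewrite subr_eq0 => /eqP.
move=> x x0; have := E s s0; rewrite qs.
have : 0 <= pval q t by rewrite pq ?pt.
rewrite (E x x0); case: (pval q t) => // -[|[|n]] _ => [|_|];
  rewrite ?mul0r ?mul1r //.
by move: (pval p s) => [[|m]|m]; lia.
Qed.

Lemma place_separated2 p q : p <> q ->
  exists z, [/\ z != 0, pval p z < 0 & 0 < pval q z].
Proof.
move=> npq; have [x [x0 qx px]] := place_separated (nesym npq).
have [y [y0 py qy]] := place_separated npq.
exists (x / y).
by rewrite mulf_neq0 ?invr_eq0 //; split=> //;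
  rewrite valuM ?valuV ?invr_eq0 //; try exact: pval_valuation; lia.
Qed.

(** Artin-Whaples induction. If [z] is integral at the new place [q], a high power of [z] times a
    separating [y] works. If [z] has a pole there, z^r / (1 + z^r) is a unit at [p] and [q] and has
    high zeros on [s], so that [y] decides at [p] and [q]. *)
Lemma place_separated_seq p (s : seq (place C)) : p \notin s ->
  exists z, [/\ z != 0, pval p z < 0 & forall q, q \in s -> 0 < pval q z].
Proof.
have vp := pval_valuation p.
elim: s => [|q s IH].
  move=> _; have [t t0 pt] := pval_onto p; exists t^-1.
  by rewrite invr_eq0; split=> //; rewrite valuV // pt.
rewrite inE negb_or => /andP[/eqP npq /IH [z [z0 pz sz]]].
have [y [y0 py qy]] := place_separated2 npq.
have vq := pval_valuation q.
have [qz|qz] := leP 0 (pval q z).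
  pose r := \sum_(i <- s) `|pval i y|%N.+1.
  exists (z ^+ r * y); rewrite mulf_neq0 ?expf_neq0 //; split=> //.
    rewrite valuM ?expf_neq0 // valuX // -mulr_natr natz.
    by nia.
  move=> i; rewrite inE => /orP[/eqP->|si].
    by rewrite valuM ?expf_neq0 // valuX // -mulr_natr natz; nia.
  have vi := pval_valuation i.
  rewrite valuM ?expf_neq0 // valuX // -mulr_natr natz.
  have ri : (`|pval i y|%N.+1 <= r)%N.
    by rewrite /r (big_rem i) //= leq_addr.
  by have := sz _ si; nia.
have bnd (i : place C) w : w != 0 -> pval i w < 0 ->
    [/\ 1 + w != 0 & pval i (w / (1 + w)) = 0].
  have vi := pval_valuation i.
  move=> w0 wi; rewrite addrC.
  have h : vge (pval i) (pval i w + 1) 1.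
    by right; rewrite valuation1 //; lia.
  have h0 := valuD_neq0 vi w0 h; split=> //.
  by rewrite valuM ?invr_eq0 // valuV // valuD // subrr.
have bnd2 (i : place C) w : w != 0 -> 0 < pval i w ->
    pval i (1 + w) = 0.
  have vi := pval_valuation i.
  move=> w0 wi; rewrite valuD ?oner_neq0 // ?valuation1 //.
  by right; rewrite ?valuation1 //; lia.
(* The outer successor keeps [r] positive for an empty [s], so that z^r has poles at [p] and [q]. *)
pose r := (\sum_(i <- s) `|pval i y|%N.+1).+1.
have zr0 : z ^+ r != 0 by rewrite expf_neq0.
have pzr : pval p (z ^+ r) < 0 by rewrite valuX // -mulr_natr natz; nia.
have qzr : pval q (z ^+ r) < 0 by rewrite valuX // -mulr_natr natz; nia.
have [h1 h2] := bnd _ _ zr0 pzr; have [h3 h4] := bnd _ _ zr0 qzr.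
have h0 : z ^+ r / (1 + z ^+ r) != 0 by rewrite mulf_neq0 ?invr_eq0.
exists (z ^+ r / (1 + z ^+ r) * y); rewrite mulf_neq0 //; split=> //.
  by rewrite valuM // h2 add0r.
move=> i; rewrite inE => /orP[/eqP->|si].
  by rewrite valuM // h4 add0r.
have vi := pval_valuation i.
have ri : (`|pval i y|%N.+1 <= r)%N.
  by apply: leq_trans (leqnSn _); rewrite (big_rem i) //= leq_addr.
have zi := sz _ si.
have zri : 0 < pval i (z ^+ r) by rewrite valuX // -mulr_natr natz; nia.
rewrite valuM // valuM ?invr_eq0 // valuV // bnd2 // subr0.
by rewrite valuX // -mulr_natr natz; nia.
Qed.

(** w / (w + 1) is close to 1 where [w] has a high pole and close to 0 where it has a high zero. *)
Lemma place_idempotent p (s : seq (place C)) (N : int) : p \notin s ->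
  exists e, vge (pval p) N (e - 1) /\ forall q, q \in s -> vge (pval q) N e.
Proof.
move=> /place_separated_seq[z [z0 pz sz]].
pose r := `|N|%N.+1; pose w := z ^+ r.
have w0 : w != 0 by rewrite expf_neq0.
have vp := pval_valuation p.
have pw : pval p w <= - N.
  by rewrite valuX // -mulr_natr natz; nia.
have pw0 : pval p w < 0.
  by rewrite valuX // -mulr_natr natz; nia.
have h : vge (pval p) (pval p w + 1) 1 by right; rewrite valuation1 //; lia.
have w10 : w + 1 != 0 by apply: valuD_neq0 h.
exists (w / (w + 1)); split.
  have -> : w / (w + 1) - 1 = - (w + 1)^-1.
    by field.
  by apply: vge_opp => //; right; rewrite valuV // valuD //; lia.
move=> q sq; have vq := pval_valuation q; have := sz _ sq => qz.
right; rewrite valuM ?invr_eq0 // valuV // [w + 1]addrC valuD ?oner_neq0 //.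
  by rewrite valuation1 // valuX // -mulr_natr natz; nia.
by right; rewrite valuation1 // valuX // -mulr_natr natz; nia.
Qed.

Lemma weak_approximation (s : seq (place C)) (y : place C -> K) (N : int) :
  uniq s -> exists f, forall p, p \in s -> vge (pval p) N (f - y p).
Proof.
elim: s => [|p s IH] /=; first by exists 0.
case/andP=> ps /IH[f sf].
(* A bound for the poles of the correction [y p - f], by which the precision of [e] is raised. *)
pose b := \sum_(q <- p :: s) `|pval q (y p - f)|%N.
have [e [pe se]] := place_idempotent (N + b%:Z) ps.
have B q : q \in p :: s -> vge (pval q) (- b%:Z) (y p - f).
  move=> qs; right; suff : (`|pval q (y p - f)| <= b)%N by lia.
  by rewrite /b (big_rem q) //= leq_addr.
have vp q := pval_valuation q.
exists (f + e * (y p - f)) => q; rewrite inE => /orP[/eqP->|sq].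
  have -> : f + e * (y p - f) - y p = (e - 1) * (y p - f) by ring.
  by rewrite -[N](addrK b%:Z); apply: vge_mul => //; apply: B; rewrite mem_head.
rewrite addrAC; apply: vge_add => //; first exact: sf.
rewrite -[N](addrK b%:Z); apply: vge_mul => //; first exact: se.
by apply: B; rewrite inE sq orbT.
Qed.

Variable hat : forall p : place C, completion p.

Lemma weak_approximation_completion (s : seq (place C))
    (y : forall p, hat p) (N : int) :
  uniq s -> exists f, forall p, p \in s ->
    vge (@cval _ _ _ (hat p)) N (y p - cemb (hat p) f).
Proof.
move=> us.
have [g gy] := choice (fun p => cemb_dense (y p) N).
have [f fg] := weak_approximation g N us.
exists f => p ps; have vp := cval_valuation (hat p).
have -> : y p - cemb (hat p) f = (y p - cemb (hat p) (g p)) -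
    cemb (hat p) (f - g p) by rewrite rmorphB /=; ring.
apply: vge_sub => //.
have [->|fg0] := eqVneq (f - g p) 0; first by rewrite rmorph0; left.
by right; rewrite cval_emb //; apply/(vgeE _ _ fg0); apply: fg.
Qed.

Lemma vge_emb p n x :
  vge (@cval _ _ _ (hat p)) n (cemb (hat p) x) <-> vge (pval p) n x.
Proof.
have [->|x0] := eqVneq x 0; first by rewrite rmorph0; split=> _; left.
by rewrite !vgeE ?fmorph_eq0 // cval_emb.
Qed.

End Places.

(** * Strong approximation *)

(** Elimination without division: a row [i0] with nonzero last entry is the pivot, and the other
    rows are replaced by the cross products that vanish in the last column. *)
Lemma idomain_dependent_ord (R : idomainType) (n m : nat)
    (A : 'I_m -> 'I_n -> R) : (n < m)%N ->
  exists r : 'I_m -> R, (exists i, r i != 0) /\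
    forall j, \sum_i r i * A i j = 0.
Proof.
elim: n m A => [|n IH] [//|m] A nm.
  by exists (fun _ => 1); split=> [|[]//]; exists ord0; rewrite oner_eq0.
have [[i0 a0]|nopiv] := pselect (exists i, A i ord_max != 0); last first.
  have [|r [r0 rA]] := IH m.+1 (fun i j => A i (widen_ord (leqnSn n) j)).
    exact: ltnW.
  exists r; split=> // j; have [jn|jn] := ltnP j n.
    rewrite -[RHS](rA (Ordinal jn)); apply: eq_bigr => i _.
    by congr (_ * A i _); apply: val_inj.
  apply: big1 => i _; suff -> : A i j = 0 by rewrite mulr0.
  have -> : j = ord_max by apply: val_inj => /=; have := ltn_ord j; lia.
  by apply/eqP; apply: contrapT => /negP ?; apply: nopiv; exists i.
pose w := widen_ord (leqnSn n).
pose B (i : 'I_m) j :=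
  A i0 ord_max * A (lift i0 i) (w j) - A (lift i0 i) ord_max * A i0 (w j).
have [//|r [[i1 r0] rA]] := IH m B.
exists (fun i => if unlift i0 i is Some i' then A i0 ord_max * r i'
  else - \sum_i' r i' * A (lift i0 i') ord_max); split.
  by exists (lift i0 i1); rewrite /= liftK mulf_neq0.
move=> j; rewrite (bigD1_ord i0) //= unlift_none.
under [X in _ + X]eq_bigr do rewrite liftK.
rewrite mulNr mulr_suml addrC -sumrB.
have [jn|jn] := ltnP j n.
  have -> : j = w (Ordinal jn) by apply: val_inj.
  rewrite -[RHS](rA (Ordinal jn)); apply: eq_bigr => i _.
  by rewrite /B; ring.
have -> : j = ord_max by apply: val_inj => /=; have := ltn_ord j; lia.
by apply: big1 => i _; ring.
Qed.

Lemma idomain_dependent (R : idomainType) (J : finType) (m : nat)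
    (A : 'I_m -> J -> R) : (#|J| < m)%N ->
  exists r : 'I_m -> R, (exists i, r i != 0) /\
    forall j, \sum_i r i * A i j = 0.
Proof.
case/(idomain_dependent_ord (fun i j => A i (enum_val j))) => r [r0 rA].
by exists r; split=> // j; have := rA (enum_rank j); rewrite enum_rankK.
Qed.

(** * Linear dependence over polynomial rings in the function field *)

Section Evaluation.
Variables (k K : fieldType) (c : {rmorphism k -> K}).
Implicit Types (t x y : K) (q : {poly k}).

Definition ev t q := (map_poly c q).[t].

Fact ev_zmod t : zmod_morphism (ev t).
Proof. by move=> p q; rewrite /ev rmorphB /= !hornerE. Qed.
Fact ev_monoid t : monoid_morphism (ev t).
Proof. by split=> [|p q]; rewrite /ev ?rmorph1 ?rmorphM /= !hornerE. Qed.
HB.instance Definition _ t :=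
  GRing.isZmodMorphism.Build {poly k} K (ev t) (ev_zmod t).
HB.instance Definition _ t :=
  GRing.isMonoidMorphism.Build {poly k} K (ev t) (ev_monoid t).

Lemma evC t a : ev t a%:P = c a.
Proof. by rewrite /ev map_polyC hornerC. Qed.
Lemma evX t : ev t 'X = t.
Proof. by rewrite /ev map_polyX hornerX. Qed.

Definition transcendental t := forall q, q != 0 -> ev t q != 0.

Lemma transcendental_neq0 t : transcendental t -> t != 0.
Proof. by move/(_ 'X); rewrite evX polyX_eq0; apply. Qed.

(** [b] generates K over k(x); denominators are cleared so that only polynomials in [x] occur. *)
Definition spanned x n (b : 'I_n -> K) := forall y,
  exists d (a : 'I_n -> {poly k}), d != 0 /\
    y * ev x d = \sum_i ev x (a i) * b i.

Definition ev2 t x (u : {poly {poly k}}) := (map_poly (ev t) u).[x].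
Fact ev2_zmod t x : zmod_morphism (ev2 t x).
Proof. by move=> p q; rewrite /ev2 rmorphB /= !hornerE. Qed.
Fact ev2_monoid t x : monoid_morphism (ev2 t x).
Proof. by split=> [|p q]; rewrite /ev2 ?rmorph1 ?rmorphM /= !hornerE. Qed.
HB.instance Definition _ t x :=
  GRing.isZmodMorphism.Build {poly {poly k}} K (ev2 t x) (ev2_zmod t x).
HB.instance Definition _ t x :=
  GRing.isMonoidMorphism.Build {poly {poly k}} K (ev2 t x) (ev2_monoid t x).

Lemma ev2_eval t x u :
  ev2 t x u = (map_poly (map_poly c) u).[x, t].
Proof.
by rewrite -horner2_swapXY horner_swapXY /ev2 -map_poly_comp.
Qed.

Lemma ev2_swapXY t x u : ev2 t x (swapXY u) = ev2 x t u.
Proof. by rewrite !ev2_eval -swapXY_map horner2_swapXY. Qed.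

Lemma ev2C t x q : ev2 t x q%:P = ev t q.
Proof. by rewrite /ev2 map_polyC hornerC. Qed.

Lemma ev2_map_polyC t x q : ev2 t x (map_poly polyC q) = ev x q.
Proof.
rewrite /ev2 -map_poly_comp /ev; congr (_.[_]); apply: eq_map_poly => a /=.
by rewrite evC.
Qed.

Lemma spanned_dependent x n (b : 'I_n -> K) (m : nat) (f : 'I_m -> K) :
  spanned x b -> (n < m)%N ->
  exists r : 'I_m -> {poly k}, (exists i, r i != 0) /\
    \sum_i ev x (r i) * f i = 0.
Proof.
move=> sp nm; have [d dP] := choice (fun i => sp (f i)).
have [a aP] := choice dP.
have [r [[i ri] rA]] := idomain_dependent_ord a nm.
exists (fun i => r i * d i); split.
  by exists i; rewrite mulf_neq0 //; case: (aP i).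
have E i' : ev x (r i' * d i') * f i' = \sum_j ev x (r i' * a i' j) * b j.
  rewrite rmorphM -mulrA [_ * f i']mulrC; have [_ ->] := aP i'.
  by rewrite mulr_sumr; apply: eq_bigr => j _; rewrite rmorphM mulrA.
under eq_bigr do rewrite E.
rewrite exchange_big big1 // => j _.
by rewrite -mulr_suml -rmorph_sum rA rmorph0 mul0r.
Qed.

(** The n + 1 first powers of [t] are dependent over k[x]. With the variables swapped this is an
    equation for [x] over k[t], with leading coefficient [s]; pseudo-division by it leaves a
    remainder of bounded degree in [x]. *)
Lemma transcendental_reduction x n (b : 'I_n -> K) t :
  spanned x b -> transcendental t -> exists s N, s != 0 /\
  forall q : {poly k}, exists M (e : 'I_N -> {poly k}),
    ev t (s ^+ M) * ev x q = \sum_i ev t (e i) * x ^+ i.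
Proof.
move=> sp tt.
have [r [[i ri] rt]] :=
  spanned_dependent (fun j : 'I_n.+1 => t ^+ j) sp (leqnn _).
pose u := \poly_(j < n.+1) r (inord j).
have u0 : u != 0.
  apply: contraNneq ri => u0; have := coef_poly n.+1 (fun j => r (inord j)) i.
  by rewrite -/u u0 coef0 ltn_ord inord_val => ->.
have uxt : ev2 t x (swapXY u) = 0.
  rewrite ev2_swapXY -rt /u poly_def rmorph_sum; apply: eq_bigr => j _ /=.
  rewrite -mul_polyC rmorphM /= ev2C inord_val rmorphXn /=; congr (_ * _ ^+ _).
  by rewrite /ev2 map_polyX hornerX.
set P := swapXY u in uxt.
have P0 : P != 0 by rewrite swapXY_eq0.
exists (lead_coef P), (size P); rewrite lead_coef_eq0; split=> // q.
have := Pdiv.Idomain.divp_eq (map_poly polyC q) P.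
set M := Pdiv.Idomain.scalp _ _; set R := Pdiv.Idomain.modp _ _.
move/(congr1 (ev2 t x)); rewrite rmorphD rmorphM /= uxt mulr0 add0r.
rewrite -mul_polyC rmorphM /= ev2C ev2_map_polyC => E.
exists M, (fun i => R`_i); rewrite E /ev2 (@horner_coef_wide _ (size P)).
  by apply: eq_bigr => j _; rewrite coef_map.
apply: leq_trans (size_poly _ _) _.
by apply: ltnW; rewrite Pdiv.Idomain.ltn_modp.
Qed.

(* Dividing a relation by the largest power of t common to its coefficients
   keeps it nontrivial at t = 0.  The bound N limits both the number of zeros
   of t and the residue degrees at them. *)
Lemma transcendental_dependent x n (b : 'I_n -> K) t :
  transcendental x -> spanned x b -> transcendental t -> exists N,
  forall m (f : 'I_m -> K), (N < m)%N ->
  exists r : 'I_m -> {poly k}, (exists i, (r i).[0] != 0) /\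
    \sum_i ev t (r i) * f i = 0.
Proof.
move=> tx sp tt; have [s [N [s0 red]]] := transcendental_reduction sp tt.
have t0 := transcendental_neq0 tt.
exists #|{: 'I_n * 'I_N}| => m f Nm.
suff [r [[i ri] rf]] : exists r : 'I_m -> {poly k}, (exists i, r i != 0) /\
    \sum_i ev t (r i) * f i = 0.
  have [l] := ubnP (size (r i)); elim: l r ri rf => // l IH r ri rf rl.
  have [?|all0] := pselect (exists j, (r j).[0] != 0); first by exists r.
  have /choice[r' rr'] j : exists q, r j = q * 'X.
    have r0 : (r j).[0] = 0.
      by apply/eqP/negPn/negP => ?; apply: all0; exists j.
    have /factor_theorem[q ->] : root (r j) 0 by apply/rootP.
    by exists q; rewrite subr0.
  have r'i : r' i != 0 by apply: contraNneq ri => r'0; rewrite rr' r'0 mul0r.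
  apply: (IH r') => //; last first.
    by move: rl; rewrite rr' size_mulX.
  apply/eqP; rewrite -(mulIr_eq0 _ (mulIf t0)) mulr_suml; apply/eqP.
  by rewrite -[RHS]rf; apply: eq_bigr => j _; rewrite rr' rmorphM /= evX mulrAC.
have [d dP] := choice (fun i => sp (f i)).
have [a aP] := choice dP.
(* With the other denominators included, each [f i] times the product of all [d l] and a power of
   [s] is a k[t]-combination of the same products of a power of [x] and a [b j]. The exponent [S i]
   below serves all [j]. *)
have [M MP] := choice (fun ij : 'I_m * 'I_n => red (a ij.1 ij.2 *
  \prod_(l | l != ij.1) d l)).
have [e eP] := choice MP.
pose S i := \sum_j M (i, j).
pose A (i : 'I_m) (jl : 'I_n * 'I_N) :=
  s ^+ (S i - M (i, jl.1))%N * e (i, jl.1) jl.2.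
have [r [[i ri] rA]] := idomain_dependent A Nm.
exists (fun i => r i * s ^+ S i); split.
  by exists i; rewrite mulf_neq0 ?expf_neq0.
have D0 : ev x (\prod_l d l) != 0.
  by apply: tx; rewrite prodf_seq_neq0; apply/allP => l _; case: (aP l).
apply/eqP; rewrite -(mulIr_eq0 _ (mulIf D0)); apply/eqP.
have E i' : ev t (r i' * s ^+ S i') * f i' * ev x (\prod_l d l) =
    \sum_jl ev t (r i' * A i' jl) * (x ^+ jl.2 * b jl.1).
  set Q := \prod_(l | l != i') d l.
  transitivity (ev t (r i' * s ^+ S i') * (f i' * ev x (d i')) * ev x Q).
    by rewrite (bigD1 i') //= [ev x (_ * _)]rmorphM /=; ring.
  have [_ ->] := aP i'; rewrite [ev t (_ * _)]rmorphM /= -mulrA mulr_suml.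
  rewrite mulr_sumr.
  rewrite -(pair_bigA _ (fun j l => ev t (r i' * A i' (j, l)) * (x ^+ l * b j))).
  apply: eq_bigr => j _ /=.
  have SM : S i' = (S i' - M (i', j) + M (i', j))%N.
    by rewrite subnK // /S (bigD1 j) //= leq_addr.
  rewrite {1}SM exprD rmorphM /= mulrAC.
  have := eP (i', j); rewrite /= rmorphM /= => ePij.
  transitivity (ev t (r i') * ev t (s ^+ (S i' - M (i', j))) * b j *
     (ev t (s ^+ M (i', j)) * (ev x (a i' j) *
     ev x (\prod_(l | l != i') d l)))); first by ring.
  rewrite ePij mulr_sumr; apply: eq_bigr => l _.
  by rewrite /A !rmorphM /=; ring.
rewrite mulr_suml /=; under eq_bigr do rewrite E.
rewrite exchange_big big1 // => jl _.
by rewrite -mulr_suml -rmorph_sum rA rmorph0 mul0r.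
Qed.

End Evaluation.

(** * Characters of finite abelian groups *)

Lemma finite_enumeration (T : Type) : finite_set [set: T]%classic ->
  exists n (t : 'I_n -> T) (r : T -> 'I_n), cancel t r /\ cancel r t.
Proof.
move=> fin; have fin' : finite_set [set: {classic T}]%classic by [].
have /finite_seqP[s sE] := fin'.
have sP (x : {classic T}) : x \in undup s.
  by rewrite mem_undup; have := congr1 (@^~ x) sE => /= <-.
have rP (x : {classic T}) : (index x (undup s) < size (undup s))%N.
  by rewrite index_mem.
exists (size (undup s)), (fun i => tnth (in_tuple (undup s)) i : {classic T}),
  (fun x => Ordinal (rP x)); split=> [i|x].
  apply: val_inj => /=; rewrite (tnth_nth (tnth (in_tuple (undup s)) i)).
  by rewrite index_uniq ?undup_uniq.
by rewrite (tnth_nth (x : {classic T})) /= nth_index.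
Qed.

Section FiniteAbelianGroup.
Variables (T : Type) (one : T) (mul : T -> T -> T) (inv : T -> T).
Hypothesis mulA : associative mul.
Hypothesis mulC : commutative mul.
Hypothesis mul1 : left_id one mul.
Hypothesis mulV : left_inverse one inv mul.
Hypothesis Tfin : finite_set [set: T]%classic.
Variable F : numClosedFieldType.

Definition is_character (chi : T -> F) :=
  chi one = 1 /\ forall x y, chi (mul x y) = chi x * chi y.

Let mulK x y : mul (inv x) (mul x y) = y.
Proof. by rewrite mulA mulV mul1. Qed.

Let mulVK x y : mul x (mul (inv x) y) = y.
Proof. by rewrite mulA [mul x _]mulC mulV mul1. Qed.

Lemma is_characterV chi x : is_character chi -> chi x * chi (inv x) = 1.
Proof. by case=> c1 cM; rewrite -cM mulC mulV. Qed.

Section Enumerated.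
Variables (n : nat) (t : 'I_n -> T) (r : T -> 'I_n).
Hypothesis tK : cancel t r.
Hypothesis rK : cancel r t.

Let sum_translate x (f : T -> F) : \sum_i f (mul x (t i)) = \sum_i f (t i).
Proof.
rewrite [RHS](reindex (fun i => r (mul x (t i)))) /=; last first.
  exists (fun i => r (mul (inv x) (t i))) => i _.
    by rewrite rK mulK tK.
  by rewrite rK mulVK tK.
by apply: eq_bigr => i _; rewrite rK.
Qed.

(** The value at the inverse stands for the complex conjugate. Translating by an [x] where the
    characters differ multiplies the sum by a factor other than 1. *)
Lemma characters_orthogonal chi chi' : is_character chi -> is_character chi' ->
  \sum_i chi (t i) * chi' (inv (t i)) = if `[< chi = chi' >] then n%:R else 0.
Proof.
move=> hchi hchi'; case: asboolP => [<-|ne].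
  rewrite (eq_bigr (fun _ => 1)) ?sumr_const ?card_ord //.
  by move=> i _; exact: is_characterV.
have [x nx] : exists x, chi x != chi' x.
  apply: contrapT => nx; apply: ne; apply/funext => x.
  by apply/eqP/negPn/negP => h; apply: nx; exists x.
set s := \sum_i _; have : (chi x * chi' (inv x)) * s = s.
  rewrite -[RHS](sum_translate x (fun y => chi y * chi' (inv y))) mulr_sumr.
  apply: eq_bigr => i _.
  have -> : inv (mul x (t i)) = mul (inv x) (inv (t i)).
    apply/esym; rewrite -[LHS](mulK (mul x (t i))).
    rewrite (mulA (mul x _)) [mul (mul x _) _]mulC mulK [mul (t i) _]mulC mulV.
    by rewrite mulC mul1.
  by rewrite !(hchi.2, hchi'.2); ring.
move/eqP; rewrite -subr_eq0 -{2}[s]mul1r -mulrBl mulf_eq0 => /orP[|/eqP//].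
rewrite subr_eq0 => /eqP E; move: nx; rewrite -subr_eq0.
rewrite -[chi x]mulr1 -(is_characterV x hchi') [chi' x * _]mulrC mulrA E mul1r.
by rewrite subrr eqxx.
Qed.

Lemma enumeration_gt0 : (0 < n)%N.
Proof. by case: n (r one) => // -[]. Qed.

Lemma characters_free (m : nat) (e : 'I_m -> T -> F) (c : 'I_m -> F) :
  injective e -> (forall i, is_character (e i)) ->
  (forall x, \sum_i c i * e i x = 0) -> forall i, c i = 0.
Proof.
move=> ei he rel i.
have : \sum_l (\sum_j c j * e j (t l)) * e i (inv (t l)) = 0.
  by apply: big1 => l _; rewrite rel mul0r.
under eq_bigr do rewrite mulr_suml.
rewrite exchange_big /= (bigD1 i) //= [X in _ + X]big1 => [|j ji].
  rewrite addr0; under eq_bigr do rewrite -mulrA.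
  rewrite -mulr_sumr characters_orthogonal // asboolT //.
  move/eqP; rewrite mulf_eq0 pnatr_eq0 => /orP[/eqP//|].
  by have := enumeration_gt0; case: (n).
under eq_bigr do rewrite -mulrA.
rewrite -mulr_sumr characters_orthogonal // asboolF ?mulr0 //.
by move/ei => E; rewrite E eqxx in ji.
Qed.

(** The regular representation on row vectors. *)
Definition translation x : 'M[F]_n :=
  \matrix_(i, j) (i == r (mul x (t j)))%:R.

Lemma mul_translation (v : 'rV[F]_n) x j :
  (v *m translation x) 0 j = v 0 (r (mul x (t j))).
Proof.
rewrite mxE (bigD1 (r (mul x (t j)))) //= mxE eqxx mulr1 big1 ?addr0 // => i ni.
by rewrite mxE (negPf ni) mulr0.
Qed.

Lemma translationM x y : translation x *m translation y = translation (mul x y).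
Proof.
apply/row_matrixP => i; rewrite !rowE mulmxA; apply/rowP => j.
by rewrite !mul_translation rK mulA.
Qed.

Lemma translation1 : translation one = 1%:M.
Proof.
apply/row_matrixP => i; rewrite !rowE; apply/rowP => j.
by rewrite mul_translation mul1 tK mulmx1.
Qed.

Definition power x m := iter m (mul x) one.

Lemma power_add x a b : power x (a + b) = mul (power x a) (power x b).
Proof.
elim: a => [|a IH]; first by rewrite mul1.
by rewrite addSn /power !iterS -!/(power _ _) IH mulA.
Qed.

Lemma power_order x : exists2 m, (0 < m)%N & power x m = one.
Proof.
have [i [j [ij pij]]] : exists a b, (a < b)%N /\ power x a = power x b.
  apply: contrapT => nex.
  have inj : injective (fun a : 'I_n.+1 => r (power x a)).
    move=> a b /(can_inj rK) pab; apply: val_inj => /=.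
    by case: (ltngtP a b) => // ab; case: nex; [exists a, b|exists b, a].
  by have := leq_card _ inj; rewrite !card_ord ltnn.
exists (j - i)%N; first by rewrite subn_gt0.
move: pij; rewrite -{1}(subnK (ltnW ij)) power_add mulC => /(congr1 (mul (inv (power x i)))).
by rewrite mulK mulV.
Qed.

End Enumerated.

(** The matrix is annihilated by X^m - 1, which splits over [F] and is separable in characteristic
    0. *)
Lemma translation_diagonalizable n (t : 'I_n.+1 -> T) (r : T -> 'I_n.+1) x :
  cancel t r -> cancel r t -> diagonalizable (translation t r x).
Proof.
move=> tK rK; have [m m0 pm] := power_order rK x.
apply/diagonalizableP.
have [rs rsE] := closed_field_poly_normal ('X^m - 1 : {poly F}).
have lc : lead_coef ('X^m - 1 : {poly F}) = 1.
  by apply/monicP; exact: monicXnsubC.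
exists rs.
  rewrite -separable_prod_XsubC; move: rsE; rewrite lc scale1r => <-.
  by apply: separable_Xn_sub_1; rewrite pnatr_eq0 -lt0n.
move: rsE; rewrite lc scale1r => <-.
apply: mxminpoly_min; rewrite rmorphB rmorphXn rmorph1 /= horner_mx_X.
have tp a : translation t r x ^+ a = translation t r (power x a).
  elim: a => [|a IH]; first by rewrite expr0 translation1.
  by rewrite exprS IH -translationM.
by rewrite tp pm translation1 // subrr.
Qed.

(** The commuting translations are diagonalized simultaneously. A row of [P] is a common
    eigenvector, hence determined by its entry at the identity; that entry is nonzero, and dividing
    by it gives a character. As [P] is invertible, these characters span, with no need to count
    them. *)
Lemma characters_span (s : T -> F) :
  exists m (e : 'I_m -> T -> F) (c : 'I_m -> F),
  (forall i, is_character (e i)) /\ forall x, s x = \sum_i c i * e i x.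
Proof.
have [n [t [r [tK rK]]]] := finite_enumeration Tfin.
case: n t r tK rK => [t r|n t r tK rK]; first by case: (r one) => -[].
have [P Pu /allP PP] : codiagonalizable [seq translation t r (t i) | i : 'I_n.+1].
  apply/codiagonalizableP; split.
    move=> _ _ /mapP[i _ ->] /mapP[j _ ->].
    by rewrite /comm_mx !translationM // mulC.
  by move=> _ /mapP[i _ ->]; exact: translation_diagonalizable.
have eig x : exists d : 'rV[F]_n.+1, P *m translation t r x = diag_mx d *m P.
  have /PP /diagonalizable_forPex[d /(simmxP Pu) E] :
     translation t r x \in [seq translation t r (t i) | i : 'I_n.+1].
    by apply/mapP; exists (r x); rewrite ?mem_enum ?rK.
  by exists d.
have [d dP] := choice eig.
have PE i x y : P i (r (mul x y)) = d x 0 i * P i (r y).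
  have : (row i P *m translation t r x) 0 (r y) =
      (row i (diag_mx (d x) *m P)) 0 (r y) by rewrite -row_mul dP.
  by rewrite mul_translation rK mul_diag_mx !mxE.
have P1 i : P i (r one) != 0.
  apply/eqP => p0.
  have : row i P = 0.
    apply/rowP => j; rewrite !mxE -[j]tK -[t j]mul1 mulC.
    by rewrite PE p0 mulr0.
  move/(congr1 (fun v => v *m invmx P)); rewrite -row_mul mulmxV // mul0mx.
  move/rowP/(_ i); rewrite !mxE eqxx => /eqP; by rewrite oner_eq0.
pose chi i x := P i (r x) / P i (r one).
pose c i := (\row_j s (t j) *m invmx P) 0 i * P i (r one).
exists n.+1, chi, c; split=> [i|x].
  split=> [|x y]; first by rewrite /chi divff.
  have E z : P i (r z) = d z 0 i * P i (r one) by rewrite -PE mulC mul1.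
  by rewrite /chi PE (E x) (E y); field.
have -> : s x = (\row_j s (t j) *m invmx P *m P) 0 (r x).
  by rewrite mulmxKV // mxE rK.
rewrite mxE; apply: eq_bigr => i _; rewrite /c /chi; field.
exact: P1.
Qed.

End FiniteAbelianGroup.

Local Open Scope classical_set_scope.

(** * Zeros and poles of functions, residue fields *)

Section GlobalField.
Variables (k : finFieldType) (C : curve k).
Local Notation K := (funfield C).
Local Notation ev := (ev (const C)).
Implicit Types (p : place C) (x y t : K) (q : {poly k}).

Lemma vge_const p (c : k) : vge (pval p) 0 (const C c).
Proof. by right; rewrite pval_const. Qed.

Lemma ev_integral p t q : vge (pval p) 0 t -> vge (pval p) 0 (ev t q).
Proof.
have vp := pval_valuation p; move=> t0.
elim/poly_ind: q => [|q c IH]; first by rewrite rmorph0; left.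
rewrite rmorphD rmorphM /= evX evC; apply: vge_add => //.
  exact: vge_mul0.
exact: vge_const.
Qed.

Lemma ev_unit p t q : vge (pval p) 1 t -> q.[0] != 0 ->
  ev t q != 0 /\ pval p (ev t q) = 0.
Proof.
have vp := pval_valuation p; move=> t1.
elim/poly_ind: q => [|q c _]; first by rewrite horner0 eqxx.
rewrite !hornerE /= => c0.
have C0 : const C c != 0 by rewrite fmorph_eq0.
have h : vge (pval p) (pval p (const C c) + 1) (ev t (q * 'X)).
  rewrite pval_const add0r rmorphM /= evX -[1]add0r.
  apply: vge_mul => //; apply: ev_integral; exact: vge_le t1.
rewrite addrC rmorphD /= evC; split; first exact: valuD_neq0 h.
by rewrite valuD // pval_const.
Qed.

(** If q(0) is nonzero, q(t) is a unit at [p]; otherwise a factor X is split off, which contributes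
    the nonzero factor [t]. *)
Lemma zero_transcendental p t : t != 0 -> 0 < pval p t ->
  transcendental (const C) t.
Proof.
move=> t0 pt; have t1 : vge (pval p) 1 t by right; lia.
move=> q; have [n] := ubnP (size q); elim: n q => // n IH q qn q0.
have [r0|r0] := eqVneq q.[0] 0; last by have [] := ev_unit t1 r0.
have /factor_theorem[r qr] : root q 0 by apply/rootP.
move: qn q0; rewrite {}qr subr0 => qn q0.
have r1 : r != 0 by apply: contraNneq q0 => ->; rewrite mul0r.
rewrite rmorphM /= evX mulf_neq0 // IH //.
by move: qn; rewrite size_mulX.
Qed.

Lemma function_field_dependent t : transcendental (const C) t -> exists N,
  forall m (f : 'I_m -> K), (N < m)%N ->
  exists r : 'I_m -> {poly k}, (exists i, (r i).[0] != 0) /\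
    \sum_i ev t (r i) * f i = 0.
Proof.
have [x [n [b [tx sp]]]] := funfieldP C.
exact: (@transcendental_dependent _ _ (const C) x n b).
Qed.

(** At N + 1 zeros of [y], weak approximation gives functions [e i] congruent to the Kronecker
    delta. In a relation between them over k[y], a coefficient with nonzero constant term is a unit
    at its zero, yet the relation makes it vanish there. *)
Lemma finite_zeros y : y != 0 -> finite_set [set p | 0 < pval p y].
Proof.
move=> y0; apply: contrapT => inf.
have [p0 /= py] := infinite_setN0 inf.
have [N dep] := function_field_dependent (zero_transcendental y0 py).
have [X XS XN] := infinite_set_fset N.+1 inf.
pose s : seq (place C) := X.
have us : uniq s by exact: fset_uniq.
have sN : (N < size s)%N by [].
have sP p : p \in s -> 0 < pval p y by move=> /XS.
pose P (i : 'I_(size s)) := nth p0 s i.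
have Ps i : P i \in s by apply: mem_nth.
have /choice[e eP] i : exists e, vge (pval (P i)) 1 (e - 1) /\
    forall j, j != i -> vge (pval (P j)) 1 e.
  have [|e [e1 e2]] := @place_idempotent _ _ (P i) (rem (P i) s) 1.
    by rewrite mem_rem_uniqF.
  exists e; split=> // j ji; apply: e2.
  rewrite mem_rem_uniq // inE Ps andbT /= /P nth_uniq //.
have [r [[i ri] rel]] := dep _ e sN.
have vp := pval_valuation (P i).
have y1 : vge (pval (P i)) 1 y.
  by right; have := sP _ (Ps i); lia.
have [u0 u1] := ev_unit y1 ri.
suff : vge (pval (P i)) 1 (ev y (r i)) by move=> /(vgeE _ _ u0); rewrite u1.
have -> : ev y (r i) = (\sum_j ev y (r j) * e j) -
  (ev y (r i) * (e i - 1) + \sum_(j | j != i) ev y (r j) * e j).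
  by rewrite (bigD1 i) //=; ring.
have r0 j : vge (pval (P i)) 0 (ev y (r j)).
  by apply: ev_integral; apply: vge_le y1.
rewrite rel sub0r; apply: vge_opp => //; apply: vge_add => //.
  by apply: vge_mul0 => //; have [] := eP i.
apply: vge_sum => // j ji; apply: vge_mul0 => //.
by have [_] := eP j; apply; rewrite eq_sym.
Qed.

Lemma finite_divisor y : finite_set [set p | pval p y != 0].
Proof.
have [->|y0] := eqVneq y 0.
  apply: sub_finite_set (finite_set0 _) => p /=.
  by rewrite pval0 eqxx.
have yV0 : y^-1 != 0 by rewrite invr_eq0.
have : finite_set ([set p | 0 < pval p y] `|` [set p | 0 < pval p y^-1]).
  by rewrite finite_setU; split; apply: finite_zeros.
apply: sub_finite_set => p /=.
by rewrite valuV //; [lia|exact: pval_valuation].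
Qed.

(** For a uniformizer [t], a relation over k[t] that is nontrivial at t = 0 becomes a k-linear
    relation between residues. So at most N residues are independent over the finite field k,
    whereas an infinite residue field would give independent families of every length. *)
Lemma finite_residue p : exists S : seq K, forall x, vge (pval p) 0 x ->
  exists2 s, s \in S & vge (pval p) 1 (x - s).
Proof.
have vp := pval_valuation p.
have [t t0 pt] := pval_onto p.
have tt : transcendental (const C) t.
  by apply: (@zero_transcendental p) => //; rewrite pt.
have [N dep] := function_field_dependent tt.
have t1 : vge (pval p) 1 t by right; rewrite pt.
apply: contrapT => nfin.
suff ind m : exists f : 'I_m -> K, (forall i, vge (pval p) 0 (f i)) /\
    forall c : 'I_m -> k, vge (pval p) 1 (\sum_i const C (c i) * f i) ->
    forall i, c i = 0.
  have [f [f0 fi]] := ind N.+1.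
  have [r [[i ri] rel]] := dep _ f (leqnn _).
  suff /fi /(_ i) : vge (pval p) 1 (\sum_j const C (r j).[0] * f j).
    by apply/eqP.
  have /choice[r' rr'] j : exists q, r j = q * 'X + ((r j).[0])%:P.
    elim/poly_ind: (r j) => [|q c _]; first by exists 0; rewrite horner0 mul0r addr0.
    by exists q; rewrite !hornerE.
  have -> : \sum_j const C (r j).[0] * f j = 0 - \sum_j ev t (r' j) * t * f j.
    rewrite -[X in X - _]rel -sumrB; apply: eq_bigr => j _.
    by rewrite {2}rr' rmorphD rmorphM /= evC evX; ring.
  rewrite sub0r; apply: vge_opp => //; apply: vge_sum => // j _.
  rewrite mulrC; apply: vge_mul0 => //; apply: vge_mul0 => //.
  by apply: ev_integral; apply: vge_le t1.
elim: m => [|m [f [f0 fi]]].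
  by exists (fun _ => 0); split=> // [[]|c _ []].
pose S := [seq \sum_i const C (c i) * f i | c : {ffun 'I_m -> k}].
have [x [x0 xS]] : exists x, vge (pval p) 0 x /\
    forall s, s \in S -> ~ vge (pval p) 1 (x - s).
  apply: contrapT => nx; apply: nfin; exists S => x x0.
  apply: contrapT => xS; apply: nx; exists x; split=> // s sS xs.
  by apply: xS; exists s.
exists (fun i => if unlift ord_max i is Some j then f j else x); split.
  by move=> i; case: unliftP.
move=> c; rewrite (bigD1_ord ord_max) //= unlift_none.
under [X in _ + X]eq_bigr do rewrite liftK.
move=> h; have cx : c ord_max = 0.
  apply/eqP/negPn/negP => cx.
  pose c' : {ffun 'I_m -> k} := [ffun i => - c (lift ord_max i) / c ord_max].
  apply: (xS (\sum_i const C (c' i) * f i)).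
    by apply/mapP; exists c' => //; rewrite mem_enum.
  have -> : x - \sum_i const C (c' i) * f i = const C (c ord_max)^-1 *
     (const C (c ord_max) * x + \sum_i const C (c (lift ord_max i)) * f i).
    rewrite mulrDr mulrA -rmorphM mulVf // rmorph1 mul1r; congr (_ + _).
    rewrite mulr_sumr -sumrN; apply: eq_bigr => i _.
    by rewrite ffunE rmorphM rmorphN /=; ring.
  by apply: vge_mul0 => //; apply: vge_const.
move: h; rewrite cx rmorph0 mul0r add0r => /fi c0 i.
by case: (unliftP ord_max i) => [j ->|->].
Qed.

Lemma val_ev_neg p x q : x != 0 -> pval p x < 0 -> q != 0 ->
  ev x q != 0 /\ pval p (ev x q) = pval p x *+ (size q).-1.
Proof.
have vp := pval_valuation p; move=> x0 px.
elim/poly_ind: q => [|q c IH]; first by rewrite eqxx.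
have [->|q0] := eqVneq q 0.
  rewrite mul0r add0r polyC_eq0 => c0; rewrite size_polyC c0 evC /=.
  by rewrite mulr0n pval_const fmorph_eq0.
have [e0 eq] := IH q0 => _; rewrite size_MXaddC (negPf q0) /=.
have sq : (size q).-1.+1 = size q by rewrite prednK // size_poly_gt0.
have m0 : ev x (q * 'X) != 0 by rewrite rmorphM /= evX mulf_neq0.
have m1 : pval p (ev x (q * 'X)) = pval p x *+ size q.
  by rewrite rmorphM /= evX valuM // eq -{2}sq mulrSr.
have h : vge (pval p) (pval p (ev x (q * 'X)) + 1) (ev x c%:P).
  rewrite evC; apply: vge_le (vge_const p c).
  by rewrite m1 -sq mulrS -mulr_natr natz; nia.
by rewrite rmorphD valuD // m1; split=> //; apply: valuD_neq0 h.
Qed.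

(** Otherwise all nonzero polynomials in [x] are units at [p]. The terms of a relation over k[x]
    between powers of a uniformizer then have distinct valuations, and the lowest one cannot
    cancel. *)
Lemma place_above_poly p x n (b : 'I_n -> K) :
  spanned (const C) x b -> vge (pval p) 0 x ->
  transcendental (const C) x ->
  exists q, q != 0 /\ 0 < pval p (ev x q).
Proof.
have vp := pval_valuation p; move=> sp px tx; apply: contrapT => nq.
have v0 q : q != 0 -> pval p (ev x q) = 0.
  move=> q0; have /(vgeE _ _ (tx _ q0)) h := ev_integral q px.
  apply/eqP; rewrite eq_le h andbT leNgt; apply/negP => lt.
  by apply: nq; exists q.
have [t t0 pt] := pval_onto p.
have [r [ex rel]] :=
  spanned_dependent (fun j : 'I_n.+1 => t ^+ j) sp (leqnn _).
case: ex => i0 ri0.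
case: (@arg_minnP _ i0 (fun i => r i != 0) (fun i => nat_of_ord i) ri0) => i ri imin.
have n0 : ev x (r i) * t ^+ i != 0 by rewrite mulf_neq0 ?expf_neq0 // tx.
have val : pval p (ev x (r i) * t ^+ i) = i.
  by rewrite valuM ?expf_neq0 ?tx // v0 // valuX // pt add0r natz.
suff : vge (pval p) (pval p (ev x (r i) * t ^+ i) + 1) (ev x (r i) * t ^+ i).
  by move=> /(vgeE _ _ n0); rewrite gerDl.
have -> : vge (pval p) (pval p (ev x (r i) * t ^+ i) + 1) (ev x (r i) * t ^+ i) =
   vge (pval p) (i%:Z + 1) (0 - \sum_(j | j != i) ev x (r j) * t ^+ j).
  by rewrite val -[X in X - _]rel (bigD1 i) //= addrK.
rewrite sub0r; apply: vge_opp => //; apply: vge_sum => // j ji.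
have [->|rj] := eqVneq (r j) 0; first by rewrite rmorph0 mul0r; left.
right; rewrite valuM ?expf_neq0 ?tx // v0 // valuX // pt add0r natz.
have /= := imin _ rj; rewrite leq_eqVlt => /orP[/eqP ij|]; last lia.
by move: ji; rewrite -val_eqE /= -ij eqxx.
Qed.

(** Gcds with [a] are split off until the rest is prime to [a]; each factor removed divides [a]. *)
Lemma poly_coprime_split (d a : {poly k}) : d != 0 -> exists d1 d2 N,
  [/\ d = d1 * d2, coprimep d2 a & d1 %| a ^+ N].
Proof.
have [n] := ubnP (size d); elim: n d => // n IH d dn d0.
have [cop|ncop] := boolP (coprimep d a).
  by exists 1, d, 0%N; rewrite mul1r expr0.
have g0 : gcdp d a != 0 by rewrite gcdp_eq0 negb_and d0.
have gd := divpK (dvdp_gcdl d a).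
have q0 : d %/ gcdp d a != 0 by apply: contraNneq d0 => q0; rewrite -gd q0 mul0r.
have [|//|d1 [d2 [N [e1 e2 e3]]]] := IH (d %/ gcdp d a).
  rewrite -ltnS; apply: leq_trans dn; rewrite ltnS.
  have -> : size d = (size (d %/ gcdp d a) + size (gcdp d a)).-1.
    by rewrite -size_mul // gd.
  move: ncop; rewrite /coprimep.
  have : (0 < size (gcdp d a))%N by rewrite size_poly_gt0.
  by move: (size _) (size _) => m1 m2; lia.
exists (d1 * gcdp d a), d2, N.+1; split=> //.
  by rewrite -[LHS]gd e1; ring.
by rewrite exprS mulrC dvdp_mul // dvdp_gcdr.
Qed.

(** Partial fractions r/(d1 d2) = u/d1 + w/d2 with cleared denominators; w/d2 is proper, hence
    integral at the poles of [x]. *)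
Lemma proper_bezout (d1 d2 r : {poly k}) : coprimep d1 d2 -> d2 != 0 ->
  exists u w, r = u * d2 + w * d1 /\ (size w < size d2)%N.
Proof.
move=> /Bezout_eq1_coprimepP[[u0 v0] /= uv] d20.
exists (r * v0 + ((r * u0) %/ d2) * d1), ((r * u0) %% d2).
split; last by rewrite ltn_modp.
transitivity (r * (u0 * d1 + v0 * d2)); first by rewrite uv mulr1.
have := divp_eq (r * u0) d2; move: (_ %/ _) (_ %% _) => A B E.
by rewrite mulrDr !mulrA E; ring.
Qed.

Variable hat : forall p : place C, completion p.

(* Let a be a polynomial in x that vanishes at the places where x is integral
   and y is not, and f close to y at the finitely many places where a vanishes
   or x has a pole.  Of each coordinate of f on the basis b, written in partial
   fractions, keep the part u/d1 with d1 dividing a power of a: the other part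
   w/d2 is proper and d2 is prime to a. *)
Theorem strong_approximation : exists D : place C -> int,
  [/\ finite_set [set p | D p != 0], forall p, D p <= 0 &
  forall y : adele hat, exists f, forall p,
    vge (@cval _ _ _ (hat p)) (D p) (y p - cemb (hat p) f)].
Proof.
have [x [n [b [tx sp]]]] := funfieldP C.
have {}tx : transcendental (const C) x by [].
have {}sp : spanned (const C) x b by [].
have x0 := transcendental_neq0 tx.
(* The coordinates on the basis will be made integral, so only the poles of [b] have to be
   allowed. *)
pose D p : int := - (\sum_j `|pval p (b j)|%N)%:Z.
exists D; split.
- have fin : finite_set (\bigcup_(j in [set: 'I_n]) [set p | pval p (b j) != 0]).
    by apply: bigcup_finite => // j _; apply: finite_divisor.
  apply: sub_finite_set fin => p /=; rewrite /D oppr_eq0 => S0.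
  apply: contrapT => nb; move/negP: S0; apply.
  rewrite (eq_bigr (fun _ => 0%N)) ?sum_nat_const ?muln0 // => j _.
  by apply/eqP; rewrite absz_eq0; apply/negPn/negP => h; apply: nb; exists j.
- by move=> p; rewrite /D; lia.
have Db p j : vge (pval p) (D p) (b j).
  right; rewrite /D (bigD1 j) //=; lia.
have D0 p : D p <= 0 by rewrite /D; lia.
move=> y.
have /finite_seqP[T0 T0E] := avalP y.
have /choice[ap apP] p : exists q, q != 0 /\
    (vge (pval p) 0 x -> 0 < pval p (ev x q)).
  have [px|px] := pselect (vge (pval p) 0 x); last first.
    by exists 1; rewrite oner_neq0; split.
  by have [q [q0 qp]] := place_above_poly sp px tx; exists q.
pose a := \prod_(p <- T0) ap p.
have a0 : a != 0.
  by rewrite prodf_seq_neq0; apply/allP => p _; have [] := apP p.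
have /finite_seqP[T1 T1E] :
    finite_set [set p | 0 < pval p (ev x a) \/ pval p x < 0].
  have : finite_set ([set p | pval p (ev x a) != 0] `|`
                     [set p | pval p x != 0]).
    by rewrite finite_setU; split; apply: finite_divisor.
  by apply: sub_finite_set => p /= [h|h]; [left|right]; lia.
pose T := undup T1.
have TP p : p \in T <-> 0 < pval p (ev x a) \/ pval p x < 0.
  by rewrite mem_undup; move: (congr1 (@^~ p) T1E) => /= <-.
have yT p : p \notin T -> vge (@cval _ _ _ (hat p)) 0 (y p).
  move=> pT; apply: contrapT => py; move/negP: pT; apply; apply/TP.
  have pT0 : p \in T0 by move: (congr1 (@^~ p) T0E) => /= <-.
  have [px|px] := ltP (pval p x) 0; [by right|left].
  have vx : vge (pval p) 0 x by right.
  have vp := pval_valuation p.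
  have [ap0 /(_ vx) app] := apP p.
  rewrite /a (big_rem p) //= rmorphM /= valuM ?tx //; last first.
    by rewrite prodf_seq_neq0; apply/allP => q _; have [] := apP q.
  have := ev_integral (\prod_(q <- rem p T0) ap q) vx.
  move=> /vgeE h; have := h _; rewrite ltr_wpDr //; apply: h.
  by rewrite tx // prodf_seq_neq0; apply/allP => q _; have [] := apP q.
have [f fP] := weak_approximation_completion y 0 (undup_uniq T1 : uniq T).
have [d [r [d0 fd]]] := sp f.
have [d1 [d2 [N [dd cop2 dvd1]]]] := poly_coprime_split a d0.
move: d0; rewrite dd mulf_eq0 negb_or => /andP[d10 d20].
have cop12 : coprimep d1 d2.
  rewrite coprimep_sym; apply: coprimep_dvdl dvd1 _.
  by rewrite coprimep_expr.
have /choice[u uP] j := proper_bezout (r j) cop12 d20.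
have /choice[w wP] := uP.
have e1 := tx _ d10; have e2 := tx _ d20.
pose f' := \sum_j ev x (u j) / ev x d1 * b j.
have ff' : f - f' = \sum_j ev x (w j) / ev x d2 * b j.
  apply/eqP; rewrite subr_eq addrC -big_split /=; apply/eqP.
  have dx0 : ev x d != 0 by rewrite dd rmorphM mulf_neq0.
  apply: (mulIf dx0); rewrite fd mulr_suml; apply: eq_bigr => j _.
  have [-> _] := wP j; rewrite dd rmorphD !rmorphM /=.
  by field; rewrite e1 e2.
exists f' => p; have vc := cval_valuation (hat p); have vp := pval_valuation p.
(* Off [T], [x] and [y] are integral and [a] is a unit, hence so is [d1], a divisor of a power of
   [a]; so [f'] itself lies in the ball. *)
have [pT|pT] := boolP (p \in T); last first.
  apply: vge_sub => //; first by apply: vge_le (yT _ pT).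
  apply/vge_emb; apply: vge_sum => // j _; apply: vge_mul0 => //.
  have px : 0 <= pval p x.
    by rewrite leNgt; apply: contra_notN _ (elimN idP pT) => ?; apply/TP; right.
  have vx : vge (pval p) 0 x by right.
  rewrite -[0](addr0 (0 : int)); apply: vge_mul => //; first exact: ev_integral.
  right; rewrite valuV // oppr_ge0.
  have /dvdpP[e ae] := dvd1.
  have pa : pval p (ev x a) <= 0.
    by rewrite leNgt; apply: contra_notN _ (elimN idP pT) => ?; apply/TP; left.
  have aN0 : a ^+ N != 0 by rewrite expf_neq0.
  have e0 : e != 0 by apply: contraNneq aN0 => e0; rewrite ae e0 mul0r.
  have := congr1 (fun z => pval p (ev x z)) ae.
  rewrite rmorphXn rmorphM /= valuX ?tx // valuM ?tx // => E.
  have /(vgeE _ _ (tx _ e0)) h := ev_integral e vx.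
  have : pval p (ev x a) *+ N <= 0 by rewrite mulrn_wle0.
  by rewrite E; move: h; clear; lia.
(* On [T], w/d2 is integral: at a pole of [x] because it is proper, elsewhere because [a] vanishes
   and so [d2], being prime to [a], does not. *)
have -> : y p - cemb (hat p) f' =
    (y p - cemb (hat p) f) + cemb (hat p) (f - f').
  by rewrite rmorphB /=; ring.
apply: vge_add => //; first by apply: vge_le (fP p pT).
apply/vge_emb; rewrite ff'; apply: vge_sum => // j _; apply: vge_mul0 => //.
have [->|w0] := eqVneq (w j) 0; first by rewrite rmorph0 mul0r; left.
have [px|px] := ltP (pval p x) 0.
  right; have [_ sw] := wP j.
  have [f1 g1] := val_ev_neg x0 px w0; have [f2 g2] := val_ev_neg x0 px d20.
  rewrite valuM ?invr_eq0 // valuV // g1 g2.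
  rewrite -[_ *+ (size (w j)).-1]mulr_natr -[_ *+ (size d2).-1]mulr_natr !natz.
  move: sw px.
  by have : (0 < size (w j))%N; [rewrite size_poly_gt0|clear; nia].
have vx : vge (pval p) 0 x by right.
rewrite -[0](addr0 (0 : int)); apply: vge_mul => //; first exact: ev_integral.
right; rewrite valuV // oppr_ge0.
have pa : 0 < pval p (ev x a) by case/TP: pT => //; rewrite ltNge px.
have /Bezout_eq1_coprimepP[[s1 s2] /= ss] := cop2.
rewrite leNgt; apply/negP => d2p.
suff : vge (pval p) 1 (1 : K) by move=> /vgeE; rewrite valuation1 // oner_neq0 => /(_ isT).
have <- : ev x s1 * ev x d2 + ev x s2 * ev x a = 1.
  by rewrite -!rmorphM -rmorphD ss rmorph1.
apply: vge_add => //; apply: vge_mul0 => //; try exact: ev_integral;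
  by right; move: d2p pa; clear; lia.
Qed.

End GlobalField.

Lemma finite_set_inj (T U : Type) (A : set T) (B : set U) (f : T -> U) :
  (forall x, A x -> B (f x)) ->
  (forall x y, A x -> A y -> f x = f y -> x = y) ->
  finite_set B -> finite_set A.
Proof.
move=> AB fi Bfin; have fA : finite_set (f @` A).
  by apply: sub_finite_set Bfin => _ [x Ax <-]; exact: AB.
have inj : {in A &, injective f} by move=> x y /set_mem Ax /set_mem Ay; exact: fi.
by rewrite -(eq_finite_set (inj_card_eq inj)).
Qed.

(** * Adeles and differentials *)

Section AdeleTheory.
Variables (k : finFieldType) (C : curve k).
Variable hat : forall p : place C, completion p.
Local Notation K := (funfield C).
Local Notation A := (adele hat).
Local Notation val p := (@cval _ _ _ (hat p)).
Implicit Types (p : place C) (f : K) (D : place C -> int).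

Let vc p : is_valuation (val p) := cval_valuation (hat p).

Lemma adele0E p : (0 : A) p = 0. Proof. by []. Qed.
Lemma adele1E p : (1 : A) p = 1. Proof. by []. Qed.
Lemma adeleDE (x y : A) p : (x + y) p = x p + y p. Proof. by []. Qed.
Lemma adeleNE (x : A) p : (- x) p = - x p. Proof. by []. Qed.
Lemma adeleME (x y : A) p : (x * y) p = x p * y p. Proof. by []. Qed.
Definition adeleE := (adele0E, adele1E, adeleDE, adeleNE, adeleME).

Definition divisor D := finite_set [set p | D p != 0].

Lemma divisor0 : divisor (fun _ => 0).
Proof. by apply: sub_finite_set (finite_set0 _) => p. Qed.

Lemma divisor2 (g : int -> int -> int) D D' :
  g 0 0 = 0 -> divisor D -> divisor D' -> divisor (fun p => g (D p) (D' p)).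
Proof.
move=> g0 dD dD'; have : finite_set ([set p | D p != 0] `|` [set p | D' p != 0]).
  by rewrite finite_setU.
apply: sub_finite_set => p /=.
by have [->|?] := eqVneq (D p) 0; [have [->|?] := eqVneq (D' p) 0; [rewrite g0 eqxx|right]|left].
Qed.

Lemma divisorD D D' : divisor D -> divisor D' -> divisor (fun p => D p + D' p).
Proof. exact: (@divisor2 (fun m n => m + n) D D' (addr0 0)). Qed.

Lemma divisorN D : divisor D -> divisor (fun p => - D p).
Proof. by apply: sub_finite_set => p /=; rewrite oppr_eq0. Qed.

Definition aball D : set A := [set x | forall p, vge (val p) (D p) (x p)].

Lemma aballD D x y : aball D x -> aball D y -> aball D (x + y).
Proof. by move=> xD yD p; apply: vge_add. Qed.

Lemma aballN D x : aball D x -> aball D (- x).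
Proof. by move=> xD p; apply: vge_opp. Qed.

Lemma aballB D x y : aball D x -> aball D y -> aball D (x - y).
Proof. by move=> xD yD; apply: aballD => //; apply: aballN. Qed.

Lemma aballM D D' x y :
  aball D x -> aball D' y -> aball (fun p => D p + D' p) (x * y).
Proof. by move=> xD yD p; apply: vge_mul. Qed.

Lemma aball_le D D' x : (forall p, D' p <= D p) -> aball D x -> aball D' x.
Proof. by move=> h xD p; apply: vge_le (xD p). Qed.

Lemma aball_min D D' x : aball D x \/ aball D' x ->
  aball (fun p => Num.min (D p) (D' p)) x.
Proof. by move=> [|]; apply: aball_le => p; rewrite ge_min lexx ?orbT. Qed.

Lemma in_aball (x : A) : exists2 D, divisor D & aball D x.
Proof.
(* The valuation is arbitrary at 0, hence the separate case. *)
exists (fun p => if x p == 0 then 0 else Num.min 0 (val p (x p))).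
  apply: sub_finite_set (avalP x) => p /=.
  have [->|x0] := eqVneq (x p) 0; first by rewrite eqxx.
  by rewrite vgeE //; lia.
move=> p; have [->|x0] := eqVneq (x p) 0; first by left.
by right; rewrite ge_min lexx orbT.
Qed.

Lemma in_aball_seq (s : seq A) :
  exists2 D, divisor D & forall x, x \in s -> aball D x.
Proof.
elim: s => [|x s [D dD sD]]; first by exists (fun _ => 0) => //; exact: divisor0.
have [D' dD' xD'] := in_aball x.
exists (fun p => Num.min (D p) (D' p)).
  exact: (@divisor2 Num.min D D' (minxx 0)).
move=> y; rewrite inE => /orP[/eqP->|ys]; apply: aball_min; first by right.
by left; apply: sD.
Qed.

Fact padele_subproof f : almost_integral (fun p => cemb (hat p) f).
Proof.
apply: sub_finite_set (finite_divisor f) => p /=; apply: contra_notN => /eqP p0.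
by apply/vge_emb; right; rewrite p0.
Qed.
Definition padele f : A := Adele (padele_subproof f).

Lemma padeleE f p : padele f p = cemb (hat p) f. Proof. by []. Qed.

Fact padele_zmod : zmod_morphism padele.
Proof. by move=> f g; apply: adele_ext => p; rewrite padeleE rmorphB. Qed.
Fact padele_monoid : monoid_morphism padele.
Proof.
split=> [|f g]; apply: adele_ext => p; first by rewrite padeleE rmorph1.
by rewrite padeleE rmorphM.
Qed.
HB.instance Definition _ := GRing.isZmodMorphism.Build K A padele padele_zmod.
HB.instance Definition _ := GRing.isMonoidMorphism.Build K A padele padele_monoid.

Lemma principalP (x : A) : principal x <-> exists f, x = padele f.
Proof.
split=> [[f fx]|[f ->]]; last by exists f.
by exists f; apply: adele_ext => p; rewrite fx.
Qed.

Lemma principal_padele f : principal (padele f).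
Proof. by apply/principalP; exists f. Qed.

Lemma padele_ball D f : aball D (padele f) <-> forall p, vge (pval p) (D p) f.
Proof. by split=> h p; have := h p; rewrite padeleE; move/vge_emb. Qed.

Definition asingle_fun p (a : hat p) : forall q, hat q :=
  dfwith (fun q => 0 : hat q) a.

Fact asingle_subproof p (a : hat p) : almost_integral (asingle_fun a).
Proof.
apply: sub_finite_set (finite_set1 p) => q /=; rewrite /asingle_fun.
by case: dfwithP => // j _ []; left.
Qed.
Definition asingle p (a : hat p) : A := Adele (asingle_subproof a).

Lemma asingle_in p (a : hat p) : asingle a p = a.
Proof. by rewrite /= /asingle_fun dfwith_in. Qed.

Lemma asingle_out p (a : hat p) q : q <> p -> asingle a q = 0.
Proof. by move=> /eqP qp; rewrite /= /asingle_fun dfwith_out // eq_sym. Qed.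

Lemma idele_of_divisor D : divisor D -> exists z w : A, [/\ z * w = 1,
  forall p, z p != 0 /\ val p (z p) = D p &
  forall p, w p != 0 /\ val p (w p) = - D p].
Proof.
move=> dD.
have /choice[t tP] p : exists t : K, t != 0 /\ pval p t = 1.
  by have [t] := pval_onto p; exists t.
pose z (p : place C) : hat p := cemb (hat p) (t p) ^ (D p).
have t0 p : cemb (hat p) (t p) != 0 by rewrite fmorph_eq0; case: (tP p).
have z0 p : z p != 0 by rewrite /z expfz_neq0 ?t0.
have vt p : val p (cemb (hat p) (t p)) = 1.
  by have [t0' tp] := tP p; rewrite cval_emb.
have vz p : val p (z p) = D p by rewrite /z valuXz ?t0 // vt mul1r.
have vw p : val p (z p)^-1 = - D p by rewrite valuV ?z0 ?vz.
have zP : almost_integral z.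
  apply: sub_finite_set dD => p /=; apply: contra_notN => /eqP Dp.
  by right; rewrite vz Dp.
have wP : almost_integral (fun p => (z p)^-1).
  apply: sub_finite_set dD => p /=; apply: contra_notN => /eqP Dp.
  by right; rewrite vw Dp oppr0.
exists (Adele zP), (Adele wP); split=> [|p|p] /=.
- by apply: adele_ext => p /=; rewrite divff ?z0.
- by rewrite z0 vz.
- by rewrite invr_eq0 z0 vw.
Qed.

Lemma finite_residue_hat p (n : int) : exists S : seq (hat p),
  forall x, vge (val p) n x -> exists2 s, s \in S & vge (val p) (n + 1) (x - s).
Proof.
have vp := pval_valuation p.
have [S SP] := finite_residue p.
have [t t0 pt] := pval_onto p.
have tn0 : t ^ n != 0 by rewrite expfz_neq0.
have vtn : pval p (t ^ n) = n by rewrite valuXz // pt mul1r.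
exists [seq cemb (hat p) (s * t ^ n) | s <- S] => x xn.
have [y xy] := cemb_dense x (n + 1).
have yn : vge (pval p) n y.
  apply/(@vge_emb _ _ hat); rewrite -[cemb _ y](subKr x).
  by apply: vge_sub => //; apply: vge_le xy; rewrite lerDl.
have : vge (pval p) 0 (y / t ^ n).
  by rewrite -(subrr n); apply: vge_mul => //; right; rewrite valuV // vtn.
case/SP => s sS ys; exists (cemb (hat p) (s * t ^ n)); first by apply: map_f.
have -> : x - cemb (hat p) (s * t ^ n) =
    (x - cemb (hat p) y) + cemb (hat p) ((y / t ^ n - s) * t ^ n).
  by rewrite mulrBl mulfVK // rmorphB /=; ring.
apply: vge_add => //; apply/vge_emb; rewrite addrC; apply: vge_mul => //.
by right; rewrite vtn.
Qed.

Lemma finite_quotient_hat p (n m : int) : exists S : seq (hat p),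
  forall x, vge (val p) n x -> exists2 s, s \in S & vge (val p) m (x - s).
Proof.
suff H (r : nat) : exists S : seq (hat p), forall x, vge (val p) n x ->
    exists2 s, s \in S & vge (val p) (n + r%:Z) (x - s).
  have [S SP] := H `|m - n|%N; exists S => x /SP[s sS xs]; exists s => //.
  by apply: vge_le xs; lia.
elim: r => [|r [S SP]].
  exists [:: 0] => x xn; exists 0; first by rewrite mem_head.
  by rewrite !(subr0, addr0).
have [S' SP'] := finite_residue_hat p (n + r%:Z).
exists [seq s + s' | s <- S, s' <- S'] => x /SP[s sS /SP'[s' sS' h]].
exists (s + s'); first by apply: allpairs_f.
by rewrite opprD addrA; apply: vge_le h; lia.
Qed.

(** Off the supports of both divisors the local conditions agree, so only finitely many local
    quotients matter; they are added one at a time through adeles supported at one place. *)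
Lemma finite_quotient D D' : divisor D -> divisor D' -> exists S : seq A,
  forall x, aball D x -> exists2 s, s \in S & aball D' (x - s).
Proof.
move=> dD dD'.
have : finite_set ([set p | D p != 0] `|` [set p | D' p != 0]).
  by rewrite finite_setU.
move=> /finite_seqP[l lP].
suff [S SP] : exists S : seq A, forall x, aball D x -> exists2 s, s \in S &
    forall p, (p \in l -> vge (val p) (D' p) (x p - s p)) /\
              (p \notin l -> s p = 0).
  exists S => x xD; have [s sS h] := SP x xD; exists s => // p.
  have [h1 h2] := h p; have [/h1//|pl] := boolP (p \in l).
  rewrite adeleE adeleNE h2 // subr0; apply: vge_le (xD p).
  suff [-> ->] : D p = 0 /\ D' p = 0 by [].
  have := congr1 (fun X => X p) lP => /= E.
  split; apply/eqP/negPn/negP => h'; move/negP: pl; apply; rewrite -E;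
    [by left|by right].
elim: l {lP} => [|p l [S SP]].
  exists [:: 0] => x xD; exists 0; first by rewrite mem_head.
  by [].
have [pl|pl] := boolP (p \in l).
  exists S => x /SP[s sS h]; exists s => // q; have := h q.
  by rewrite inE; have [->|//] := eqVneq q p; rewrite pl.
have [S' SP'] := finite_quotient_hat p (D p) (D' p).
exists [seq s + asingle s' | s <- S, s' <- S'] => x xD.
have [s sS h] := SP x xD; have [s' sS' h'] := SP' _ (xD p).
exists (s + asingle s'); first by apply: allpairs_f.
move=> q; rewrite inE adeleE; have [->|/eqP qp] := eqVneq q p.
  by split=> // _; rewrite asingle_in; have [_ ->] := h p; rewrite ?add0r.
by rewrite asingle_out // addr0; exact: h.
Qed.

Section WithDifferential.
Variable eta : weil_differential hat.
Hypothesis eta_neq0 : exists x, eta x != 0.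

Fact eta_zmod : zmod_morphism eta.
Proof.
have e0 : eta 0 = 0.
  by have := wfunD eta 0 0; rewrite addr0 -{1}[eta 0]addr0 => /addrI.
move=> x y; rewrite wfunD; congr (_ + _); apply/eqP.
by rewrite -subr_eq0 opprK -wfunD addNr e0.
Qed.
HB.instance Definition _ := GRing.isZmodMorphism.Build A k eta eta_zmod.

Lemma place_exists : exists p : place C, True.
Proof.
apply: contrapT => np; have [x /negP] := eta_neq0; apply.
have -> : x = 0 by apply: adele_ext => p; case: np; exists p.
by rewrite raddf0.
Qed.

(** [S] represents the ball of [D0] modulo that of E - D, where [eta] kills the ball of [E]. The
    values of [eta] at f s, for s in [S], determine f: if they agree for f and g and h = f - g is
    nonzero, dividing by h and strong approximation write every adele as an element of K plus h s
    plus an element of the ball of [E], so [eta] would vanish. *)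
Lemma finite_global_sections D : divisor D ->
  finite_set [set f : K | forall p, vge (pval p) (D p) f].
Proof.
move=> dD; have [E [dE etaE]] := wfun_continuous eta.
have [D0 [dD0 _ sa]] := strong_approximation hat.
have dE' : divisor (fun p => E p + - D p).
  by apply: divisorD => //; apply: divisorN.
have [S SP] := finite_quotient dD0 dE'.
pose Phi (f : K) : {ffun 'I_(size S) -> k} :=
  [ffun i : 'I_(size S) => eta (padele f * nth 0 S i)].
apply: (@finite_set_inj _ _ _ [set: {ffun 'I_(size S) -> k}] Phi) => //.
move=> f g Sf Sg fg; apply/eqP/negPn/negP => /negP nfg.
have fg0 : f - g != 0 by rewrite subr_eq0; apply/negP.
have Sfg : aball D (padele (f - g)).
  by rewrite rmorphB; apply: aballB; apply/padele_ball.
have [x0 /negP] := eta_neq0; apply.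
have [c cP] := sa (padele (f - g)^-1 * x0).
have [s sS sP] := SP (padele (f - g)^-1 * x0 - padele c) cP.
have -> : x0 = padele (f - g) * padele c + padele (f - g) * s +
   padele (f - g) * (padele (f - g)^-1 * x0 - padele c - s).
  have uv : padele (f - g) * padele (f - g)^-1 = 1.
    by rewrite -rmorphM divff // rmorph1.
  by rewrite -[LHS]mul1r -uv; ring.
rewrite 2!wfunD -rmorphM wfun_principal ?add0r; last exact: principal_padele.
rewrite [X in _ + X]etaE ?addr0; last first.
  move=> p; rewrite -[E p](subrK (D p)) addrC.
  exact: (aballM Sfg sP).
move/ffunP/(_ (Ordinal (etrans (index_mem s S) sS))): fg.
rewrite !ffunE /= nth_index // => fgs.
by rewrite (rmorphB padele) mulrBl (raddfB eta) /= fgs subrr.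
Qed.

End WithDifferential.
End AdeleTheory.

(** * The orders of the differential and of alpha *)

Section OrderOfDifferential.
Variables (k : finFieldType) (C : curve k).
Variable hat : forall p : place C, completion p.
Local Notation K := (funfield C).
Local Notation A := (adele hat).
Local Notation val p := (@cval _ _ _ (hat p)).
Variable eta : weil_differential hat.
Implicit Types (p : place C) (x y c u : A).

Let vc p : is_valuation (val p) := cval_valuation (hat p).

Lemma sum_asingle (l : seq (place C)) x q : uniq l ->
  (\sum_(p <- l) asingle (x p)) q = if q \in l then x q else 0.
Proof.
elim: l => [|p l IH] /=; first by rewrite big_nil.
case/andP=> pl /IH E; rewrite big_cons adeleDE E inE.
have [->|/eqP qp] := eqVneq q p; first by rewrite (negPf pl) asingle_in addr0.
by rewrite asingle_out // add0r.
Qed.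

Definition has_order u := forall p, u p != 0 /\ diff_order eta p (val p (u p)).

(** If u c has a pole at p, testing on adeles supported at p would make [eta] vanish there to higher
    order than it does. Conversely, c y is split into finitely many one-place parts, killed by the
    definition of the order, and a rest killed by continuity. *)
Lemma regular_diffE u : has_order u ->
  forall c, regular_diff eta c <-> integral (u * c).
Proof.
move=> ou c; split=> [rc p|uc y iy].
  have [u0 [vu nvu]] := ou p; rewrite adeleME.
  have [->|c0] := eqVneq (c p) 0; first by rewrite mulr0; left.
  apply: contrapT => ncp; apply: nvu => x xq xp.
  have y0 : integral (asingle (x p / c p)).
    move=> q; have [->|/eqP qp] := eqVneq q p; last first.
      by rewrite asingle_out //; left.
    rewrite asingle_in; have [->|x0] := eqVneq (x p) 0.
      by rewrite mul0r; left.
    right; rewrite valuM ?invr_eq0 // valuV //.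
    move: xp ncp; rewrite vgeE // vgeE ?mulf_neq0 // valuM //.
    by move: (val p _) (val p _) (val p _) => i j l; lia.
  rewrite -(rc _ y0); congr (eta _); apply: adele_ext => q; rewrite adeleME.
  have [->|/eqP qp] := eqVneq q p; first by rewrite asingle_in mulrC divfK.
  by rewrite asingle_out // mulr0 xq.
have [E [dE etaE]] := wfun_continuous eta.
set z := c * y.
have zP p : vge (val p) (- val p (u p)) (z p).
  have [u0 _] := ou p.
  rewrite adeleME -[c p](mulKf u0) -mulrA -[- _]addr0; apply: vge_mul => //.
    by right; rewrite valuV.
  by rewrite -[0 : int]addr0; apply: vge_mul; [|exact: uc|exact: iy].
have sing p : eta (asingle (z p)) = 0.
  have [_ [vu _]] := ou p; apply: vu; last by rewrite asingle_in.
  by move=> q qp; rewrite asingle_out.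
have /finite_seqP[l lP] :
    finite_set ([set p | E p != 0] `|` [set p | ~ vge (val p) 0 (z p)]).
  by rewrite finite_setU; split => //; exact: avalP.
pose r := \sum_(p <- undup l) asingle (z p).
have -> : z = r + (z - r) by rewrite addrC subrK.
rewrite wfunD (_ : eta r = 0) ?add0r; last first.
  by rewrite /r (raddf_sum eta) big1 // => p _; exact: sing.
apply: etaE => p; rewrite adeleDE adeleNE /r sum_asingle ?undup_uniq //.
rewrite mem_undup; have [pl|pl] := boolP (p \in l); first by rewrite subrr; left.
rewrite subr0; have := congr1 (fun X => X p) lP => /= lp.
have -> : E p = 0.
  by apply/eqP/negPn/negP => h; move/negP: pl; apply; rewrite -lp; left.
by apply: contrapT => h; move/negP: pl; apply; rewrite -lp; right.
Qed.

Variable alpha : A.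
Hypothesis alphaA' : nonsquare_quad_diff eta alpha.
Hypothesis alpha_simple : simple_zeros eta alpha.

Lemma alpha_principal : exists2 c : K, c != 0 & alpha = padele hat c.
Proof.
have [[/principalP[c ac] _] sq] := alphaA'.
exists c => //; apply/eqP => c0; apply: (sq 0).
- by apply/principalP; exists 0; rewrite rmorph0.
- by move=> y _; rewrite mul0r (raddf0 eta).
- by rewrite ac c0 rmorph0 mul0r.
Qed.

(* Simple zeros force the order of eta to vanish wherever that of alpha does. *)
Lemma order_idele : exists u w : A, [/\ u * w = 1, has_order u,
  integral (u * u * alpha) &
  forall p, ~ vge (val p) 2 ((u * u * alpha) p)].
Proof.
have [c c0 ac] := alpha_principal; have [[_ qd] _] := alphaA'.
have /choice[n nP] p : exists n, diff_order eta p n /\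
   vge (val p) (- (n + n)) (alpha p) by have [n] := qd p; exists n.
have nsP p : ~ vge (val p) (2 - (n p + n p)) (alpha p).
  by apply: alpha_simple; have [] := nP p.
have e0 p : cemb (hat p) c != 0 by rewrite fmorph_eq0.
have bnd p : - (n p + n p) <= pval p c /\ pval p c < 2 - (n p + n p).
  have [_] := nP p; have := nsP p; rewrite ac padeleE !vgeE ?e0 // cval_emb //.
  by move=> /negP; rewrite -ltNge => h1 h2; split.
have dn : divisor n.
  apply: sub_finite_set (finite_divisor c) => p /=; have := bnd p; lia.
have [u [w [uw uP wP]]] := idele_of_divisor hat dn.
have uua p : (u * u * alpha) p != 0 /\
    val p ((u * u * alpha) p) = n p + n p + pval p c.
  have [u0 vu] := uP p; have E0 : u p * u p != 0 by rewrite mulf_neq0.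
  have ep := e0 p; rewrite ac !adeleME padeleE; split; first by rewrite mulf_neq0.
  by rewrite (valuM (vc p) E0 ep) (valuM (vc p) u0 u0) vu (cval_emb (hat p) c0).
exists u, w; split=> // p.
- by have [u0 ->] := uP p; split=> //; have [] := nP p.
- by have [h0 h1] := uua p; apply/(vgeE _ _ h0); rewrite h1; have := bnd p; lia.
- by have [h0 h1] := uua p; rewrite vgeE // h1; have := bnd p; lia.
Qed.

(** The hypothesis excludes only squares of regular differentials, but a root [b] in K is
    automatically regular: u b has the integral square u^2 alpha. *)
Lemma alpha_nonsquare b : principal b -> b * b <> alpha.
Proof.
move=> pb bb; have [_ sq] := alphaA'; apply: (sq b) => //.
have [u [w [uw ou iu _]]] := order_idele.
apply/(regular_diffE ou) => p.
have := iu p; rewrite -bb (_ : u * u * (b * b) = (u * b) * (u * b)); last by ring.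
rewrite adeleME; have [->|x0] := eqVneq ((u * b) p) 0; first by left.
by move=> /(vgeE _ _ (mulf_neq0 x0 x0)); rewrite (valuM (vc p) x0 x0) vgeE //; lia.
Qed.

End OrderOfDifferential.

Lemma ord2P (i : 'I_2) : i = 0 \/ i = 1.
Proof. by case: i => [[|[|]]] // p; [left|right]; apply: val_inj. Qed.

(** * Matrices of size two and the commutant of the companion matrix *)

Section Matrices2.
Variable R : comPzRingType.
Implicit Types (a b c d x y z : R) (M N P : 'M[R]_2) (S : set R).

Definition mx2 a b c d : 'M[R]_2 := \matrix_(i, j)
  (if i == 0 then (if j == 0 then a else b) else (if j == 0 then c else d)).

Lemma mx2_00 a b c d : mx2 a b c d 0 0 = a. Proof. by rewrite mxE. Qed.
Lemma mx2_01 a b c d : mx2 a b c d 0 1 = b. Proof. by rewrite mxE. Qed.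
Lemma mx2_10 a b c d : mx2 a b c d 1 0 = c. Proof. by rewrite mxE. Qed.
Lemma mx2_11 a b c d : mx2 a b c d 1 1 = d. Proof. by rewrite mxE. Qed.
Definition mx2E := (mx2_00, mx2_01, mx2_10, mx2_11).

Lemma mx2P M N : M 0 0 = N 0 0 -> M 0 1 = N 0 1 -> M 1 0 = N 1 0 ->
  M 1 1 = N 1 1 -> M = N.
Proof.
move=> h1 h2 h3 h4; apply/matrixP => i j.
by case: (ord2P i) => ->; case: (ord2P j) => ->.
Qed.

Lemma mx2_eta M : M = mx2 (M 0 0) (M 0 1) (M 1 0) (M 1 1).
Proof. by apply: mx2P; rewrite mx2E. Qed.

Lemma mulmx2E n (M : 'M[R]_(n, 2)) m (N : 'M[R]_(2, m)) i j :
  (M *m N) i j = M i 0 * N 0 j + M i 1 * N 1 j.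
Proof.
rewrite mxE big_ord_recl big_ord1; congr (_ + M i _ * N _ _);
by apply: val_inj.
Qed.

Lemma mulmx_mx2 a b c d a' b' c' d' : mx2 a b c d *m mx2 a' b' c' d' =
  mx2 (a * a' + b * c') (a * b' + b * d') (c * a' + d * c') (c * b' + d * d').
Proof. by apply: mx2P; rewrite mulmx2E !mx2E. Qed.

Lemma scalar_mx2 z : z%:M = mx2 z 0 0 z.
Proof. by apply: mx2P; rewrite !mxE. Qed.

Lemma spec_mx2 a x y : spec_mx a x y = mx2 x (a * y) y x.
Proof. by apply: mx2P; rewrite !mxE. Qed.

Lemma mxtrace2 M : \tr M = M 0 0 + M 1 1.
Proof.
rewrite /mxtrace big_ord_recl big_ord1; congr (_ + M _ _); exact: val_inj.
Qed.

Lemma det_mx2 M : \det M = M 0 0 * M 1 1 - M 0 1 * M 1 0.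
Proof.
rewrite (expand_det_row _ 0) big_ord_recl big_ord1.
rewrite /cofactor !det_mx11 !mxE /= expr0 expr1 mul1r mulN1r mulrN.
by congr (_ * M _ _ - M _ _ * M _ _); apply: val_inj.
Qed.

Definition subring_set S :=
  [/\ S 1, forall x y, S x -> S y -> S (x - y) &
      forall x y, S x -> S y -> S (x * y)].

Section SubringSet.
Variable S : set R.
Hypothesis HS : subring_set S.
Lemma sring0 : S 0. Proof. by have [h1 h2 _] := HS; rewrite -(subrr 1); apply: h2. Qed.
Lemma sring1 : S 1. Proof. by have [] := HS. Qed.
Lemma sringB x y : S x -> S y -> S (x - y). Proof. by have [_ h _] := HS; exact: h. Qed.
Lemma sringM x y : S x -> S y -> S (x * y). Proof. by have [_ _ h] := HS; exact: h. Qed.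
Lemma sringN x : S x -> S (- x).
Proof. by rewrite -sub0r; apply: sringB sring0. Qed.
Lemma sringD x y : S x -> S y -> S (x + y).
Proof. by move=> Sx Sy; rewrite -[y]opprK; apply: sringB => //; apply: sringN. Qed.
Lemma sring_mul n m (M : 'M[R]_(n, 2)) (N : 'M[R]_(2, m)) :
  (forall i j, S (M i j)) -> (forall i j, S (N i j)) ->
  forall i j, S ((M *m N) i j).
Proof. by move=> h1 h2 i j; rewrite mulmx2E; apply: sringD; apply: sringM. Qed.

Lemma sring_mx2 a b c d : S a -> S b -> S c -> S d ->
  forall i j, S (mx2 a b c d i j).
Proof.
by move=> ? ? ? ? i j; case: (ord2P i) => ->; case: (ord2P j) => ->; rewrite mx2E.
Qed.

Lemma GL2_mul M N : GL2 S M -> GL2 S N -> GL2 S (M *m N).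
Proof.
move=> [M' [m1 m2 m3 m4]] [N' [n1 n2 n3 n4]]; exists (N' *m M'); split.
- by rewrite mulmxA -[M *m N *m N']mulmxA n1 mulmx1.
- by rewrite mulmxA -[N' *m M' *m M]mulmxA m2 mulmx1.
- exact: sring_mul.
- exact: sring_mul.
Qed.

Lemma GL2_inv M : GL2 S M ->
  exists M', [/\ GL2 S M', M *m M' = 1%:M & M' *m M = 1%:M].
Proof. by move=> [M' [m1 m2 m3 m4]]; exists M'; split=> //; exists M; split. Qed.

Lemma GL2_det a b c d e : S a -> S b -> S c -> S d -> S e ->
  (a * d - b * c) * e = 1 -> GL2 S (mx2 a b c d).
Proof.
move=> Sa Sb Sc Sd Se ade.
exists (mx2 (d * e) (- b * e) (- c * e) (a * e)); split.
- by rewrite mulmx_mx2 scalar_mx2 -ade; congr mx2; ring.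
- by rewrite mulmx_mx2 scalar_mx2 -ade; congr mx2; ring.
- exact: sring_mx2.
- by apply: sring_mx2; apply: sringM => //; apply: sringN.
Qed.

Lemma GL2_1 : GL2 S 1%:M.
Proof.
have h : forall i j, S ((1%:M : 'M[R]_2) i j).
  rewrite scalar_mx2; apply: sring_mx2; do [exact: sring1|exact: sring0].
by exists 1%:M; rewrite mulmx1.
Qed.

End SubringSet.

Lemma GL2_sub S T M : (forall x, S x -> T x) -> GL2 S M -> GL2 T M.
Proof.
by move=> ST [M' [h1 h2 h3 h4]]; exists M'; split=> // i j; apply: ST.
Qed.

Lemma subring_setT : subring_set setT. Proof. by []. Qed.

Lemma mxinvE M N : M *m N = 1%:M -> N *m M = 1%:M -> mxinv M = N.
Proof.
move=> MN NM; rewrite /mxinv; case: xgetP => [P _ [_ PM]|/(_ N)[]//].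
by rewrite -[P]mulmx1 -MN mulmxA PM mul1mx.
Qed.

Lemma spec_mxM a x y x' y' : spec_mx a x y *m spec_mx a x' y' =
  spec_mx a (x * x' + a * y * y') (x * y' + y * x').
Proof. by rewrite !spec_mx2 mulmx_mx2; congr mx2; ring. Qed.

Lemma spec_mxC a x y x' y' : spec_mx a x y *m spec_mx a x' y' =
  spec_mx a x' y' *m spec_mx a x y.
Proof. by rewrite !spec_mxM; congr spec_mx; ring. Qed.

Lemma spec_mx_commutant a M : M *m spec_mx a 0 1 = spec_mx a 0 1 *m M ->
  M = spec_mx a (M 0 0) (M 1 0).
Proof.
rewrite [M]mx2_eta !spec_mx2 !mulmx_mx2 => E.
have := congr1 (fun N : 'M[R]_2 => N 0 0) E.
have := congr1 (fun N : 'M[R]_2 => N 1 0) E.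
rewrite !mx2E !mul0r !mulr0 !mulr1 !mul1r !add0r !addr0 => -> ->.
by [].
Qed.

(* The second column is the product of tau with the first one. *)
Lemma spec_mx_of_col a M :
  M *m mx2 0 0 1 0 = spec_mx a 0 1 *m M *m mx2 1 0 0 0 ->
  M = spec_mx a (M 0 0) (M 1 0).
Proof.
move=> E.
have := congr1 (fun N : 'M[R]_2 => N 0 0) E.
have := congr1 (fun N : 'M[R]_2 => N 1 0) E.
rewrite !mulmx2E spec_mx2 !mx2E.
rewrite !(mulr0, mulr1, mul0r, mul1r, addr0, add0r) => E11 E01.
by rewrite [LHS]mx2_eta spec_mx2 E01 E11.
Qed.

Lemma commute_inv M N P : M *m N = 1%:M -> N *m M = 1%:M ->
  M *m P = P *m M -> N *m P = P *m N.
Proof.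
move=> MN NM MP; rewrite -[N *m P]mulmx1 -MN mulmxA -[N *m P *m M]mulmxA -MP.
by rewrite mulmxA NM mul1mx.
Qed.

End Matrices2.

(** * Higgs bundles and ideles of the spectral curve *)

Section HiggsNormalForm.
Variables (k : finFieldType) (char_k : 2%:R != 0 :> k) (C : curve k).
Variable hat : forall p : place C, completion p.
Local Notation A := (adele hat).
Local Notation val p := (@cval _ _ _ (hat p)).
Local Notation Integral := (@integral _ _ hat).
Local Notation Principal := (@principal _ _ hat).
Variable eta : weil_differential hat.
Variable alpha : A.
Hypothesis alphaA' : nonsquare_quad_diff eta alpha.
Hypothesis alpha_simple : simple_zeros eta alpha.
Variables u w : A.
Hypothesis uw : u * w = 1.
Hypothesis ou : has_order eta u.
Hypothesis iu : integral (u * u * alpha).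
Hypothesis nu : forall p, ~ vge (val p) 2 ((u * u * alpha) p).

Let vc p : is_valuation (val p) := cval_valuation (hat p).

Lemma principal_subring : subring_set (@principal _ _ hat).
Proof.
split; first by apply/principalP; exists 1; rewrite rmorph1.
- move=> x y /principalP[f ->] /principalP[g ->]; apply/principalP.
  by exists (f - g); rewrite rmorphB.
- move=> x y /principalP[f ->] /principalP[g ->]; apply/principalP.
  by exists (f * g); rewrite rmorphM.
Qed.

Lemma integral_subring : subring_set (@integral _ _ hat).
Proof.
split=> [p|x y ix iy|x y ix iy p]; first by right; rewrite valuation1.
- exact: (@aballB _ _ hat (fun _ => 0)).
- by rewrite -[0 : int]addr0; apply: vge_mul; [|exact: ix|exact: iy].
Qed.

Lemma regularE c : regular_diff eta c <-> integral (u * c).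
Proof. exact: regular_diffE. Qed.

Local Notation S := (spec_mx alpha 0 1).
Definition gL : 'M[A]_2 := mx2 1 0 0 u.
Definition gLi : 'M[A]_2 := mx2 1 0 0 w.

Lemma gLK : gL *m gLi = 1%:M.
Proof. by rewrite mulmx_mx2 scalar_mx2 uw; congr mx2; ring. Qed.
Lemma gLiK : gLi *m gL = 1%:M.
Proof. by rewrite mulmx_mx2 scalar_mx2 [w * u]mulrC uw; congr mx2; ring. Qed.
Lemma gLP : GL2 setT gL.
Proof. by exists gLi; rewrite gLK gLiK. Qed.

Lemma alpha_is_principal : principal alpha.
Proof. by have [[]] := alphaA'. Qed.

Lemma principal_S i j : principal (S i j).
Proof.
have h := principal_subring; rewrite spec_mx2 mulr1.
apply: sring_mx2; try exact: sring0; try exact: sring1.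
exact: alpha_is_principal.
Qed.

(** As [m] commutes with [S], regularity reduces to the case of [gL], where the conjugate of [S] has
    the off-diagonal entries u alpha and w. Their products with u are u^2 alpha and 1. *)
Lemma higgs_intro m : spec_idele alpha m ->
  exists x : higgs eta alpha, hphi x = S /\ hg x = m *m gL.
Proof.
move=> [[mi [m1 m2 _ _]] [x [y mE]]].
have gP : GL2 setT (m *m gL).
  by apply: GL2_mul; [exact: subring_setT|exists mi|exact: gLP].
have tr0 : \tr S = 0 by rewrite mxtrace2 spec_mx2 !mx2E addr0.
have det : - \det S = alpha by rewrite det_mx2 spec_mx2 !mx2E; ring.
have reg i j : regular_diff eta ((mxinv (m *m gL) *m S *m (m *m gL)) i j).
  have -> : mxinv (m *m gL) = gLi *m mi.
    apply: mxinvE.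
      by rewrite mulmxA -[m *m gL *m gLi]mulmxA gLK mulmx1.
    by rewrite mulmxA -[gLi *m mi *m m]mulmxA m2 mulmx1 gLiK.
  have -> : gLi *m mi *m S *m (m *m gL) = gLi *m S *m gL.
    rewrite !mulmxA -[gLi *m mi *m S *m m]mulmxA.
    have -> : S *m m = m *m S by rewrite mE spec_mxC.
    by rewrite mulmxA -[gLi *m mi *m m]mulmxA m2 mulmx1.
  apply/regularE; move: i j; rewrite spec_mx2 !mulmx_mx2.
  move=> i j; have hi := integral_subring.
  case: (ord2P i) => ->; case: (ord2P j) => ->; rewrite mx2E.
  - by rewrite (_ : u * _ = 0); [exact: sring0|ring].
  - rewrite (_ : u * _ = u * u * alpha) //; ring.
  - rewrite (_ : u * _ = u * w); last ring.
    by rewrite uw; exact: sring1.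
  - by rewrite (_ : u * _ = 0); [exact: sring0|ring].
by exists (Higgs gP principal_S tr0 det reg).
Qed.

Lemma higgs_iso_refl (x : higgs eta alpha) : higgs_iso x x.
Proof.
exists 1%:M, 1, 1%:M; rewrite !(mul1mx, mulmx1); split=> //.
- exact: GL2_1 principal_subring.
- by exists 1; rewrite mulr1.
- exact: GL2_1 integral_subring.
Qed.

Lemma higgs_iso_trans (x y t : higgs eta alpha) :
  higgs_iso x y -> higgs_iso y t -> higgs_iso x t.
Proof.
move=> [g [z [q [gP zP qP E1 E2]]]] [g' [z' [q' [gP' zP' qP' E1' E2']]]].
exists (g' *m g), (z * z'), (q *m q'); split.
- exact: GL2_mul principal_subring _ _ _ _.
- by case: zP => i zi; case: zP' => i' zi'; exists (i * i'); rewrite mulrACA zi zi' mulr1.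
- exact: GL2_mul integral_subring _ _ _ _.
- rewrite E1' E1 !mulmxA scalar_mxM !mulmxA; congr (_ *m _).
  by rewrite -!mulmxA (scalar_mxC z') !mulmxA.
- by rewrite mulmxA E2' -[g' *m _ *m g]mulmxA E2 mulmxA.
Qed.

Lemma higgs_iso_sym (x y : higgs eta alpha) : higgs_iso x y -> higgs_iso y x.
Proof.
move=> [g [z [q [gP [z' zz'] qP E1 E2]]]].
have [g' [gP' g1 g2]] := GL2_inv gP; have [q' [qP' q1 q2]] := GL2_inv qP.
have zM : z%:M *m z'%:M = 1%:M :> 'M[A]_2 by rewrite -scalar_mxM zz'.
exists g', z', q'; split=> //.
- by exists z; rewrite mulrC.
- rewrite E1 !mulmxA g2 mul1mx -!mulmxA -(scalar_mxC z').
  by rewrite (mulmxA q) q1 mul1mx zM mulmx1.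
- rewrite -[hphi x *m g']mul1mx -g2 -!mulmxA (mulmxA g) -E2 -(mulmxA (hphi y)).
  by rewrite g1 mulmx1.
Qed.

Lemma higgs_class_eq (x y : higgs eta alpha) :
  higgs_class x = higgs_class y <-> higgs_iso x y.
Proof.
split=> [E|xy].
  have : sval (higgs_class y) y by exact: higgs_iso_refl.
  by rewrite -E.
apply: eq_exist => /=; apply/seteqP; split=> t /= h.
  by apply: higgs_iso_trans h; apply: higgs_iso_sym.
by apply: higgs_iso_trans h.
Qed.

Lemma higgs_class_surj (P : HF eta alpha) : exists x, P = higgs_class x.
Proof. by case: P => c [x E]; exists x; apply: eq_exist. Qed.

(** The lattice of the spectral order is [gL] applied to the standard lattice. The idele [w] is
    itself a regular differential, and the strongest test. *)
Lemma spec_integralE v : spec_integral eta v <->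
  forall i, integral ((gLi *m v) i 0).
Proof.
have hi := integral_subring.
have E0 : (gLi *m v) 0 0 = v 0 0 by rewrite mulmx2E !mx2E; ring.
have E1 : (gLi *m v) 1 0 = w * v 1 0 by rewrite mulmx2E !mx2E; ring.
split=> [[v0 v1] i|h].
  case: (ord2P i) => ->; rewrite ?E0 // E1 mulrC; apply: v1.
  by apply/regularE; rewrite uw; exact: sring1.
split; first by rewrite -E0.
move=> c /regularE uc; rewrite (_ : v 1 0 * c = (w * v 1 0) * (u * c)).
  by apply: (sringM hi) => //; rewrite -E1.
by rewrite -[LHS]mul1r -uw; ring.
Qed.

(** Two bases of one lattice differ by an integral matrix with integral inverse; applying the
    inclusions to basis vectors shows the columns of [X] and [Y] to be integral. *)
Lemma lattice_eqP (g m : 'M[A]_2) : GL2 setT g -> GL2 setT m ->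
  [set g *m v | v in [set v : 'cV[A]_2 | forall i, integral (v i 0)]]
    = [set m *m v | v in spec_integral eta] <->
  exists2 q, GL2 Integral q & g = m *m gL *m q.
Proof.
move=> [gi [g1 g2 _ _]] [mi [m1 m2 _ _]].
have hi := integral_subring.
pose X := gLi *m mi *m g; pose Y := gi *m m *m gL.
have XY : X *m Y = 1%:M.
  rewrite /X /Y !mulmxA -[_ *m g *m gi]mulmxA g1 mulmx1.
  by rewrite -[_ *m mi *m m]mulmxA m2 mulmx1 gLiK.
have YX : Y *m X = 1%:M.
  rewrite /X /Y !mulmxA -[_ *m gL *m gLi]mulmxA gLK mulmx1.
  by rewrite -[_ *m m *m mi]mulmxA m1 mulmx1 g2.
have gE : g = m *m gL *m X.
  rewrite /X !mulmxA -[m *m gL *m gLi]mulmxA gLK mulmx1.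
  by rewrite m1 mul1mx.
split=> [E|[q qP gq]].
  exists X => //; exists Y; split=> //.
    move=> i j; have : [set m *m v | v in spec_integral eta] (g *m delta_mx j 0).
      rewrite -E; exists (delta_mx j 0) => // l /=; rewrite mxE /=.
      by case: (_ && _); [exact: sring1|exact: sring0].
    case=> v /spec_integralE vi ve; have := vi i.
    have -> : v = mi *m g *m delta_mx j 0 by rewrite -mulmxA -ve mulmxA m2 mul1mx.
    by rewrite !mulmxA -/X -colE mxE.
  move=> i j.
  have : [set g *m v | v in [set v : 'cV[A]_2 | forall i, integral (v i 0)]]
      (m *m gL *m delta_mx j 0).
    rewrite E; exists (gL *m delta_mx j 0); last by rewrite mulmxA.
    apply/spec_integralE => l; rewrite mulmxA gLiK mul1mx mxE /=.
    by case: (_ && _); [exact: sring1|exact: sring0].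
  case=> v /= vi ve; have := vi i.
  have -> : v = Y *m delta_mx j 0 by rewrite /Y -!mulmxA (mulmxA m) -ve mulmxA g2 mul1mx.
  by rewrite -colE mxE.
have [q' [[? [_ _ q'i _]] q1 q2]] := GL2_inv qP.
have [? [_ _ qi _]] := qP.
apply/seteqP; split=> _ [v vi <-].
  exists (gL *m q *m v); last by rewrite gq !mulmxA.
  apply/spec_integralE => i; rewrite !mulmxA gLiK mul1mx.
  by apply: (sring_mul hi) => // {}i j; rewrite (ord1 j).
exists (q' *m (gLi *m v)).
  move=> i; apply: (sring_mul hi) => // {}i j; rewrite (ord1 j).
  exact: (spec_integralE v).1.
rewrite gq !mulmxA -[_ *m q *m q']mulmxA q1 mulmx1.
by rewrite -[m *m gL *m gLi]mulmxA gLK mulmx1.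
Qed.

Lemma pushforwardE m P : spec_idele alpha m -> pushforward m P <->
  exists x : higgs eta alpha, [/\ P = higgs_class x, hphi x = S & hg x = m *m gL].
Proof.
move=> mP; have [mG _] := mP; split=> [[x [-> xS /(lattice_eqP (hgP x) mG)[q qP xq]]]|].
  have [y [yS yg]] := higgs_intro mP.
  exists y; split=> //; apply/higgs_class_eq; apply: higgs_iso_sym.
  exists 1%:M, 1, q; split=> //.
  - exact: GL2_1 principal_subring.
  - by exists 1; rewrite mulr1.
  - by rewrite mul1mx mulmx1 yg.
  - by rewrite xS yS mulmx1 mul1mx.
case=> x [-> xS xg]; exists x; split=> //.
apply/(lattice_eqP (hgP x) mG); exists 1%:M; first exact: GL2_1 integral_subring.
by rewrite mulmx1.
Qed.

Lemma pushforward_total m : spec_idele alpha m ->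
  exists P : HF eta alpha, pushforward m P.
Proof.
move=> mP; have [x [xS xg]] := higgs_intro mP.
by exists (higgs_class x); apply/(pushforwardE _ mP); exists x.
Qed.

(* Two spectral ideles have isomorphic push-forwards exactly when they agree
   up to the units of the function field of the spectral curve, scalar ideles
   and integral units. *)
Definition spec_equiv (m m' : 'M[A]_2) := exists gamma z q,
  [/\ GL2 Principal gamma, units z, GL2 Integral q,
      m' *m gL = gamma *m m *m gL *m z%:M *m q &
      S *m gamma = gamma *m S].

Lemma pushforward_eq m m' P P' : spec_idele alpha m -> spec_idele alpha m' ->
  pushforward m P -> pushforward m' P' -> (P = P' :> HF eta alpha) <-> spec_equiv m m'.
Proof.
move=> mP mP' /(pushforwardE _ mP)[x [-> xS xg]] /(pushforwardE _ mP')[y [-> yS yg]].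
rewrite higgs_class_eq; split=> [[g [z [q [h1 h2 h3 h4 h5]]]]|[g [z [q [h1 h2 h3 h4 h5]]]]];
  exists g, z, q; split=> //.
- by rewrite -yg h4 xg !mulmxA.
- by rewrite -[S in LHS]yS h5 xS.
- by rewrite yg h4 xg !mulmxA.
- by rewrite xS yS.
Qed.

Lemma integral_unit (x : A) : (forall p, x p != 0 /\ val p (x p) = 0) ->
  exists2 y : A, x * y = 1 & integral y.
Proof.
move=> xP; have yi p : vge (val p) 0 (x p)^-1.
  by have [x0 vx] := xP p; right; rewrite valuV // vx.
have yP : almost_integral (fun p => (x p)^-1).
  by apply: sub_finite_set (finite_set0 _) => p /=; case.
exists (Adele yP) => //; apply: adele_ext => p /=.
by rewrite divff //; case: (xP p).
Qed.

Lemma vge2_unit p : vge (val p) 0 (2%:R : hat p) /\ ~ vge (val p) 1 (2%:R : hat p).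
Proof.
have E : (2%:R : hat p) = cemb (hat p) (const C 2%:R) by rewrite !rmorph_nat.
have n0 : const C 2%:R != 0 by rewrite fmorph_eq0.
rewrite E; split; first by apply/vge_emb; exact: vge_const.
by move/vge_emb => /(vgeE _ _ n0); rewrite pval_const.
Qed.

Lemma unit_of_vge p (x : hat p) : vge (val p) 0 x -> ~ vge (val p) 1 x ->
  x != 0 /\ val p x = 0.
Proof.
move=> x0 x1; have nx : x != 0 by apply: contra_notN x1 => /eqP->; left.
by split=> //; move: x0 x1; rewrite !vgeE //; lia.
Qed.

(* The values at (1, 0), (0, 1) and (1, 1) of the quadratic form
   det (v | B v) are d, - c and d - 2 b - c; they are not all in the maximal
   ideal unless b^2 + c d is in its square. *)
Lemma cyclic_vector (b c d : A) : integral b -> integral c -> integral d ->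
  b * b + c * d = u * u * alpha ->
  exists x y z : A, [/\ integral x, integral y, integral z &
    (d * (x * x) - 2%:R * b * (x * y) - c * (y * y)) * z = 1].
Proof.
move=> ib ic id E.
pose P p (xy : hat p * hat p) :=
  [/\ vge (val p) 0 xy.1, vge (val p) 0 xy.2 &
   ~ vge (val p) 1 (d p * (xy.1 * xy.1) - 2%:R * b p * (xy.1 * xy.2)
       - c p * (xy.2 * xy.2))].
have v1 p : vge (val p) 0 1 by right; rewrite valuation1.
(* The vector is chosen place by place among three constant ones; these are integral everywhere, so
   the choices form adeles. *)
have /all_sig[xy xyP] p : {xy | P p xy}.
  apply: cid; have [hd|hd] := pselect (vge (val p) 1 (d p)); last first.
    exists (1, 0); split=> //=; first by left.
    by rewrite !mulr0 !mulr1 !subr0.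
  have [hc|hc] := pselect (vge (val p) 1 (c p)); last first.
    exists (0, 1); split=> //=; first by left.
    rewrite !mulr0 !mul0r !mulr1 mulr0 subr0 sub0r => /(vge_opp (vc p)).
    by rewrite opprK.
  exists (1, 1); split=> //=; rewrite !mulr1 => h.
  have hb : vge (val p) 1 (b p).
    have h2 : vge (val p) 1 (2%:R * b p).
      rewrite (_ : 2%:R * b p = d p - c p - (d p - 2%:R * b p - c p)); last by ring.
      by apply: vge_sub => //; apply: vge_sub.
    have [t0 t1] := vge2_unit p.
    have [n0 v20] := unit_of_vge t0 t1.
    rewrite -[b p](mulKf n0); apply: vge_mul0 => //.
    by right; rewrite valuV // v20.
  apply: (@nu p); rewrite -E.
  rewrite adeleDE !adeleME; apply: vge_add => //.
    by rewrite -[2]/(1 + 1); apply: vge_mul.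
  by rewrite -[2]/(1 + 1); apply: vge_mul.
have xP : almost_integral (fun p => (xy p).1).
  by apply: sub_finite_set (finite_set0 _) => p /=; have [? _ _] := xyP p.
have yP : almost_integral (fun p => (xy p).2).
  by apply: sub_finite_set (finite_set0 _) => p /=; have [_ ? _] := xyP p.
pose x := Adele xP; pose y := Adele yP.
have ix : integral x by move=> p; have [? _ _] := xyP p.
have iy : integral y by move=> p; have [_ ? _] := xyP p.
have hi := integral_subring.
have i2 : integral (2%:R : A).
  by rewrite -[2%:R]/(1 + 1); apply: (sringD hi); exact: sring1.
set q := d * (x * x) - 2%:R * b * (x * y) - c * (y * y).
have iq : integral q.
  by rewrite /q; apply: (sringB hi); [apply: (sringB hi)|];
    repeat (apply: (sringM hi) => //).
have [|z qz iz] := @integral_unit q; last by exists x, y, z.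
move=> p; apply: unit_of_vge; first exact: iq.
by have [_ _] := xyP p.
Qed.

(** The first basis vector is cyclic for [hphi x]: a zero lower left entry would make [alpha] the
    square of [f 0 0]. The columns of [gamma] are this vector and its image, a basis in which the
    Higgs field is the companion matrix. *)
Lemma higgs_reduction (x : higgs eta alpha) : exists gamma g,
  [/\ GL2 Principal gamma, GL2 setT g, hg x = gamma *m g,
      hphi x *m gamma = gamma *m S &
      forall i j, integral (u * (mxinv g *m S *m g) i j)].
Proof.
have hp := principal_subring.
set f := hphi x; have fp i j : principal (f i j) := hphi_principal x i j.
have f11 : f 1 1 = - f 0 0.
  by apply/eqP; rewrite -addr_eq0 addrC -mxtrace2 hphi_traceless.
have fdet : f 0 0 * f 0 0 + f 0 1 * f 1 0 = alpha.
  by rewrite -(hphi_det x) det_mx2 -/f f11; ring.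
have [h hE] := (principalP (f 1 0)).1 (fp _ _).
have h0 : h != 0.
  apply/eqP => h0; apply: (alpha_nonsquare alphaA' alpha_simple (fp 0 0)).
  by rewrite -fdet hE h0 rmorph0 mulr0 addr0.
pose gamma := mx2 1 (f 0 0) 0 (f 1 0).
have gP : GL2 Principal gamma.
  apply: (GL2_det hp (e := padele hat h^-1)) => //.
  - exact: sring1. - exact: sring0. - exact: principal_padele.
  - by rewrite mul1r mulr0 subr0 hE -rmorphM divff // rmorph1.
have fg : f *m gamma = gamma *m S.
  rewrite [f]mx2_eta spec_mx2 !mulmx_mx2 f11 -fdet; congr mx2; ring.
have [gi [giP g1 g2]] := GL2_inv gP.
have gT : GL2 setT gi by apply: GL2_sub giP.
have hT : GL2 setT (gi *m hg x).
  by apply: GL2_mul (hgP x) => //; exact: subring_setT.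
exists gamma, (gi *m hg x); split=> //.
  by rewrite mulmxA g1 mul1mx.
move=> i j; apply/regularE.
have [hi [_ i1 i2]] := GL2_inv (hgP x).
have -> : mxinv (gi *m hg x) = mxinv (hg x) *m gamma.
  rewrite (mxinvE i1 i2); apply: mxinvE.
    by rewrite mulmxA -[gi *m hg x *m hi]mulmxA i1 mulmx1.
  by rewrite mulmxA -[hi *m gamma *m gi]mulmxA g1 mulmx1.
have -> : mxinv (hg x) *m gamma *m S *m (gi *m hg x) =
    mxinv (hg x) *m f *m hg x.
  rewrite -[_ *m gamma *m S]mulmxA -fg !mulmxA.
  by rewrite -[_ *m gamma *m gi]mulmxA g1 mulmx1.
exact: hphi_regular.
Qed.

(** The lattice is free over the spectral order. A local cyclic vector of u B, followed by its
    image, gives [v] in GL_2 of the integral adeles. In [m], the new basis rescaled by [gLi], the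
    second column is tau times the first, so [m] is a multiplication matrix. *)
Theorem higgs_normal_form (x : higgs eta alpha) : exists gamma m q,
  [/\ GL2 Principal gamma, spec_idele alpha m, GL2 Integral q,
      hg x = gamma *m m *m gL *m q & hphi x *m gamma = gamma *m S].
Proof.
have [gamma [g [gP gT xg xf reg]]] := higgs_reduction x.
have [gi [_ g1 g2]] := GL2_inv gT.
rewrite (mxinvE g1 g2) in reg.
set B := gi *m S *m g in reg.
have Btr : B 1 1 = - B 0 0.
  apply/eqP; rewrite -addr_eq0 addrC -mxtrace2 /B mxtrace_mulC mulmxA g1 mul1mx.
  by rewrite mxtrace2 spec_mx2 !mx2E addr0.
have BB : B *m B = alpha%:M.
  rewrite /B !mulmxA -[_ *m g *m gi]mulmxA g1 mulmx1.
  rewrite -[gi *m S *m S]mulmxA spec_mxM.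
  have -> : spec_mx alpha (0 * 0 + alpha * 1 * 1) (0 * 1 + 1 * 0) = alpha%:M.
    by rewrite spec_mx2 scalar_mx2; congr mx2; ring.
  by rewrite scalar_mxC -mulmxA g2 mulmx1.
have Bdet : B 0 0 * B 0 0 + B 0 1 * B 1 0 = alpha.
  by have := congr1 (fun N : 'M[A]_2 => N 0 0) BB; rewrite mulmx2E scalar_mx2 mx2E.
have [||||x0 [y0 [z [ix iy iz xyz]]]] :=
  @cyclic_vector (u * B 0 0) (u * B 0 1) (u * B 1 0); try exact: reg.
  by rewrite -Bdet; ring.
pose v : 'M[A]_2 := mx2 x0 (u * B 0 0 * x0 + u * B 0 1 * y0)
                 y0 (u * B 1 0 * x0 - u * B 0 0 * y0).
have hi := integral_subring.
have vP : GL2 Integral v.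
  apply: (GL2_det hi _ _ _ _ iz) => //.
  - by apply: (sringD hi); apply: (sringM hi).
  - by apply: (sringB hi); apply: (sringM hi).
  - by rewrite -xyz; ring.
have [vi [viP v1 v2]] := GL2_inv vP.
pose m := g *m v *m gLi.
have vE : v *m gLi *m mx2 0 0 1 0 = B *m v *m mx2 1 0 0 0.
  rewrite [B]mx2_eta /v /gLi !mulmx_mx2 Btr; congr mx2; ring: uw.
have mS : m *m mx2 0 0 1 0 = S *m m *m mx2 1 0 0 0.
  have -> : S *m m *m mx2 1 0 0 0 = S *m g *m v *m mx2 1 0 0 0.
    rewrite /m !mulmxA -[_ *m gLi *m _]mulmxA; congr (_ *m _).
    by rewrite mulmx_mx2; congr mx2; ring.
  rewrite /m -!mulmxA (mulmxA v) vE /B !mulmxA g1 mul1mx.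
  by [].
exists gamma, m, vi; split=> //; last first.
  rewrite xg /m !mulmxA -[_ *m gLi *m gL]mulmxA gLiK mulmx1.
  by rewrite -[_ *m v *m vi]mulmxA v1 mulmx1.
split.
  rewrite /m; apply: (GL2_mul (subring_setT _)); last by exists gL; rewrite gLK gLiK.
  by apply: (GL2_mul (subring_setT _)) => //; apply: GL2_sub vP.
exists (m 0 0), (m 1 0); exact: spec_mx_of_col mS.
Qed.

Corollary pushforward_surj (P : HF eta alpha) :
  exists2 m, spec_idele alpha m & pushforward m P.
Proof.
have [x ->] := higgs_class_surj P.
have [g [m [q [gP mP qP xg xf]]]] := higgs_normal_form x.
exists m => //; apply/(pushforwardE _ mP).
have [y [yS yg]] := higgs_intro mP; exists y; split=> //.
apply/higgs_class_eq; apply: higgs_iso_sym; exists g, 1, q; split=> //.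
- by exists 1; rewrite mulr1.
- by rewrite mulmx1 yg xg !mulmxA.
- by rewrite yS.
Qed.

End HiggsNormalForm.

(** * Finiteness of the Hitchin fiber *)

Lemma pigeonhole (T : finType) (r : nat) (f : 'I_r -> T) : (#|T| < r)%N ->
  exists i j, i != j /\ f i = f j.
Proof.
move=> Tr; apply: contrapT => nf.
have fi : injective f.
  move=> i j fij; apply/eqP/negPn/negP => ij; apply: nf; by exists i, j.
by have := leq_card f fi; rewrite card_ord leqNgt Tr.
Qed.

(* If the translates of M by B cover V and L meets B trivially, then L/N
   embeds into M/N. *)
Lemma separated_transfer (V : zmodType) (B M N L : V -> Prop) :
  (forall v, exists2 b, B b & M (v - b)) ->
  (forall x y, B x -> B y -> B (x - y)) ->
  (forall x y, L x -> L y -> L (x - y)) ->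
  (forall v, L v -> B v -> v = 0) -> (forall v, N v -> L v) ->
  forall (r : nat) (s : 'I_r -> V), (forall i, L (s i)) ->
  (forall i j, i != j -> ~ N (s i - s j)) ->
  exists s' : 'I_r -> V, (forall i, M (s' i)) /\
    (forall i j, i != j -> ~ N (s' i - s' j)).
Proof.
move=> cov Bsub Lsub LB NL r s sL sN.
have /choice[b bP] i : exists b, B b /\ M (s i - b).
  by have [b] := cov (s i); exists b.
exists (fun i => s i - b i); split=> [i|i j ij Nij]; first by case: (bP i).
apply: (sN i j ij).
have E : b i - b j = (s i - s j) - (s i - b i - (s j - b j)).
  by rewrite [- (_ - (s j - b j))]opprD addrACA subKr -opprD subKr.
have : b i - b j = 0.
  apply: LB; last by apply: Bsub; case: (bP i); case: (bP j).
  by rewrite E; apply: (Lsub); [apply: Lsub|apply: NL].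
move/eqP; rewrite E subr_eq0 => /eqP->; exact: Nij.
Qed.

(** * Global vectors in adelic lattices *)

Section Minkowski.
Variables (k : finFieldType) (C : curve k).
Variable hat : forall p : place C, completion p.
Local Notation K := (funfield C).
Local Notation A := (adele hat).
Local Notation val p := (@cval _ _ _ (hat p)).
Local Notation Principal := (@principal _ _ hat).
Variable eta : weil_differential hat.
Hypothesis eta_neq0 : exists x, eta x != 0.

Let vc p : is_valuation (val p) := cval_valuation (hat p).

Definition mball n m D (M : 'M[A]_(n, m)) := forall i j, aball D (M i j).

Lemma mball_mul n m D D' (M : 'M[A]_(n, 2)) (N : 'M[A]_(2, m)) :
  mball D M -> mball D' N -> mball (fun p => D p + D' p) (M *m N).
Proof.
by move=> hM hN i j; rewrite mulmx2E; apply: aballD; apply: aballM.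
Qed.

Lemma mball_scale n m D D' x (M : 'M[A]_(n, m)) :
  aball D x -> mball D' M -> mball (fun p => D p + D' p) (x *: M).
Proof. by move=> hx hM i j; rewrite mxE; apply: aballM. Qed.

Lemma mballB n m D (M N : 'M[A]_(n, m)) : mball D M -> mball D N -> mball D (M - N).
Proof. by move=> hM hN i j; rewrite !mxE; apply: aballB. Qed.

Lemma mballN n m D (M : 'M[A]_(n, m)) : mball D M -> mball D (- M).
Proof. by move=> hM i j; rewrite !mxE; apply: aballN. Qed.

Lemma mball_le n m D D' (M : 'M[A]_(n, m)) :
  (forall p, D' p <= D p) -> mball D M -> mball D' M.
Proof. by move=> h hM i j; apply: aball_le (hM i j). Qed.

Lemma in_mball n m (M : 'M[A]_(n, m)) : exists2 D, divisor D & mball D M.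
Proof.
have [D dD DP] := in_aball_seq [seq M ij.1 ij.2 | ij : 'I_n * 'I_m].
by exists D => // i j; apply: DP; apply/mapP; exists (i, j); rewrite ?mem_enum.
Qed.

Lemma mball_quotient n m D D' : divisor D -> divisor D' ->
  exists (T : finType) (f : 'M[A]_(n, m) -> T), forall M N,
    mball D M -> mball D N -> f M = f N -> mball D' (M - N).
Proof.
move=> dD dD'; have [s sP] := finite_quotient hat dD dD'.
have /choice[i iP] x : exists i : 'I_(size s).+1, aball D x ->
    aball D' (x - nth 0 s i).
  have [xD|nx] := pselect (aball D x); last by exists ord0.
  have [y ys xy] := sP x xD.
  have ly : (index y s < (size s).+1)%N by rewrite ltnS index_size.
  by exists (Ordinal ly) => _ /=; rewrite nth_index.
exists {ffun 'I_n * 'I_m -> 'I_(size s).+1}, (fun M => [ffun ij => i (M ij.1 ij.2)]).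
move=> M N hM hN fMN a b.
move/ffunP/(_ (a, b)): fMN; rewrite !ffunE /= => fab.
rewrite !mxE (_ : M a b - N a b =
  (M a b - nth 0 s (i (M a b))) - (N a b - nth 0 s (i (M a b)))).
  by apply: aballB; [|rewrite fab]; apply: iP.
by ring.
Qed.

Definition mprincipal n m (M : 'M[A]_(n, m)) := forall i j, Principal (M i j).

Lemma mprincipalB n m (M N : 'M[A]_(n, m)) :
  mprincipal M -> mprincipal N -> mprincipal (M - N).
Proof.
move=> hM hN i j; rewrite !mxE.
exact: (sringB (principal_subring hat)).
Qed.

Lemma mprincipalP n m (M : 'M[A]_(n, m)) : mprincipal M ->
  exists N : 'M[K]_(n, m), M = map_mx (padele hat) N.
Proof.
move=> hM; have /choice[f fP] (ij : 'I_n * 'I_m) :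
  exists f, M ij.1 ij.2 = padele hat f by exact/principalP/hM.
exists (\matrix_(i, j) f (i, j)); apply/matrixP => i j.
by rewrite !mxE -fP.
Qed.

Lemma finite_mprincipal n m D : divisor D ->
  finite_set [set N : 'M[K]_(n, m) | mball D (map_mx (padele hat) N)].
Proof.
move=> dD; have /finite_fsetP[X XE] := finite_global_sections eta_neq0 dD.
have Xin (N : 'M[K]_(n, m)) i j : mball D (map_mx (padele hat) N) -> N i j \in X.
  move=> /(_ i j); rewrite mxE => /padele_ball h.
  by have := congr1 (fun Y => Y (N i j)) XE => /= <-.
case: (fset_0Vmem X) => [X0|[x0 x0X]].
  have [[i j]|no] := pselect (exists i : 'I_n * 'I_m, True).
    apply: sub_finite_set (finite_set0 _) => N /= /(Xin _ i.1 i.2).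
    by rewrite X0 inE.
  apply: sub_finite_set (finite_set1 0) => N _; apply/matrixP => a b.
  by case: no; exists (a, b).
pose code (N : 'M[K]_(n, m)) : {ffun 'I_n * 'I_m -> X} :=
  [ffun ij => insubd [`x0X]%fset (N ij.1 ij.2)].
apply: (@finite_set_inj _ _ _ [set: {ffun 'I_n * 'I_m -> X}] code) => //.
move=> N N' hN hN' E; apply/matrixP => i j.
move/ffunP/(_ (i, j)): E; rewrite !ffunE => /(congr1 (\val)) /=.
by rewrite !insubdK //; apply: Xin.
Qed.

Variable D0 : place C -> int.
Hypothesis dD0 : divisor D0.
Hypothesis sa : forall y : A, exists f : K, forall p,
  vge (val p) (D0 p) (y p - cemb (hat p) f).
Variables z w : A.
Hypothesis zw : z * w = 1.
Variable p0 : place C.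
Hypothesis zv : forall p, z p != 0 /\ val p (z p) = (p == p0)%:Z.
Hypothesis wv : forall p, w p != 0 /\ val p (w p) = - (p == p0)%:Z.

Local Notation V := 'cV[A]_2.
Implicit Types v : V.

Lemma z_integral : aball (fun _ => 0) z.
Proof. by move=> p; right; have [_ ->] := zv p; case: (p == p0). Qed.

Lemma mball_z v : mball D0 v -> mball D0 (z *: v).
Proof.
move=> hv; have := mball_scale z_integral hv.
by apply: mball_le => p; rewrite add0r.
Qed.

Lemma mball_zX v j : mball D0 v -> mball D0 (z ^+ j *: v).
Proof.
move=> hv; elim: j => [|j IH]; first by rewrite expr0 scale1r.
by rewrite exprS -scalerA; apply: mball_z.
Qed.

Lemma vector_cover v : exists2 b : V, mprincipal b & mball D0 (v - b).
Proof.
have /choice[f fP] i : exists f : K, aball D0 (v i 0 - padele hat f).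
  by have [f] := sa (v i 0); exists f.
exists (\col_i padele hat (f i)) => i j.
  by rewrite mxE; exact: principal_padele.
by rewrite (ord1 j) !mxE.
Qed.

Lemma w_escapes : exists2 v : V, mball D0 v & ~ mball D0 (w *: v).
Proof.
have [e [_ [_ eP _]]] := idele_of_divisor hat dD0.
exists (\col_i e) => [i j|/(_ 0 0)]; rewrite !mxE.
  by move=> p; right; have [_ ->] := eP p.
move=> /(_ p0); have [e0 ve] := eP p0; have [w0 vw] := wv p0.
rewrite adeleME vgeE ?mulf_neq0 // (valuM (vc p0) w0 e0) ve vw eqxx.
by lia.
Qed.

Section Dual.
Variables m h : 'M[A]_2.
Hypothesis mh : m *m h = 1%:M.
Hypothesis hm : h *m m = 1%:M.

(* A Minkowski argument without volumes: if neither m M nor w h M (for M the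
   ball of D0, so w M is strictly larger than M) met the global vectors, then
   comparing quotients, M/(M \cap h M) would embed into itself after adding a
   class. *)
Lemma minkowski_dual :
  (forall v, mball D0 v -> mprincipal (m *m v) -> v = 0) ->
  exists v, [/\ mball D0 v, v <> 0 & mprincipal (h *m (w *: v))].
Proof.
move=> mK; apply: contrapT => nK.
have hK v : mball D0 v -> mprincipal (h *m (w *: v)) -> v = 0.
  by move=> hv pv; apply: contrapT => v0; apply: nK; exists v.
(* [P r] provides r classes of M/(M \cap m M): h x lies in M exactly when x lies in m M. *)
pose P r := exists s : 'I_r -> V, (forall i, mball D0 (s i)) /\
  forall i j, i != j -> ~ mball D0 (h *m (s i - s j)).
have wz v : w *: (z *: v) = v by rewrite scalerA mulrC zw scale1r.
have [e0 he0 ne0] := w_escapes.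
have step r : P r -> P r.+1.
  move=> [s [sM sN]].
  (* First transfer: the map h carries the r classes into h M/(M \cap h M), the vector h w e0
     outside h M adds one more, and all of them move from w h M to M, still distinct modulo M \cap h
     M. *)
  pose t (i : 'I_r.+1) : V :=
    if unlift ord_max i is Some j then h *m s j else h *m (w *: e0).
  pose L (x : V) := exists2 v, mball D0 v & x = h *m (w *: v).
  pose N (x : V) := mball D0 x /\ exists2 v, mball D0 v & x = h *m v.
  have [|v [v1 hv1 ->] /(hK _ hv1)->|x [_ [v hv ->]]|i|i j ij|s' [sM' sN']] :=
    @separated_transfer V (@mprincipal 2 1) (@mball 2 1 D0) N L vector_cover
      (@mprincipalB _ _) _ _ _ _ t.
  - move=> _ _ [v1 h1 ->] [v2 h2 ->]; exists (v1 - v2); first exact: mballB.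
    by rewrite -mulmxBr scalerBr.
  - by rewrite scaler0 mulmx0.
  - by exists (z *: v); rewrite ?wz //; exact: mball_z.
  - rewrite /t; case: unliftP => [j _|_]; last by exists e0.
    by exists (z *: s j); rewrite ?wz //; exact: mball_z.
  - have inj x y : h *m x = h *m y -> x = y.
      by move=> E; rewrite -[x]mul1mx -mh -mulmxA E mulmxA mh mul1mx.
    rewrite /t; case: unliftP ij => [i' ->|->]; case: unliftP => [j' ->|->];
      rewrite ?eqxx // => ij [N1 [v hv E]].
    + apply: (sN i' j'); first by apply: contra_neq ij => ->.
      by rewrite mulmxBr.
    + move: E; rewrite -mulmxBr => /inj /eqP; rewrite subr_eq => /eqP E.
      apply: ne0; rewrite (_ : w *: e0 = s i' - v); first exact: mballB.
      by rewrite E addrC addKr.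
    + move: E; rewrite -mulmxBr => /inj /eqP; rewrite subr_eq => /eqP E.
      apply: ne0; rewrite E -[v + _]opprK opprD; apply: mballN.
      by apply: mballB => //; apply: mballN.
  (* Second transfer: the map m carries these r + 1 classes into m M/(M \cap m M), and they move
     from m M to M. *)
  pose L2 (x : V) := exists2 v, mball D0 v & x = m *m v.
  pose N2 (x : V) := mball D0 x /\ exists2 v, mball D0 v & x = m *m v.
  have [|v [v1 hv1 ->] /(mK _ hv1)->|x [_ [v hv ->]]|i|i j ij|s2 [sM2 sN2]] :=
    @separated_transfer V (@mprincipal 2 1) (@mball 2 1 D0) N2 L2 vector_cover
      (@mprincipalB _ _) _ _ _ _ (fun i => m *m s' i).
  - move=> _ _ [v1 h1 ->] [v2 h2 ->]; exists (v1 - v2); first exact: mballB.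
    by rewrite -mulmxBr.
  - by rewrite mulmx0.
  - by exists v.
  - by exists (s' i).
  - rewrite -mulmxBr => -[hN _]; apply: (sN' i j ij); split; first exact: mballB.
    by exists (m *m (s' i - s' j)) => //; rewrite mulmxA hm mul1mx.
  exists s2; split=> // i j ij hN; apply: (sN2 i j ij); split; first exact: mballB.
  by exists (h *m (s2 i - s2 j)) => //; rewrite mulmxA mh mul1mx.
have Pall r : P r.
  by elim: r => [|r /step//]; exists (fun _ => 0); split=> [[]//|[]].
have [E dE hE] := in_mball h.
have [T [f fP]] := mball_quotient 2 1 (divisorD dE dD0) dD0.
have [s [sM sN]] := Pall #|T|.+1.
have [i [j [ij fij]]] := pigeonhole (fun i => f (h *m s i)) (ltnSn _).
apply: (sN i j ij); rewrite mulmxBr; apply: fP => //; exact: mball_mul.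
Qed.

(** Only finitely many global vectors lie in m M. For a nonzero one, N, the vector h N has a nonzero
    component at [p0], which bounds the powers of [z] that can be divided out. *)
Lemma scaling_shrinks : exists j, forall v, mball D0 v ->
  mprincipal (m *m (z ^+ j *: v)) -> v = 0.
Proof.
have [E dE mE] := in_mball m.
have /finite_fsetP[X XE] := finite_mprincipal 2 1 (divisorD dE dD0).
have /choice[J JP] (N : 'cV[K]_2) : exists J, forall j v, (J <= j)%N ->
    mball D0 v -> map_mx (padele hat) N = m *m (z ^+ j *: v) -> N = 0.
  have [->|N0] := eqVneq N 0; first by exists 0%N.
  pose c := h *m map_mx (padele hat) N.
  have [i ci] : exists i, (c i 0) p0 != 0.
    apply: contrapT => nc; case/eqP: N0; apply/matrixP => i l; rewrite (ord1 l) mxE.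
    have : map_mx (padele hat) N = m *m c by rewrite /c mulmxA mh mul1mx.
    move/matrixP/(_ i 0); rewrite mxE mulmx2E => /(congr1 (fun x => aval x p0)).
    have c0 l' : (c l' 0) p0 = 0.
      by apply/eqP/negPn/negP => h'; apply: nc; exists l'.
    rewrite adeleDE !adeleME !c0 !mulr0 addr0 padeleE => /eqP.
    by rewrite fmorph_eq0 => /eqP.
  exists (absz (val p0 ((c i 0) p0) - D0 p0)%R).+1 => j v Jj hv NE; exfalso.
  have cE : c = z ^+ j *: v by rewrite /c NE mulmxA hm mul1mx.
  have zj : (z ^+ j : A) p0 = z p0 ^+ j.
    elim: (j) => [|n IH]; first by rewrite !expr0.
    by rewrite !exprS adeleME IH.
  have [z0 vz] := zv p0.
  have v0 : (v i 0) p0 != 0.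
    by move: ci; rewrite cE mxE adeleME mulf_eq0 negb_or => /andP[].
  have := hv i 0 p0; rewrite vgeE // => hvi.
  move: Jj; rewrite cE mxE adeleME zj (valuM (vc p0)) ?expf_neq0 //.
  rewrite (valuX (vc p0)) // vz eqxx -mulr_natr natz mul1r.
  by move: hvi; move: (val p0 _) (D0 p0) => a b; lia.
exists (\sum_(N <- X) J N)%N => v hv hp.
have [N NE] := mprincipalP hp.
have NX : N \in X.
  have := congr1 (fun Y => Y N) XE => /= <-; rewrite -NE.
  by apply: mball_mul => //; exact: mball_zX.
have N0 : N = 0.
  by apply: (JP N _ v _ hv (esym NE)); rewrite (big_rem N) //= leq_addr.
have E0 : z ^+ (\sum_(N <- X) J N)%N *: v = 0.
  rewrite -[LHS]mul1mx -hm -mulmxA NE N0.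
  by rewrite (_ : map_mx _ 0 = 0) ?mulmx0 //; apply/matrixP => i j; rewrite !mxE rmorph0.
rewrite -[v]scale1r -(expr1n _ (\sum_(N <- X) J N)%N) -zw exprMn mulrC.
by rewrite -scalerA E0 scaler0.
Qed.

End Dual.

(** Multiplication by [z] shrinks the lattice; [t] is chosen where t m M still contains a nonzero
    global vector and z t m M no longer does. The absence of such vectors in the latter yields one
    on the dual side. *)
Lemma critical_scaling (m h : 'M[A]_2) : m *m h = 1%:M -> h *m m = 1%:M ->
  exists t ti, [/\ t * ti = 1,
   exists v, [/\ mball D0 v, v <> 0 & mprincipal (t *: m *m v)] &
   exists v, [/\ mball D0 v, v <> 0 & mprincipal (ti *: h *m (w *: (w *: v)))]].
Proof.
move=> mh hm.
have scK (a b : A) (M N : 'M[A]_2) : a * b = 1 -> M *m N = 1%:M ->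
    (a *: M) *m (b *: N) = 1%:M.
  by move=> ab MN; rewrite -scalemxAl -scalemxAr scalerA ab MN scale1r.
have zwX j : z ^+ j * w ^+ j = 1 by rewrite -exprMn zw expr1n.
have wzX j : w ^+ j * z ^+ j = 1 by rewrite mulrC.
have [j1 j1P] := scaling_shrinks hm mh.
(* With the roles of [m] and [h] exchanged, this shows that a sufficiently enlarged m M contains a
   global vector. *)
have [|v [v1 v2 v3]] := @minkowski_dual (z ^+ j1 *: h) (w ^+ j1 *: m)
    (scK _ _ _ _ (zwX _) hm) (scK _ _ _ _ (wzX _) mh).
  by move=> v hv; rewrite -scalemxAl scalemxAr; apply: j1P.
pose Q i := exists v, [/\ mball D0 v, v <> 0 &
   mprincipal ((w ^+ j1.+1 * z ^+ i) *: m *m v)].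
have Q0 : Q 0%N.
  exists v; split=> //; move: v3.
  by rewrite expr0 mulr1 exprSr -scalemxAr scalemxAl scalerA [w * _]mulrC.
have [j2 j2P] := scaling_shrinks (scK _ _ _ _ (wzX j1.+1) mh)
                   (scK _ _ _ _ (zwX j1.+1) hm).
have nQ : ~ Q j2.
  case=> v' [h1 h2 h3]; apply: h2; apply: j2P => //.
  by rewrite -scalemxAr scalemxAl scalerA [z ^+ _ * _]mulrC.
have [i [Qi nQi]] : exists i, Q i /\ ~ Q i.+1.
  apply: contrapT => nex; apply: nQ; elim: j2 {j2P} => // i IH.
  by apply: contrapT => nQ; apply: nex; exists i.
have tt : (w ^+ j1.+1 * z ^+ i) * (z ^+ j1.+1 * w ^+ i) = 1.
  by rewrite mulrACA wzX zwX mulr1.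
exists (w ^+ j1.+1 * z ^+ i), (z ^+ j1.+1 * w ^+ i); split=> //.
have tt' : (w ^+ j1.+1 * z ^+ i.+1) * (z ^+ j1.+1 * w ^+ i.+1) = 1.
  by rewrite mulrACA wzX zwX mulr1.
(* One factor [w] comes from [minkowski_dual], the other from passing to the next scaling. *)
have [|v' [h1 h2 h3]] := @minkowski_dual ((w ^+ j1.+1 * z ^+ i.+1) *: m)
    ((z ^+ j1.+1 * w ^+ i.+1) *: h)  (scK _ _ _ _ tt' mh)
    (scK _ _ _ _ (etrans (mulrC _ _) tt') hm).
  by move=> v' hv' hp; apply: contrapT => v0; apply: nQi; exists v'.
exists v'; split=> //; move: h3; congr mprincipal.
by rewrite -!scalemxAl -!scalemxAr !scalerA; congr (_ *: _); rewrite !exprS; ring.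
Qed.

End Minkowski.

(** * Bounded representatives of spectral ideles *)

Section SpectralIdeles.
Variables (k : finFieldType) (char_k : 2%:R != 0 :> k) (C : curve k).
Variable hat : forall p : place C, completion p.
Local Notation K := (funfield C).
Local Notation A := (adele hat).
Local Notation val p := (@cval _ _ _ (hat p)).
Local Notation Integral := (@integral _ _ hat).
Local Notation Principal := (@principal _ _ hat).
Variable eta : weil_differential hat.
Hypothesis eta_neq0 : exists x, eta x != 0.
Variable alpha : A.
Hypothesis alphaA' : nonsquare_quad_diff eta alpha.
Hypothesis alpha_simple : simple_zeros eta alpha.
Variables u w : A.
Hypothesis uw : u * w = 1.
Hypothesis ou : has_order eta u.
Hypothesis iu : integral (u * u * alpha).
Hypothesis nu : forall p, ~ vge (val p) 2 ((u * u * alpha) p).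

Local Notation S := (spec_mx alpha 0 1).
Local Notation gL := (gL u).
Local Notation gLi := (gLi w).
Local Notation spec_idele := (spec_idele alpha).

Lemma spec_mx_comm (M : 'M[A]_2) x y : M = spec_mx alpha x y -> S *m M = M *m S.
Proof. by move=> ->; rewrite spec_mxC. Qed.

Lemma spec_idele_comm m : spec_idele m -> S *m m = m *m S.
Proof. by case=> _ [x [y /spec_mx_comm]]. Qed.

Lemma spec_ideleC m m' : spec_idele m -> spec_idele m' -> m *m m' = m' *m m.
Proof. by case=> _ [x [y ->]] [_ [x' [y' ->]]]; rewrite spec_mxC. Qed.

Lemma spec_idele_intro m : GL2 setT m -> m *m S = S *m m -> spec_idele m.
Proof.
move=> mG mS; split=> //; exists (m 0 0), (m 1 0).
exact: spec_mx_commutant.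
Qed.

Lemma spec_idele_inv m : spec_idele m -> exists mi,
  [/\ spec_idele mi, m *m mi = 1%:M & mi *m m = 1%:M].
Proof.
move=> mP; have [mG _] := mP; have [mi [miG m1 m2]] := GL2_inv mG.
exists mi; split=> //; apply: spec_idele_intro => //.
by apply: (commute_inv m1 m2); rewrite (spec_idele_comm mP).
Qed.

Lemma spec_idele_mul m m' : spec_idele m -> spec_idele m' -> spec_idele (m *m m').
Proof.
move=> mP mP'; apply: spec_idele_intro.
  by apply: (GL2_mul (subring_setT _)); [case: mP|case: mP'].
by rewrite -mulmxA -(spec_idele_comm mP') mulmxA -(spec_idele_comm mP) mulmxA.
Qed.

Lemma spec_idele1 : spec_idele 1%:M.
Proof.
apply: spec_idele_intro; first exact: GL2_1 (subring_setT _).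
by rewrite mul1mx mulmx1.
Qed.

Lemma spec_idele_scale m t ti : t * ti = 1 -> spec_idele m -> spec_idele (t *: m).
Proof.
move=> tt mP; have [mi [miP m1 m2]] := spec_idele_inv mP.
apply: spec_idele_intro; last first.
  by rewrite -scalemxAl -(spec_idele_comm mP) scalemxAr.
exists (ti *: mi); split=> //; rewrite -scalemxAl -scalemxAr scalerA.
  by rewrite tt m1 scale1r.
by rewrite mulrC tt m2 scale1r.
Qed.

(** The column (x, y) is read as the element x + y tau of adele[tau]. *)
Definition vec_spec (v : 'cV[A]_2) := spec_mx alpha (v 0 0) (v 1 0).

Lemma vec_spec_mul m v : S *m m = m *m S -> vec_spec (m *m v) = m *m vec_spec v.
Proof.
move=> mS; have E := spec_mx_commutant (esym mS).
rewrite /vec_spec [m in RHS]E spec_mxM !mulmx2E; congr spec_mx.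
by rewrite [m in LHS]E spec_mx2 !mx2E; ring.
by rewrite [m in LHS]E spec_mx2 !mx2E; ring.
Qed.

Lemma vec_spec_scale t v : vec_spec (t *: v) = t *: vec_spec v.
Proof.
rewrite /vec_spec !spec_mx2 !mxE; apply: mx2P; rewrite !mxE /=; ring.
Qed.

Lemma vec_spec_principal v : mprincipal v -> v <> 0 -> exists li,
  [/\ GL2 Principal (vec_spec v), GL2 Principal li, vec_spec v *m li = 1%:M,
      li *m vec_spec v = 1%:M & S *m li = li *m S].
Proof.
move=> pv v0; have hp := principal_subring hat.
have [[a0 _] sq] := alphaA'.
have [c c0 ac] := alpha_principal alphaA'.
have [f fE] := (principalP _).1 (pv 0 0); have [g gE] := (principalP _).1 (pv 1 0).
have d0 : f * f - c * g * g != 0.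
  apply/eqP => /eqP; rewrite subr_eq0 => /eqP fg.
  have [g0|g0] := eqVneq g 0.
    apply: v0; apply/matrixP => i j; rewrite (ord1 j) [RHS]mxE.
    have f0 : f = 0 by apply/eqP; rewrite -[_ == _]orbb -mulf_eq0 fg g0 mulr0.
    by case: (ord2P i) => ->; rewrite ?fE ?gE ?f0 ?g0 rmorph0.
  apply: (alpha_nonsquare alphaA' alpha_simple (principal_padele hat (f / g))).
  rewrite ac -rmorphM; congr padele; rewrite mulf_div fg -[c * g * g]mulrA mulfK //.
  by rewrite mulf_neq0.
have G : GL2 Principal (vec_spec v).
  rewrite /vec_spec spec_mx2 fE gE; apply: (GL2_det hp (e := padele hat (f * f - c * g * g)^-1));
    try exact: principal_padele.
    by rewrite ac -rmorphM; exact: principal_padele.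
  by rewrite ac -!rmorphM -rmorphB -rmorphM (_ : f * f - _ = f * f - c * g * g)
     ?divff ?rmorph1 //; ring.
have [li [liP l1 l2]] := GL2_inv G; exists li; split=> //.
by apply/esym; apply: (commute_inv l1 l2); rewrite /vec_spec spec_mxC.
Qed.

Lemma mball_mx2 D (a b c d : A) : aball D a -> aball D b -> aball D c ->
  aball D d -> mball D (mx2 a b c d).
Proof.
by move=> ? ? ? ? i j; case: (ord2P i) => ->; case: (ord2P j) => ->; rewrite mx2E.
Qed.

Lemma vec_spec_ball D : divisor D -> exists2 D', divisor D' &
  forall v : 'cV[A]_2, mball D v -> mball D' (vec_spec v).
Proof.
move=> dD; have [Ea dEa Ha] := in_aball alpha.
exists (fun p => Num.min (D p) (Ea p + D p)).
  by apply: (@divisor2 _ _ (fun a b => Num.min a (b + a)) D Ea) => //; rewrite addr0 minxx.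
move=> v hv; rewrite /vec_spec spec_mx2.
have h i : aball (fun p => Num.min (D p) (Ea p + D p)) (v i 0).
  by apply: aball_min; left; exact: hv.
by apply: mball_mx2 => //; apply: aball_min; right; apply: aballM.
Qed.

(** The ball contains finitely many global vectors, so one divisor bounds all their inverses. *)
Lemma common_inverse_ball D : divisor D -> exists2 D', divisor D' &
  forall v, mprincipal v -> mball D v -> v <> 0 ->
  forall li, vec_spec v *m li = 1%:M -> li *m vec_spec v = 1%:M -> mball D' li.
Proof.
move=> dD; have /finite_seqP[X XE] := finite_mprincipal eta_neq0 2 1 dD.
pose inv (N : 'cV[K]_2) := mxinv (vec_spec (map_mx (padele hat) N)).
have [D' dD' DP] := in_aball_seq
  [seq inv N ij.1 ij.2 | N <- X, ij <- enum {: 'I_2 * 'I_2}].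
exists D' => // v pv hv v0 li l1 l2 i j.
have [N vE] := mprincipalP pv.
rewrite -(mxinvE l1 l2) vE; apply: DP.
apply: (@allpairs_f _ _ _ (fun N ij => inv N ij.1 ij.2) _ _ N (i, j)).
  by have := congr1 (fun Y => Y N) XE => /= <-; rewrite -vE.
by rewrite mem_enum.
Qed.

(** With M = t m, the critical scaling gives global elements l = M v and l' = M^-1 x^2 v' of K[tau]
    with v, v' in a fixed ball. Their product c = x^2 v v' is global and bounded, so c^-1 is bounded
    as well. The representative l^-1 M equals c^-1 x^2 v', and its inverse M^-1 l equals v. *)
Theorem bounded_representatives : exists2 E, divisor E &
  forall m, spec_idele m -> exists m' mi', [/\ spec_idele m', m' *m mi' = 1%:M,
    mi' *m m' = 1%:M, mball E m' /\ mball E mi' & spec_equiv alpha u m m'].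
Proof.
have [D0 [dD0 _ sa]] := strong_approximation hat.
have [p0 _] := place_exists eta_neq0.
have dp0 : divisor (fun p : place C => (p == p0)%:Z).
  apply: sub_finite_set (finite_set1 p0) => p /=.
  by have [->//|] := eqVneq p p0.
have [z [x [zx zv xv]]] := idele_of_divisor hat dp0.
have [E1 dE1 smE1] := vec_spec_ball dD0.
have [Ex dEx xE] := in_aball (x * x).
pose D2 p := Ex p + (E1 p + E1 p).
have dD2 : divisor D2 by apply: divisorD => //; apply: divisorD.
have [E2 dE2 invE2] := common_inverse_ball dD2.
pose E3 p := E2 p + (Ex p + E1 p).
have dE3 : divisor E3 by apply: divisorD => //; apply: divisorD.
exists (fun p => Num.min (E1 p) (E3 p)).
  exact: (@divisor2 _ _ Num.min E1 E3 (minxx 0)).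
move=> m mP; have [mi [miP m1 m2]] := spec_idele_inv mP.
have [t [ti [tt [v [hv v0 pv]] [v' [hv' v0' pv']]]]] :=
  critical_scaling eta_neq0 dD0 sa zx zv xv m1 m2.
pose M := t *: m; pose Mi := ti *: mi.
have MP : spec_idele M by exact: spec_idele_scale tt mP.
have MiP : spec_idele Mi by apply: (@spec_idele_scale _ _ t) miP; rewrite mulrC.
have M1 : M *m Mi = 1%:M by rewrite -scalemxAl -scalemxAr scalerA tt m1 scale1r.
have M2 : Mi *m M = 1%:M.
  by rewrite -scalemxAl -scalemxAr scalerA mulrC tt m2 scale1r.
pose l := M *m v; pose l' := Mi *m (x *: (x *: v')).
have l0 : l <> 0.
  by move=> l0; apply: v0; rewrite -[v]mul1mx -M2 -mulmxA -/l l0 mulmx0.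
have zx2 : (z * z) * (x * x) = 1 by rewrite mulrACA zx mulr1.
have l0' : l' <> 0.
  move=> l0'; apply: v0'; have xx0 : x *: (x *: v') = 0.
    by rewrite -[LHS]mul1mx -M1 -mulmxA -/l' l0' mulmx0.
  by rewrite -[v']scale1r -zx2 -scalerA -[(x * x) *: _]scalerA xx0 scaler0.
have [li [lP liP l1 l2 lS]] := vec_spec_principal pv l0.
have [li' [lP' liP' l1' l2' lS']] := vec_spec_principal pv' l0'.
have lE : vec_spec l = M *m vec_spec v by apply: vec_spec_mul; exact: spec_idele_comm.
have lE' : vec_spec l' = (x * x) *: (Mi *m vec_spec v').
  rewrite vec_spec_mul; last exact: spec_idele_comm.
  by rewrite !vec_spec_scale scalerA -scalemxAr.
have comm (a b : 'cV[A]_2) : vec_spec a *m vec_spec b = vec_spec b *m vec_spec a by exact: spec_mxC.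
have smS a : S *m vec_spec a = vec_spec a *m S by rewrite /vec_spec spec_mxC.
pose c := vec_spec l *m l'.
have cE : vec_spec c = vec_spec l *m vec_spec l' by apply: vec_spec_mul.
have cE2 : vec_spec c = (x * x) *: (vec_spec v *m vec_spec v').
  rewrite cE lE lE' -scalemxAr; congr (_ *: _).
  have MC : M *m vec_spec v = vec_spec v *m M.
    by have [_ [a [b ->]]] := MP; rewrite spec_mxC.
  by rewrite MC -!mulmxA (mulmxA M) M1 mul1mx.
have col_sm (a : 'cV[A]_2) i : a i 0 = vec_spec a i 0.
  by rewrite /vec_spec spec_mx2; case: (ord2P i) => ->; rewrite mx2E.
have cb : mball D2 c.
  move=> i j; rewrite (ord1 j) col_sm cE2; apply: mball_scale => //.
  by apply: mball_mul; apply: smE1.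
have pc : mprincipal c.
  have [? [_ _ h _]] := lP.
  move=> i j; apply: (sring_mul (principal_subring hat)) => //; exact: pv'.
have ci1 : vec_spec c *m (li' *m li) = 1%:M.
  by rewrite cE -mulmxA (mulmxA (vec_spec l')) l1' mul1mx l1.
have ci2 : (li' *m li) *m vec_spec c = 1%:M.
  by rewrite cE -mulmxA (mulmxA li) l2 mul1mx l2'.
have c0 : c <> 0.
  move=> c0; apply: l0'; rewrite -[l']mul1mx -l2 -mulmxA -/c c0 mulmx0 //.
have ib := invE2 c pc cb c0 _ ci1 ci2.
have liE : li = (li' *m li) *m vec_spec l'.
  by rewrite -mulmxA [li *m vec_spec l'](_ : _ = vec_spec l' *m li) ?mulmxA ?l2' ?mul1mx //;
  apply: (commute_inv l1 l2); exact: comm.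
have LiP : spec_idele li.
  by apply: spec_idele_intro => //; apply: GL2_sub liP.
have M'E : li *m M = (li' *m li) *m ((x * x) *: vec_spec v').
  have E' : vec_spec l' *m M = (x * x) *: vec_spec v'.
    rewrite lE' -scalemxAl -mulmxA (_ : vec_spec v' *m M = M *m vec_spec v').
      by rewrite mulmxA M2 mul1mx.
    by have [_ [a [b ->]]] := MP; rewrite spec_mxC.
  by transitivity ((li' *m li *m vec_spec l') *m M); [rewrite -liE|rewrite -mulmxA E'].
have MiE : Mi *m vec_spec l = vec_spec v by rewrite lE mulmxA M2 mul1mx.
exists (li *m M), (Mi *m vec_spec l); split.
- exact: spec_idele_mul.
- by rewrite mulmxA -[_ *m M *m Mi]mulmxA M1 mulmx1 l2.
- by rewrite mulmxA -[_ *m vec_spec l *m li]mulmxA l1 mulmx1 M2.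
- split.
    rewrite M'E; apply: (@mball_le _ _ _ _ _ E3); first by move=> p; rewrite ge_min lexx orbT.
    by apply: mball_mul => //; apply: mball_scale => //; apply: smE1.
  rewrite MiE; apply: (@mball_le _ _ _ _ _ E1); first by move=> p; rewrite ge_min lexx.
  exact: smE1.
- exists li, t, 1%:M; split=> //.
  + by exists ti.
  + exact: GL2_1 (integral_subring hat).
  + by rewrite mulmx1 mul_mx_scalar -!scalemxAr -!scalemxAl -mulmxA.
Qed.

(** If two bounded representatives m, m' are close, gL^-1 m^-1 m' gL is 1 plus an integral matrix,
    and so is its inverse; hence their push-forwards agree. The divisor [D] compensates the bounds
    of [gLi], m^-1 and [gL]. *)
Theorem HF_finite : finite_set [set: HF eta alpha].
Proof.
have [E dE HE] := bounded_representatives.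
have hi := integral_subring hat.
have [E1 dE1 LE1] := in_mball gL; have [E2 dE2 LE2] := in_mball gLi.
pose D p := - (E2 p + E p + E1 p).
have dD : divisor D by apply: divisorN; do 2?apply: divisorD.
have [T [f fP]] := mball_quotient hat 2 2 dE dD.
have ex P : exists mm : 'M[A]_2 * 'M[A]_2, [/\ spec_idele mm.1, mm.1 *m mm.2 = 1%:M,
    mm.2 *m mm.1 = 1%:M, mball E mm.1 /\ mball E mm.2 &
    pushforward mm.1 (P : HF eta alpha)].
  have [m mP mP'] := pushforward_surj char_k alphaA' alpha_simple uw ou iu nu P.
  have [m' [mi' [h1 h2 h3 h4 h5]]] := HE m mP.
  exists (m', mi'); split=> //=.
  have [Q QP] := pushforward_total alphaA' uw ou iu h1.
  by rewrite ((pushforward_eq alphaA' uw ou iu mP h1 mP' QP).2 h5).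
have [mm mmP] := choice ex.
apply: (@finite_set_inj _ _ _ [set: T] (fun P => f (mm P).1)) => //.
move=> P Q _ _ fPQ.
have [a1 a2 a3 [a4 a5] a6] := mmP P; have [b1 b2 b3 [b4 b5] b6] := mmP Q.
apply/(pushforward_eq alphaA' uw ou iu a1 b1 a6 b6).
have key (m mi m' : 'M[A]_2) : mi *m m = 1%:M -> mball E mi ->
    mball D (m' - m) -> forall i j, Integral ((gLi *m mi *m m' *m gL) i j).
  move=> mm1 hmi hd i j.
  have -> : gLi *m mi *m m' *m gL = 1%:M + gLi *m mi *m (m' - m) *m gL.
    rewrite mulmxBr -[_ *m mi *m m]mulmxA mm1 mulmx1 mulmxBl gLiK //.
    by rewrite addrC subrK.
  have addE (M N : 'M[A]_2) : (M + N) i j = M i j + N i j by rewrite mxE.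
  rewrite addE; apply: (sringD hi); first by have [? [_ _ h _]] := GL2_1 hi; exact: h.
  have := mball_mul (mball_mul (mball_mul LE2 hmi) hd) LE1.
  move=> /(_ i j); apply: aball_le => p; rewrite /D; lia.
have PQ := fP _ _ a4 b4 fPQ.
have QP : mball D ((mm Q).1 - (mm P).1) by rewrite -opprB; apply: mballN.
exists 1%:M, 1, (gLi *m (mm P).2 *m (mm Q).1 *m gL); split.
- exact: GL2_1 (principal_subring hat).
- by exists 1; rewrite mulr1.
- exists (gLi *m (mm Q).2 *m (mm P).1 *m gL).
  have inv (m mi m' mi' : 'M[A]_2) : m *m mi = 1%:M -> mi' *m m' = 1%:M ->
     (gLi *m mi' *m m *m gL) *m (gLi *m mi *m m' *m gL) = 1%:M.
    move=> e1 e2; rewrite !mulmxA -[_ *m gL *m gLi]mulmxA gLK // mulmx1.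
    rewrite -[_ *m m *m mi]mulmxA e1 mulmx1 -[_ *m mi' *m m']mulmxA e2 mulmx1.
    exact: gLiK.
  split; [exact: (inv _ _ _ _ b2 a3)|exact: (inv _ _ _ _ a2 b3)
    |exact: (key _ _ _ a3 a5 QP)|exact: (key _ _ _ b3 b5 PQ)].
- rewrite mul1mx mulmx1 !mulmxA -[_ *m gL *m gLi]mulmxA gLK // mulmx1.
  by rewrite a2 mul1mx.
- by rewrite mulmx1 mul1mx.
Qed.

End SpectralIdeles.

(** * The Hitchin function of a character and its Hecke eigenvalues *)

Section KillingForm.
Variable R : comPzRingType.
Implicit Types X Y g h : 'M[R]_2.

Lemma killingE X Y :
  killing X Y = 4%:R * \tr (X *m Y) - 2%:R * (\tr X * \tr Y).
Proof.
have sum2 (F : 'I_2 -> R) : \sum_i F i = F 0 + F 1.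
  by rewrite big_ord_recl big_ord1; congr (_ + F _); apply: val_inj.
have d00 : delta_mx 0 0 = mx2 1 0 0 0 :> 'M[R]_2 by apply: mx2P; rewrite !mxE.
have d01 : delta_mx 0 1 = mx2 0 1 0 0 :> 'M[R]_2 by apply: mx2P; rewrite !mxE.
have d10 : delta_mx 1 0 = mx2 0 0 1 0 :> 'M[R]_2 by apply: mx2P; rewrite !mxE.
have d11 : delta_mx 1 1 = mx2 0 0 0 1 :> 'M[R]_2 by apply: mx2P; rewrite !mxE.
have subE (M N : 'M[R]_2) i j : (M - N) i j = M i j - N i j by rewrite !mxE.
rewrite /killing !sum2 d00 d01 d10 d11 /lie !mxtrace2.
by rewrite !(subE, mulmx2E, mx2E); ring.
Qed.

Lemma killingDl X X' Y : killing (X + X') Y = killing X Y + killing X' Y.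
Proof. by rewrite !killingE mulmxDl !mxtraceD; ring. Qed.

Lemma killingBr X Y Y' : killing X (Y - Y') = killing X Y - killing X Y'.
Proof. by rewrite !killingE mulmxBr !raddfB /=; ring. Qed.

Lemma killing_scalar a Y : killing a%:M Y = 0.
Proof.
rewrite killingE mul_scalar_mx mxtraceZ mxtrace_scalar.
by rewrite -[a *+ 2]mulr_natr; ring.
Qed.

Lemma killing_ad g h X Y : g *m h = 1%:M -> h *m g = 1%:M ->
  killing (g *m X *m h) Y = killing X (h *m Y *m g).
Proof.
move=> gh hg; rewrite !killingE; congr (_ * _ - _ * _).
  by rewrite -!mulmxA [\tr (g *m _)]mxtrace_mulC !mulmxA.
rewrite [\tr (g *m X *m h)]mxtrace_mulC mulmxA hg mul1mx.
by rewrite [\tr (h *m Y *m g)]mxtrace_mulC mulmxA gh mul1mx.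
Qed.

Lemma killing_delta (i j : 'I_2) a Y : \tr Y = 0 ->
  killing (a *: delta_mx i j) Y = 4%:R * (a * Y j i).
Proof.
move=> Y0; rewrite killingE Y0 mulr0 mulr0 subr0 -scalemxAl mxtraceZ.
congr (_ * (_ * _)); rewrite /mxtrace (bigD1 i) //= big1 ?addr0.
  rewrite mxE (bigD1 j) //= mxE !eqxx mul1r big1 ?addr0 // => l lj.
  by rewrite mxE (negPf lj) andbF mul0r.
move=> l li; rewrite mxE big1 // => l' _.
by rewrite mxE (negPf li) mul0r.
Qed.

End KillingForm.

(** * Matrices over the dual numbers and bundle classes *)

Section DualMatrices.
Variables (k : finFieldType) (C : curve k).
Variable hat : forall p : place C, completion p.
Local Notation A := (adele hat).
Local Notation DA := (dual A).
Implicit Types g h : 'M[DA]_2.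

Lemma dreM (x y : DA) : dre (x * y) = dre x * dre y. Proof. by []. Qed.
Lemma depsM (x y : DA) : deps (x * y) = dre x * deps y + deps x * dre y.
Proof. by []. Qed.
Lemma dreD (x y : DA) : dre (x + y) = dre x + dre y. Proof. by []. Qed.
Lemma depsD (x y : DA) : deps (x + y) = deps x + deps y. Proof. by []. Qed.

Lemma mx_reM g h : mx_re (g *m h) = mx_re g *m mx_re h.
Proof.
apply/matrixP => i j; rewrite [RHS]mulmx2E mxE (mulmx2E g h) dreD !dreM.
by rewrite !mxE.
Qed.

Lemma mx_imM g h : mx_im (g *m h) = mx_re g *m mx_im h + mx_im g *m mx_re h.
Proof.
apply/matrixP => i j.
rewrite mxE (mulmx2E g h) depsD !depsM [RHS]mxE !mulmx2E !mxE.
by rewrite addrACA.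
Qed.

Lemma mx_re_scalar (x : DA) : mx_re x%:M = (dre x)%:M.
Proof. by apply/matrixP => i j; rewrite !mxE; case: (i == j). Qed.

Lemma mx_im_scalar (x : DA) : mx_im x%:M = (deps x)%:M.
Proof. by apply/matrixP => i j; rewrite !mxE; case: (i == j). Qed.

Lemma mx_re1 : mx_re (1%:M : 'M[DA]_2) = 1%:M.
Proof. exact: mx_re_scalar. Qed.
Lemma mx_im1 : mx_im (1%:M : 'M[DA]_2) = 0.
Proof. by rewrite mx_im_scalar; apply/matrixP => i j; rewrite !mxE mul0rn. Qed.

Lemma GL2_re_im (T : set DA) (T' : set A) g : (forall x, T x -> T' (dre x)) ->
  (forall x, T x -> T' (deps x)) -> GL2 T g -> exists h,
  [/\ g *m h = 1%:M /\ h *m g = 1%:M,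
   mx_re g *m mx_re h = 1%:M /\ mx_re h *m mx_re g = 1%:M,
   GL2 T' (mx_re g), forall i j, T' (mx_re h i j) & forall i j, T' (mx_im g i j)].
Proof.
move=> h1 h2 [h [gh hg gT hT]]; exists h.
have e1 : mx_re g *m mx_re h = 1%:M by rewrite -mx_reM gh mx_re1.
have e2 : mx_re h *m mx_re g = 1%:M by rewrite -mx_reM hg mx_re1.
have T1 i j : T' (mx_re h i j) by rewrite mxE; exact: h1.
split.
- by [].
- by [].
- by exists (mx_re h); split=> // i j; rewrite mxE; exact: h1.
- exact: T1.
- by move=> i j; rewrite mxE; exact: h2.
Qed.

Lemma GL2_re g : GL2 setT g -> exists h, [/\ g *m h = 1%:M, h *m g = 1%:M,
   mx_re g *m mx_re h = 1%:M, mx_re h *m mx_re g = 1%:M & GL2 setT (mx_re g)].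
Proof.
move=> gP; have [//|//|h [[h1 h2] [h3 h4] h5 _ _]] := @GL2_re_im setT setT g _ _ gP.
by exists h.
Qed.

(* Ad and the functions sealed in the same way below are given through an
   opaque proof because unification would otherwise unfold them. *)
Fact Ad_subproof :
  {ad : 'M[A]_2 -> 'M[A]_2 -> 'M[A]_2 | forall g X : 'M[A]_2, ad g X = g *m X *m mxinv g}.
Proof. by exists (fun g X : 'M[A]_2 => g *m X *m mxinv g). Qed.
Definition Ad := sval Ad_subproof.

Lemma Ad_def (g X : 'M[A]_2) : Ad g X = g *m X *m mxinv g.
Proof. exact: (svalP Ad_subproof). Qed.

Lemma AdE (g h X : 'M[A]_2) : g *m h = 1%:M -> h *m g = 1%:M ->
  Ad g X = g *m X *m h.
Proof. by move=> gh hg; rewrite Ad_def (mxinvE gh hg). Qed.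

Lemma Ad_mul (g h X : 'M[A]_2) : GL2 setT g -> GL2 setT h ->
  Ad (g *m h) X = Ad g (Ad h X).
Proof.
move=> [g' [g1 g2 _ _]] [h' [h1 h2 _ _]].
rewrite (AdE _ g1 g2) (AdE _ h1 h2) (@AdE _ (h' *m g')) ?mulmxA //.
  by rewrite -[_ *m h *m h']mulmxA h1 mulmx1.
by rewrite -[_ *m g' *m g]mulmxA g2 mulmx1.
Qed.

Lemma AdD (g X Y : 'M[A]_2) : Ad g (X + Y) = Ad g X + Ad g Y.
Proof. by rewrite !Ad_def mulmxDr mulmxDl. Qed.

Lemma Ad_scalar (g : 'M[A]_2) a : GL2 setT g -> Ad g a%:M = a%:M.
Proof.
move=> [h [gh hg _ _]]; rewrite (AdE _ gh hg) scalar_mxC -mulmxA gh mulmx1 //.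
Qed.

(** The logarithmic derivative is a cocycle for the adjoint action. *)
Lemma bundle_class_mul g h : GL2 setT g -> GL2 setT h ->
  bundle_class (g *m h) = bundle_class g + Ad (mx_re g) (bundle_class h).
Proof.
move=> /GL2_re[g' [g1 g2 g3 g4 _]] /GL2_re[h' [h1 h2 h3 h4 _]].
rewrite /bundle_class (AdE _ g3 g4) (mxinvE g3 g4) (mxinvE h3 h4).
rewrite (@mxinvE _ _ (mx_re h' *m mx_re g')).
- rewrite mx_imM mulmxDl addrC !mulmxA; congr (_ *m _ + _).
  by rewrite -[_ *m mx_re h *m _]mulmxA h3 mulmx1.
- by rewrite mx_reM mulmxA -[_ *m mx_re h *m _]mulmxA h3 mulmx1.
- by rewrite mx_reM mulmxA -[_ *m mx_re g' *m _]mulmxA g4 mulmx1.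
Qed.

Lemma bundle_class_scalar (z : DA) : units z ->
  exists a, bundle_class z%:M = a%:M.
Proof.
move=> [y zy]; have e : dre z * dre y = 1 by rewrite -dreM zy.
exists (deps z * dre y); rewrite /bundle_class mx_re_scalar mx_im_scalar.
rewrite (@mxinvE _ _ (dre y)%:M) -?scalar_mxM //; first by rewrite e.
by rewrite mulrC e.
Qed.

Definition dmx (X Y : 'M[A]_2) : 'M[DA]_2 := \matrix_(i, j) Dual (X i j) (Y i j).

Lemma mx_re_dmx X Y : mx_re (dmx X Y) = X.
Proof. by apply/matrixP => i j; rewrite !mxE. Qed.
Lemma mx_im_dmx X Y : mx_im (dmx X Y) = Y.
Proof. by apply/matrixP => i j; rewrite !mxE. Qed.

Lemma dmxK g : dmx (mx_re g) (mx_im g) = g.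
Proof. by apply/matrixP => i j; rewrite !mxE; case: (g i j). Qed.

Lemma dmx_mul X Y X' Y' : dmx X Y *m dmx X' Y' = dmx (X *m X') (X *m Y' + Y *m X').
Proof.
by rewrite -[LHS]dmxK mx_reM mx_imM !mx_re_dmx !mx_im_dmx.
Qed.

Lemma dmx1 : dmx 1%:M 0 = 1%:M.
Proof. by rewrite -[RHS]dmxK mx_re1 mx_im1. Qed.

Lemma GL2_dmx_const (T : set A) (X : 'M[A]_2) : T 0 -> GL2 T X -> GL2 (dual_set T) (dmx X 0).
Proof.
move=> T0 [Y [h1 h2 h3 h4]]; exists (dmx Y 0).
rewrite !dmx_mul !mulmx0 !mul0mx addr0 h1 h2 dmx1; split=> // i j; rewrite mxE;
  by split=> //=; rewrite mxE.
Qed.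

Lemma GL2_dmx_eps (T : set A) (Z : 'M[A]_2) : subring_set T -> (forall i j, T (Z i j)) ->
  GL2 (dual_set T) (dmx 1%:M Z).
Proof.
move=> hT hZ; have [? [_ _ h1 _]] := GL2_1 hT.
exists (dmx 1%:M (- Z)); rewrite !dmx_mul !(mulmx1, mul1mx) subrr addNr dmx1.
split=> // i j; rewrite mxE; split=> //=; rewrite ?mxE; last exact: sringN.
Qed.

Lemma bundle_class_dmx_const X : bundle_class (dmx X 0) = 0.
Proof. by rewrite /bundle_class mx_im_dmx mul0mx. Qed.

Lemma bundle_class_dmx_eps Z : bundle_class (dmx 1%:M Z) = Z.
Proof.
by rewrite /bundle_class mx_im_dmx mx_re_dmx (@mxinvE _ _ 1%:M) ?mulmx1.
Qed.

Lemma nil_unipE x : nil_unip x = dmx 1%:M (mx2 0 x 0 0) :> 'M[DA]_2.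
Proof.
apply/matrixP => i j; rewrite !mxE.
case: (ord2P i) => ->; case: (ord2P j) => -> /=; rewrite ?mulr0 ?mulr1 ?addr0 ?add0r //.
Qed.

Lemma dual_setT : dual_set (setT : set A) = setT.
Proof. by apply/seteqP; split. Qed.

End DualMatrices.

(** * The group structure of the Hitchin fiber and its characters *)

Section CharacterBasis.
Variables (k : finFieldType) (char_k : 2%:R != 0 :> k) (C : curve k).
Variable hat : forall p : place C, completion p.
Local Notation A := (adele hat).
Local Notation val p := (@cval _ _ _ (hat p)).
Variable eta : weil_differential hat.
Hypothesis eta_neq0 : exists x, eta x != 0.
Variable alpha : A.
Hypothesis alphaA' : nonsquare_quad_diff eta alpha.
Hypothesis alpha_simple : simple_zeros eta alpha.
Variables u w : A.
Hypothesis uw : u * w = 1.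
Hypothesis ou : has_order eta u.
Hypothesis iu : integral (u * u * alpha).
Hypothesis nu : forall p, ~ vge (val p) 2 ((u * u * alpha) p).

Local Notation S := (spec_mx alpha 0 1).
Local Notation spec_idele := (spec_idele alpha).
Local Notation spec_equiv := (spec_equiv alpha u).
Local Notation HF := (HF eta alpha).

Let push_eq := pushforward_eq alphaA' uw ou iu.
Let push_total := pushforward_total alphaA' uw ou iu.

(** All ideles and [g1], [g2] lie in the commutative algebra adele[tau]. Moving m1' next to [gL]
    before the second substitution keeps [q1] and [q2] to the right of [gL], with which they do not
    commute. *)
Lemma spec_equiv_mul m1 m1' m2 m2' : spec_idele m1 -> spec_idele m1' ->
  spec_idele m2 -> spec_idele m2' -> spec_equiv m1 m1' -> spec_equiv m2 m2' ->
  spec_equiv (m1 *m m2) (m1' *m m2').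
Proof.
move=> h1 h1' h2 h2' [g1 [z1 [q1 [g1P [i1 zi1] q1P E1 c1]]]].
move=> [g2 [z2 [q2 [g2P [i2 zi2] q2P E2 c2]]]].
have hi := integral_subring hat; have hp := principal_subring hat.
have cg (g m : 'M[A]_2) : S *m g = g *m S -> spec_idele m -> m *m g = g *m m.
  move=> Sg [_ [x [y ->]]]; rewrite (spec_mx_commutant (esym Sg)).
  by rewrite spec_mxC.
exists (g2 *m g1), (z1 * z2), (q1 *m q2); split.
- exact: GL2_mul.
- by exists (i1 * i2); rewrite mulrACA zi1 zi2 mulr1.
- exact: GL2_mul.
- rewrite -mulmxA E2 !mulmxA (cg _ _ c2 h1') -[g2 *m m1' *m m2]mulmxA.
  rewrite (spec_ideleC h1' h2) -!mulmxA (mulmxA m1') E1 !mulmxA.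
  rewrite -[g2 *m m2 *m g1]mulmxA (cg _ _ c1 h2) !mulmxA.
  rewrite -[_ *m m2 *m m1]mulmxA (spec_ideleC h2 h1) !mulmxA scalar_mxM !mulmxA.
  congr (_ *m _); rewrite -[in LHS]mulmxA -[in RHS]mulmxA; congr (_ *m _).
  by rewrite scalar_mxC.
- by rewrite mulmxA c2 -mulmxA c1 mulmxA.
Qed.

(** The product is defined through chosen ideles and is independent of the choice by
    [spec_equiv_mul]; the axioms then follow from those of ideles, as an idele has only one
    push-forward. *)
Lemma HF_group : exists (one : HF) mul inv, [/\ associative mul, commutative mul,
  left_id one mul /\ left_inverse one inv mul, pushforward 1%:M one &
  forall m m' P P', spec_idele m -> spec_idele m' -> pushforward m P ->
    pushforward m' P' -> pushforward (m *m m') (mul P P')].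
Proof.
have /choice[rep repP] (P : HF) : exists m, spec_idele m /\ pushforward m P.
  by have [m h1 h2] := pushforward_surj char_k alphaA' alpha_simple uw ou iu nu P; exists m.
have s1 : spec_idele 1%:M by exact: spec_idele1.
have rP P : spec_idele (rep P) by case: (repP P).
have rM P Q : spec_idele (rep P *m rep Q) by apply: spec_idele_mul.
have [one oneP] := push_total s1.
have /choice[mul0 mulP] PQ := push_total (rM PQ.1 PQ.2).
pose mul P Q := mul0 (P, Q).
have /choice[ri riP] P : exists mi, spec_idele mi /\ mi *m rep P = 1%:M.
  by have [mi [h1 _ h2]] := spec_idele_inv (rP P); exists mi.
have siP P : spec_idele (ri P) by case: (riP P).
have /choice[inv invP] P := push_total (siP P).
have pm m m' P P' : spec_idele m -> spec_idele m' -> pushforward m P ->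
    pushforward m' P' -> pushforward (m *m m') (mul P P').
  move=> mP mP' pP pP'; have mm := spec_idele_mul mP mP'.
  have [Q QP] := push_total mm.
  have e1 := (push_eq (rP P) mP (repP P).2 pP).1 erefl.
  have e2 := (push_eq (rP P') mP' (repP P').2 pP').1 erefl.
  have := spec_equiv_mul (rP P) mP (rP P') mP' e1 e2.
  by move/(push_eq (rM P P') mm (mulP (P, P')) QP).2; rewrite /mul => ->.
have uniq m (P P' : HF) : spec_idele m -> pushforward m P -> pushforward m P' -> P = P'.
  move=> mP h1 h2; apply/(push_eq mP mP h1 h2).
  by apply/(push_eq mP mP h1 h1).
exists one, mul, inv; split=> // [P Q T|P Q|].
- have h1 := rP P; have h2 := rP Q; have h3 := rP T.
  have q1 := (repP P).2; have q2 := (repP Q).2; have q3 := (repP T).2.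
  apply: (uniq (rep P *m rep Q *m rep T)).
  + by apply: spec_idele_mul.
  + by rewrite -mulmxA; apply: (pm) => //; apply: (pm).
  + by apply: (pm) => //; apply: (pm).
- apply: (uniq (rep P *m rep Q)) => //; first exact: (pm _ _ _ _ (rP P) (rP Q) (repP P).2 (repP Q).2).
  rewrite (spec_ideleC (rP P) (rP Q)); exact: (pm _ _ _ _ (rP Q) (rP P) (repP Q).2 (repP P).2).
- split=> P.
    apply: (uniq (rep P)) => //; last exact: (repP P).2.
    by rewrite -[rep P]mul1mx; apply: (pm) => //; exact: (repP P).2.
  apply: (uniq 1%:M) => //; have [_ <-] := riP P.
  by apply: (pm) => //; exact: (repP P).2.
Qed.

Variable R : realType.

(** Since every class is a push-forward, [HF_character] describes the characters of the group of
    [HF_group]; by finiteness every function has finite support. *)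
Theorem HF_characters_basis : is_basis
  (@finitely_supported _ _ _ eta R alpha) (@HF_character _ _ _ eta R alpha).
Proof.
have [one [mul [inv [mA mC [m1 mV] p1 pm]]]] := HF_group.
have fin := HF_finite char_k eta_neq0 alphaA' alpha_simple uw ou iu nu.
have s1 : spec_idele 1%:M by exact: spec_idele1.
have uniq m (P P' : HF) : spec_idele m -> pushforward m P -> pushforward m P' -> P = P' :> HF.
  move=> mP h1 h2; apply/(push_eq mP mP h1 h2).
  by apply/(push_eq mP mP h1 h1).
have charE (chi : HF -> R[i]) : HF_character chi <-> is_character one mul chi.
  split=> [[c1 cM]|[c1 cM]]; split.
  - exact: c1.
  - move=> P Q; have surj := pushforward_surj char_k alphaA' alpha_simple uw ou iu nu.
    have [m hm hP] := surj P; have [m' hm' hQ] := surj Q.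
    by apply: (cM m m') => //; exact: pm.
  - by move=> P hP; rewrite (uniq _ _ _ s1 hP p1).
  - move=> m m' P P' Q hm hm' hP hP' hQ.
    rewrite (uniq _ _ _ (spec_idele_mul hm hm') hQ (pm _ _ _ _ hm hm' hP hP')).
    exact: cM.
split=> [chi _|n e c ei he rel|s _].
- by apply: sub_finite_set fin.
- have [N [t [r [tK rK]]]] := finite_enumeration fin.
  apply: (characters_free mA mC m1 mV tK rK ei) => // i.
  exact/charE.
- have [m [e [c [he se]]]] := @characters_span _ _ _ _ mA mC m1 mV fin R[i] s.
  by exists m, e, c; split=> // i; apply/charE.
Qed.

End CharacterBasis.

(** * Averaging characters over finite lists *)

Section Averaging.
Variables (V : zmodType) (F : fieldType) (I : eqType) (chi : I -> V -> F).
Variable N : nat.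
Hypothesis N_gt0 : (0 < N)%N.
Hypothesis chiD : forall i x y, chi i (x + y) = chi i x * chi i y.
Hypothesis chiN : forall i x, chi i x ^+ N = 1.

(** Combining the list with the multiples y j, j < N, of a point where [chi i] is nontrivial
    multiplies each sum by a geometric sum. That of [chi i] belongs to an N-th root of unity other
    than 1 and vanishes; the earlier sums stay 0. *)
Lemma averaging_list (L : seq I) :
  (forall i, i \in L -> exists x, chi i x != 1) ->
  exists s : seq V, (0 < size s)%N /\
    forall i, i \in L -> \sum_(x <- s) chi i x = 0.
Proof.
have chi0 i : chi i 0 = 1.
  have n0 : chi i 0 != 0.
    apply/eqP => c0; have /eqP := chiN i 0.
    by rewrite c0 expr0n eqn0Ngt N_gt0 eq_sym oner_eq0.
  by apply: (mulfI n0); rewrite -chiD addr0 mulr1.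
have chiX i x j : chi i (x *+ j) = chi i x ^+ j.
  by elim: j => [|j IH]; rewrite ?mulr0n ?expr0 // mulrS chiD IH exprS.
elim: L => [_|i L IH nontriv]; first by exists [:: 0].
have [|s [s0 sP]] := IH.
  by move=> l lL; apply: nontriv; rewrite inE lL orbT.
have [y yi] := nontriv i (mem_head _ _).
exists [seq y *+ j + x | j <- iota 0 N, x <- s]; split.
  by rewrite size_allpairs size_iota muln_gt0 N_gt0.
move=> l; rewrite inE => lL.
rewrite big_allpairs_dep /=.
transitivity ((\sum_(0 <= j < N) chi l y ^+ j) * (\sum_(x <- s) chi l x)).
  rewrite /index_iota subn0 mulr_suml; apply: eq_bigr => j _.
  by rewrite mulr_sumr; apply: eq_bigr => x _; rewrite chiD chiX.
case/orP: lL => [/eqP->|/sP->]; last by rewrite mulr0.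
suff -> : \sum_(0 <= j < N) chi i y ^+ j = 0 by rewrite mul0r.
have yi' : chi i y - 1 != 0 by rewrite subr_eq0.
by apply: (mulfI yi'); rewrite big_mkord -subrX1 chiN subrr mulr0.
Qed.

End Averaging.

Lemma finzmod_card (k : finFieldType) (x : k) : x *+ #|k| = 0.
Proof.
have : \sum_(y : k) y = \sum_(y : k) (x + y) by rewrite (reindex_inj (addrI x)).
rewrite (_ : \sum_y (x + y) = x *+ #|k| + \sum_(y : k) y); last first.
  by rewrite big_split sumr_const.
by rewrite -{1}[\sum_(y : k) y]add0r => /addIr.
Qed.

(** * Vanishing of integrals of nontrivial characters *)

Section HaarIntegral.
Variables (k : finFieldType) (C : curve k).
Variable hat : forall p : place C, completion p.
Local Notation A := (adele hat).
Variable R : realType.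
Local Notation CC := (R[i]).

(** A translation permutes the cosets of the periods, so the sum over them is also its mean over a
    list of translations; a list on which all the characters sum to 0 makes it vanish. *)
Lemma haar_eq0 (F : A -> CC) (I : eqType) (L : seq I) (c : I -> CC)
    (chi : I -> A -> CC) (N : nat) : (0 < N)%N ->
  (forall i x y, chi i (x + y) = chi i x * chi i y) ->
  (forall i x, chi i x ^+ N = 1) ->
  (forall i, i \in L -> exists x, chi i x != 1) ->
  (forall x, F x = \sum_(i <- L) c i * chi i x) -> haar F = 0.
Proof.
move=> N0 chiD chiN nontriv FE; rewrite /haar.
set Q := period_cosets F.
(* With infinitely many cosets the sum of ones has the default value 0, whose inverse is 0. *)
have [Qfin|Qinf] := pselect (finite_set Q); last first.
  rewrite (@fsbig_dflt _ _ _ _ Q) ?invr0 ?mul0r //.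
  apply: contra_not Qinf; apply: sub_finite_set => X QX; split=> //=.
  by apply/eqP; rewrite oner_eq0.
suff -> : \sum_(X \in Q) F (xget 0 X) = 0 by rewrite mulr0.
have [s [s0 sP]] := averaging_list N0 chiD chiN nontriv.
have per0 : periods F 0 by move=> x; rewrite addr0.
have FQ X x : Q X -> X x -> F (xget 0 X) = F x.
  move=> [y ->] [b pb <-]; rewrite pb.
  case: xgetP => [_ -> [b' pb' <-]|/(_ y)[]]; first by rewrite pb'.
  by exists 0 => //; rewrite addr0.
have QxX X : Q X -> X (xget 0 X).
  move=> [y ->]; apply: (@xgetPex _ 0 [set y + b | b in periods F]).
  by exists y; exists 0 => //; rewrite addr0.
pose tau y (X : set A) : set A := [set x + y | x in X].
have tauK y X : tau (- y) (tau y X) = X.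
  apply/seteqP; split=> [_ [_ [x Xx <-] <-]|x Xx]; first by rewrite addrK.
  by exists (x + y); [exists x|rewrite addrK].
have tauQ y X : Q X -> Q (tau y X).
  move=> [x ->]; exists (x + y); apply/seteqP; split=> [_ [_ [b pb <-] <-]|_ [b pb <-]].
    by exists b => //; rewrite addrAC.
  by exists (x + b); [exists b|rewrite addrAC].
have tr y : \sum_(X \in Q) F (xget 0 X + y) = \sum_(X \in Q) F (xget 0 X).
  rewrite [RHS](reindex_fsbig (tau y) Q Q).
    apply: eq_fsbigr => X /set_mem QX; apply/esym/FQ; first exact: tauQ.
    by exists (xget 0 X) => //; exact: QxX.
  split; first by move=> X; exact: tauQ.
    by move=> X Y _ _ E; rewrite -(tauK y X) E tauK.
  move=> X QX; exists (tau (- y) X); first exact: tauQ.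
  by rewrite -{1}(opprK y) tauK.
have E : (\sum_(X \in Q) F (xget 0 X)) *+ size s = 0.
  have const (a : CC) : \sum_(y <- s) a = a *+ size s.
    by rewrite big_const_seq count_predT iter_addr_0.
  rewrite -const.
  under eq_bigr => y _ do rewrite -(tr y).
  under eq_bigr => y _ do rewrite fsbig_finite //=.
  rewrite exchange_big /= big1 // => X _.
  under eq_bigr => y _ do rewrite FE.
  rewrite exchange_big /= big_seq big1 // => i iL.
  under eq_bigr => y _ do rewrite chiD mulrA.
  by rewrite -mulr_sumr sP // mulr0.
move/eqP: E; rewrite -mulr_natr mulf_eq0 pnatr_eq0 => /orP[/eqP//|].
by rewrite eqn0Ngt s0.
Qed.

End HaarIntegral.

(** * The Hitchin function of a character *)

Section HitchinFunction.
Variables (k : finFieldType) (char_k : 2%:R != 0 :> k) (C : curve k).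
Variable hat : forall p : place C, completion p.
Local Notation K := (funfield C).
Local Notation A := (adele hat).
Local Notation val p := (@cval _ _ _ (hat p)).
Local Notation Integral := (@integral _ _ hat).
Local Notation Principal := (@principal _ _ hat).
Variable eta : weil_differential hat.
Hypothesis eta_neq0 : exists x, eta x != 0.
Variable alpha : A.
Hypothesis alphaA' : nonsquare_quad_diff eta alpha.
Hypothesis alpha_simple : simple_zeros eta alpha.
Variables u w : A.
Hypothesis uw : u * w = 1.
Hypothesis ou : has_order eta u.
Hypothesis iu : integral (u * u * alpha).
Hypothesis nu : forall p, ~ vge (val p) 2 ((u * u * alpha) p).
Variable R : realType.
Local Notation CC := (R[i]).
Variable psi : k -> CC.
Hypothesis psi_char : nontrivial_character psi.
Variable chi : HF eta alpha -> CC.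
Hypothesis chi_char : HF_character chi.

Local Notation S := (spec_mx alpha 0 1).
Local Notation gL := (gL u).
Local Notation M2 := 'M[A]_2.

Lemma higgs_ext (x y : higgs eta alpha) : hg x = hg y -> hphi x = hphi y -> x = y.
Proof.
case: x y => [g f x1 x2 x3 x4 x5] [g' f' y1 y2 y3 y4 y5] /= gg ff; subst g' f'.
by congr Higgs; apply: Prop_irrelevance.
Qed.

Definition is_higgs (g f : M2) := exists x : higgs eta alpha, hg x = g /\ hphi x = f.

Definition Regular (M : M2) := forall i j, Integral (u * M i j).

Definition is_phi (f : M2) := [/\ mprincipal f, \tr f = 0 & - \det f = alpha].

Lemma is_higgsP (g gi f : M2) : g *m gi = 1%:M -> gi *m g = 1%:M ->
  is_higgs g f <-> is_phi f /\ Regular (gi *m f *m g).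
Proof.
move=> g1 g2; split=> [[x [xg xf]]|[[pf tf df] rf]].
  split; first by rewrite -xf; split; [exact: hphi_principal|exact: hphi_traceless|exact: hphi_det].
  move=> i j; apply/(regularE ou); rewrite -(mxinvE g1 g2) -xg -xf.
  exact: hphi_regular.
have gP : GL2 setT g by exists gi.
have reg i j : regular_diff eta ((mxinv g *m f *m g) i j).
  by rewrite (mxinvE g1 g2); apply/(regularE ou).
by exists (Higgs gP pf tf df reg).
Qed.

(** [chi] is extended by 0 to pairs of matrices that are not Higgs bundles, so that sums over Higgs
    bundles can be written as sums over matrices. *)
Fact weight_subproof : {wt : M2 -> M2 -> CC |
  (forall x : higgs eta alpha, wt (hg x) (hphi x) = chi (higgs_class x)) /\
  (forall g f, ~ is_higgs g f -> wt g f = 0)}.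
Proof.
exists (fun g f => if pselect (is_higgs g f) is left e
   then chi (higgs_class (sval (cid e))) else 0).
split=> [x|g f]; last by case: pselect.
case: pselect => [e|[]]; last by exists x.
by case: cid => y /= [yg yf]; rewrite (@higgs_ext y x).
Qed.

Definition weight := sval weight_subproof.

Lemma weightE (x : higgs eta alpha) : weight (hg x) (hphi x) = chi (higgs_class x).
Proof. exact: (svalP weight_subproof).1. Qed.

Lemma weight0 g f : ~ is_higgs g f -> weight g f = 0.
Proof. exact: (svalP weight_subproof).2. Qed.

Lemma Regular_conj (B q q' : M2) : (forall i j, Integral (q i j)) ->
  (forall i j, Integral (q' i j)) -> Regular B -> Regular (q' *m B *m q).
Proof.
move=> hq hq' hB i j; have hi := integral_subring hat.
have -> : u * (q' *m B *m q) i j = (q' *m (u *: B) *m q) i j.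
  by rewrite -scalemxAr -scalemxAl [RHS]mxE.
apply: sring_mul => // {}i {}j; apply: sring_mul => // {}i {}j.
by rewrite mxE; exact: hB.
Qed.

Lemma higgs_transport (g f c ci q : M2) z : GL2 setT g ->
  GL2 Principal c -> c *m ci = 1%:M -> ci *m c = 1%:M -> units z ->
  GL2 Integral q -> is_higgs g f -> is_higgs (c *m g *m z%:M *m q) (c *m f *m ci) /\
    weight (c *m g *m z%:M *m q) (c *m f *m ci) = weight g f.
Proof.
move=> [gi [g1 g2 _ _]] cP c1 c2 [zi zz] qP hgf.
have zz' : zi * z = 1 by rewrite mulrC.
have [qi [[? [_ _ qiI _]] q1 q2]] := GL2_inv qP; have [? [_ _ qI _]] := qP.
have h1 : (c *m g *m z%:M *m q) *m (qi *m zi%:M *m gi *m ci) = 1%:M.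
  rewrite !mulmxA -[_ *m q *m qi]mulmxA q1 mulmx1.
  rewrite -[_ *m z%:M *m zi%:M]mulmxA -scalar_mxM zz mulmx1.
  by rewrite -[_ *m g *m gi]mulmxA g1 mulmx1.
have h2 : (qi *m zi%:M *m gi *m ci) *m (c *m g *m z%:M *m q) = 1%:M.
  rewrite !mulmxA -[_ *m ci *m c]mulmxA c2 mulmx1.
  rewrite -[_ *m gi *m g]mulmxA g2 mulmx1.
  by rewrite -[_ *m zi%:M *m z%:M]mulmxA -scalar_mxM zz' mulmx1.
have [[pf tf df] rf] := (is_higgsP f g1 g2).1 hgf.
have ciP : GL2 Principal ci.
  by have [? [h a1 a2]] := GL2_inv cP; rewrite -[ci]mulmx1 -a1 mulmxA c2 mul1mx.
have hgf' : is_higgs (c *m g *m z%:M *m q) (c *m f *m ci).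
  apply/(is_higgsP _ h1 h2); split.
    split.
    - have hp := principal_subring hat.
      have [? [_ _ cI _]] := cP; have [? [_ _ ciI _]] := ciP.
      by move=> i j; apply: sring_mul => // {}i {}j; apply: sring_mul.
    - by rewrite mxtrace_mulC mulmxA c2 mul1mx.
    - rewrite -df; congr (- _); rewrite !det_mulmx mulrAC -det_mulmx c1 det1.
      by rewrite mul1r.
  have -> : qi *m zi%:M *m gi *m ci *m (c *m f *m ci) *m (c *m g *m z%:M *m q) =
     qi *m (gi *m f *m g) *m q.
    rewrite !mulmxA -[_ *m ci *m c]mulmxA c2 mulmx1.
    rewrite -[_ *m ci *m c]mulmxA c2 mulmx1; congr (_ *m _).
    rewrite [_ *m z%:M]scalar_mxC !mulmxA -[z%:M *m qi]scalar_mxC.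
    by rewrite -[qi *m z%:M *m zi%:M]mulmxA -scalar_mxM zz mulmx1.
  exact: Regular_conj.
split=> //; have [x [xg xf]] := hgf; have [y [yg yf]] := hgf'.
rewrite -yg -yf -xg -xf !weightE; congr chi; apply/higgs_class_eq.
apply: higgs_iso_sym; exists c, z, q; split=> //; first by exists zi.
  by rewrite yg xg.
by rewrite yf xf -mulmxA c2 mulmx1.
Qed.

Lemma higgs_transport_inv (g f c ci q : M2) z : GL2 setT g ->
  GL2 Principal c -> c *m ci = 1%:M -> ci *m c = 1%:M -> units z ->
  GL2 Integral q -> is_higgs (c *m g *m z%:M *m q) (c *m f *m ci) -> is_higgs g f.
Proof.
move=> gP cP c1 c2 zP qP h'.
have [zi zz] := zP; have zz' : zi * z = 1 by rewrite mulrC.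
have [qi [qiP q1 q2]] := GL2_inv qP.
have ciP : GL2 Principal ci.
  by have [? [h a1 a2]] := GL2_inv cP; rewrite -[ci]mulmx1 -a1 mulmxA c2 mul1mx.
have gP' : GL2 setT (c *m g *m z%:M *m q).
  apply: (GL2_mul (subring_setT _)); last by apply: GL2_sub qP.
  apply: (GL2_mul (subring_setT _)); last by exists zi%:M; rewrite -!scalar_mxM zz zz'.
  by apply: (GL2_mul (subring_setT _)) => //; apply: GL2_sub cP.
have ziP : units zi by exists z.
have := (higgs_transport gP' ciP c2 c1 ziP qiP h').1.
rewrite !mulmxA c2 !mul1mx -[f *m ci *m c]mulmxA c2 mulmx1.
rewrite [_ *m zi%:M]scalar_mxC -!mulmxA q1 mulmx1 !mulmxA.
by rewrite -scalar_mxC -mulmxA -scalar_mxM zz' mulmx1.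
Qed.

Lemma weight_transport (g f c ci q : M2) z : GL2 setT g ->
  GL2 Principal c -> c *m ci = 1%:M -> ci *m c = 1%:M -> units z ->
  GL2 Integral q ->
  weight (c *m g *m z%:M *m q) (c *m f *m ci) = weight g f.
Proof.
move=> gP cP c1 c2 zP qP.
have [h|h] := pselect (is_higgs g f).
  by have [] := higgs_transport gP cP c1 c2 zP qP h.
by rewrite (weight0 h) weight0 // => /(higgs_transport_inv gP cP c1 c2 zP qP).
Qed.

(** A Higgs field is g B g^-1 with u B integral, so its entries are elements of K in a ball that
    depends on g only. *)
Lemma finite_higgs g : GL2 setT g -> finite_set [set f | is_higgs g f].
Proof.
move=> [gi [g1 g2 _ _]].
have [D1 dD1 gD] := in_mball g; have [D2 dD2 giD] := in_mball gi.
have [Dw dDw wD] := in_aball w.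
have dD : divisor (fun p => D1 p + (Dw p + 0) + D2 p).
  by do ?apply: divisorD => //; exact: divisor0.
have fin := finite_mprincipal eta_neq0 2 2 dD.
apply: sub_finite_set (finite_image (map_mx (padele hat)) fin) => f /= hf.
have [[pf _ _] rf] := (is_higgsP f g1 g2).1 hf.
have [N fN] := mprincipalP pf; exists N => //=; rewrite -fN.
have -> : f = g *m (w *: (u *: (gi *m f *m g))) *m gi.
  rewrite scalerA [w * u]mulrC uw scale1r !mulmxA g1 mul1mx.
  by rewrite -mulmxA g1 mulmx1.
apply: mball_mul => //; apply: mball_mul => //; apply: mball_scale => //.
by move=> i j; rewrite mxE; exact: rf.
Qed.

Fact pairing_subproof :
  {pr : M2 -> M2 -> k | forall X f, pr X f = eta (killing X f)}.
Proof. by exists (fun X f => eta (killing X f)). Qed.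

Definition pairing := sval pairing_subproof.

Lemma pairing_def X f : pairing X f = eta (killing X f).
Proof. exact: (svalP pairing_subproof). Qed.

Lemma pairingD X Y f : pairing (X + Y) f = pairing X f + pairing Y f.
Proof. by rewrite !pairing_def killingDl wfunD. Qed.

Lemma psiD x y : psi (x + y) = psi x * psi y.
Proof. by have [_ h _] := psi_char. Qed.

Lemma psi0 : psi 0 = 1.
Proof. by have [h _ _] := psi_char. Qed.

Lemma psi_exp x : psi x ^+ #|k| = 1.
Proof.
rewrite -psi0 -(finzmod_card x); elim: #|k| => [|n IH].
  by rewrite mulr0n psi0 expr0.
by rewrite mulrS psiD exprS IH.
Qed.

Lemma card_finfield_gt0 : (0 < #|k|)%N.
Proof. by apply/card_gt0P; exists 0. Qed.

(** The index set may be enlarged because other matrices have weight 0; different bundles can thus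
    be summed over a common [P]. *)
Lemma hitchinE (P : set M2) g : finite_set P -> GL2 setT g ->
  (forall f, is_higgs (mx_re g) f -> P f) ->
  hitchin_function psi chi g =
  \sum_(f \in P) psi (pairing (bundle_class g) f) * weight (mx_re g) f.
Proof.
move=> fP gP HP; rewrite /hitchin_function.
rewrite -(fsbig_widen [set f | is_higgs (mx_re g) f] P); first last.
- by move=> f [_ /= nf]; rewrite /= weight0 // mulr0.
- by [].
rewrite (reindex_fsbig (fun x : higgs eta alpha => hphi x) [set x | hg x = mx_re g]
  [set f | is_higgs (mx_re g) f]).
  by apply: eq_fsbigr => x /set_mem /= <-; rewrite weightE pairing_def.
split=> [x /= xg|x y /set_mem /= xg /set_mem /= yg|f /= [x [xg xf]]].
- by exists x.
- by apply: higgs_ext; rewrite xg yg.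
- by exists x.
Qed.

Lemma pairing_principal X f : mprincipal X -> mprincipal f -> pairing X f = 0.
Proof.
move=> /mprincipalP[X' ->] /mprincipalP[f' ->].
rewrite pairing_def killingE -map_mxM !trace_map_mx.
apply: wfun_principal; apply/principalP.
exists (4%:R * \tr (X' *m f') - 2%:R * (\tr X' * \tr f')).
by rewrite rmorphB !rmorphM !rmorph_nat.
Qed.

Lemma pairing_regular (X f : M2) : (forall i j, Integral (X i j)) -> Regular f ->
  \tr f = 0 -> pairing X f = 0.
Proof.
move=> iX rf tf; rewrite pairing_def killingE tf mulr0 mulr0 subr0 mxtrace2 !mulmx2E.
have hi := integral_subring hat.
have i4 : Integral 4%:R.
  have i1 := sring1 hi; have i2 : Integral (1 + 1) by exact: (sringD hi).
  have -> : 4%:R = (1 + 1) * (1 + 1) :> A by ring.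
  exact: (sringM hi).
have e i j : eta (f i j * (4%:R * X j i)) = 0.
  have /(regularE ou) h := rf i j; apply: h; exact: (sringM hi).
have -> : 4%:R * (X 0 0 * f 0 0 + X 0 1 * f 1 0 + (X 1 0 * f 0 1 + X 1 1 * f 1 1)) =
   f 0 0 * (4%:R * X 0 0) + f 1 0 * (4%:R * X 0 1) + (f 0 1 * (4%:R * X 1 0)
   + f 1 1 * (4%:R * X 1 1)) by ring.
by rewrite !wfunD !e !addr0.
Qed.

Lemma pairing_Ad (g gi X f : M2) : g *m gi = 1%:M -> gi *m g = 1%:M ->
  pairing (Ad g X) f = pairing X (gi *m f *m g).
Proof. by move=> g1 g2; rewrite !pairing_def (AdE _ g1 g2) killing_ad. Qed.

Lemma pairing_scalar a f : pairing a%:M f = 0.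
Proof. by rewrite pairing_def killing_scalar (raddf0 eta). Qed.

Local Notation IntegralC := (@integralC _ _ hat).
Local Notation PrincipalC := (@principalC _ _ hat).
Local Notation DM := 'M[dual A]_2.

(* The contribution of f to the value of the Hitchin function at the product of
   dmx g0 0 and x. *)
Fact hecke_term_subproof : {tm : M2 -> DM -> M2 -> CC | forall g0 x f, tm g0 x f =
  psi (pairing (Ad g0 (bundle_class x)) f) * weight (g0 *m mx_re x) f}.
Proof.
by exists (fun g0 x f =>
  psi (pairing (Ad g0 (bundle_class x)) f) * weight (g0 *m mx_re x) f).
Qed.

Definition hecke_term := sval hecke_term_subproof.

Lemma hecke_term_def g0 x f : hecke_term g0 x f =
  psi (pairing (Ad g0 (bundle_class x)) f) * weight (g0 *m mx_re x) f.
Proof. exact: (svalP hecke_term_subproof). Qed.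

Lemma GL2_1T : GL2 setT (1%:M : M2).
Proof. exact: GL2_1 (subring_setT _). Qed.

Lemma GL2T_mul (n : comPzRingType) (g h : 'M[n]_2) :
  GL2 setT g -> GL2 setT h -> GL2 setT (g *m h).
Proof. exact: (GL2_mul (subring_setT _)). Qed.

Lemma GL2T_re (g : 'M[dual A]_2) : GL2 setT g -> GL2 setT (mx_re g).
Proof. by move=> /GL2_re[h [_ _ _ _]]. Qed.

Lemma GL2_unit (n : comPzRingType) (z : n) : units z -> GL2 setT (z%:M : 'M[n]_2).
Proof. by case=> y zy; exists y%:M; rewrite -!scalar_mxM [y * z]mulrC zy. Qed.

Lemma GL2T (n : comPzRingType) (T : set n) (g : 'M[n]_2) : GL2 T g -> GL2 setT g.
Proof. by apply: GL2_sub. Qed.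

Lemma Ad1 X : Ad 1%:M X = X :> M2.
Proof. by rewrite (@AdE _ _ _ 1%:M 1%:M) ?mulmx1 ?mul1mx. Qed.

Lemma weight_right (g f q : M2) z : GL2 setT g -> units z -> GL2 Integral q ->
  weight (g *m z%:M *m q) f = weight g f.
Proof.
move=> gP zP qP; have p1 := GL2_1 (principal_subring hat).
have := @weight_transport g f 1%:M 1%:M q z gP p1 (mulmx1 _) (mulmx1 _) zP qP.
by rewrite !mul1mx mulmx1.
Qed.

Lemma higgs_right (g f q : M2) z : GL2 setT g -> units z -> GL2 Integral q ->
  is_higgs g f -> is_higgs (g *m z%:M *m q) f.
Proof.
move=> gP zP qP hf; have p1 := GL2_1 (principal_subring hat).
have := (higgs_transport gP p1 (mulmx1 _) (mulmx1 _) zP qP hf).1.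
by rewrite !mul1mx mulmx1.
Qed.

(** Off the Higgs pairs both weights vanish. On them [f] is regular, so the class of the integral
    factor pairs to 0, and the class of the central factor is scalar. *)
Lemma hecke_term_right (g0 f : M2) (x q : DM) (z : dual A) : GL2 setT g0 -> GL2 setT x -> units z ->
  GL2 IntegralC q -> hecke_term g0 (x *m z%:M *m q) f = hecke_term g0 x f.
Proof.
move=> gP xP zP qP; have xP0 := GL2T_re xP.
have zP0 : units (dre z) by case: zP => y zy; exists (dre y); rewrite -dreM zy.
have [//|//|qi [_ [q1 q2] qI qiI qeps]] := @GL2_re_im _ _ hat IntegralC Integral q _ _ qP.
  by move=> y [].
  by move=> y [].
have zG := GL2_unit zP.
have gx := GL2T_mul gP xP0.
have reE : mx_re (x *m z%:M *m q) = mx_re x *m (dre z)%:M *m mx_re q.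
  by rewrite 2!mx_reM mx_re_scalar.
rewrite !hecke_term_def reE.
rewrite !mulmxA.
rewrite (weight_right _ gx zP0 qI).
have [hf|nf] := pselect (is_higgs (g0 *m mx_re x) f); last first.
  by rewrite (weight0 nf) [LHS]mulr0 [RHS]mulr0.
suff -> : pairing (Ad g0 (bundle_class (x *m z%:M *m q))) f =
    pairing (Ad g0 (bundle_class x)) f by [].
rewrite bundle_class_mul; [|exact: GL2T_mul|exact: GL2T qP].
rewrite bundle_class_mul //; have [a ->] := bundle_class_scalar zP.
rewrite !AdD !pairingD Ad_scalar // Ad_scalar // pairing_scalar addr0.
have xz : GL2 setT (mx_re (x *m z%:M)) by apply: GL2T_re; exact: GL2T_mul.
rewrite -Ad_mul // mx_reM mx_re_scalar mulmxA.
have := higgs_right gx zP0 (GL2_1 (integral_subring hat)) hf.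
rewrite mulmx1 => hf'.
have [G [G1 G2 _ _]] := GL2T_mul gx (GL2_unit zP0).
have [[_ tf _] rf] := (is_higgsP f G1 G2).1 hf'.
have Z0 : pairing (Ad (g0 *m mx_re x *m (dre z)%:M) (bundle_class q)) f = 0.
  rewrite (pairing_Ad (bundle_class q) f G1 G2); apply: pairing_regular rf _.
    rewrite /bundle_class (mxinvE q1 q2).
    exact: (sring_mul (integral_subring hat) qeps qiI).
  by rewrite mxtrace_mulC mulmxA G1 mul1mx.
by rewrite Z0 addr0.
Qed.

Lemma hecke_term_left (g0 f : M2) (y x : DM) : GL2 setT g0 -> GL2 setT y -> GL2 setT x ->
  hecke_term g0 (y *m x) f =
  psi (pairing (Ad g0 (bundle_class y)) f) * hecke_term (g0 *m mx_re y) x f.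
Proof.
move=> gP yP xP; rewrite !hecke_term_def bundle_class_mul // AdD pairingD psiD mx_reM.
by rewrite Ad_mul ?mulmxA ?mulrA //; exact: GL2T_re.
Qed.

Lemma pairing_conj (c ci g X f : M2) : GL2 setT g -> c *m ci = 1%:M ->
  ci *m c = 1%:M -> pairing (Ad (c *m g) X) (c *m f *m ci) = pairing (Ad g X) f.
Proof.
move=> gP c1 c2; rewrite Ad_mul //; last by exists ci.
rewrite (pairing_Ad _ _ c1 c2) !mulmxA c2 mul1mx -[f *m ci *m c]mulmxA c2 mulmx1.
by [].
Qed.

Lemma weight_conj (c ci g f : M2) : GL2 setT g -> GL2 Principal c ->
  c *m ci = 1%:M -> ci *m c = 1%:M ->
  weight (c *m g) (c *m f *m ci) = weight g f.
Proof.
move=> gP cP c1 c2; have i1 := GL2_1 (integral_subring hat).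
have u1 : units (1 : A) by exists 1; rewrite mulr1.
by have := weight_transport f gP cP c1 c2 u1 i1; rewrite !mulmx1.
Qed.

Lemma hecke_term_conj (c ci g0 f : M2) x : GL2 setT g0 -> GL2 setT x ->
  GL2 Principal c -> c *m ci = 1%:M -> ci *m c = 1%:M ->
  hecke_term (c *m g0) x (c *m f *m ci) = hecke_term g0 x f.
Proof.
move=> gP xP cP c1 c2; rewrite !hecke_term_def pairing_conj // -mulmxA weight_conj //.
by apply: GL2T_mul => //; exact: GL2T_re.
Qed.

Lemma hitchin_term (P : set M2) g : finite_set P -> GL2 setT g ->
  (forall f, is_higgs (mx_re g) f -> P f) ->
  hitchin_function psi chi g = \sum_(f \in P) hecke_term 1%:M g f.
Proof.
move=> fP gP HP; rewrite (hitchinE fP gP HP); apply: eq_fsbigr => f _.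
by rewrite hecke_term_def Ad1 mul1mx.
Qed.

Lemma is_higgs_phi g f : is_higgs g f -> is_phi f.
Proof.
by move=> [x [_ <-]]; split; [exact: hphi_principal|exact: hphi_traceless|exact: hphi_det].
Qed.

(** A global factor on the left conjugates the Higgs fields, which reindexes the sum, and its own
    class is principal, hence pairs to 0 with global fields. The factors on the right are handled by
    [hecke_term_right]. *)
Lemma hitchin_bun : bun_function (hitchin_function psi chi).
Proof.
move=> c g z q cP gP zP qP.
have [|||ci [_ [c1 c2] c0P c0iP cim]] := @GL2_re_im _ _ hat PrincipalC Principal c.
- by move=> y [].
- by move=> y [].
- exact: cP.
have cT := GL2T cP; have qT := GL2T qP; have zT := GL2_unit zP.
have gP0 := GL2T_re gP.
have zP0 : units (dre z) by case: zP => y zy; exists (dre y); rewrite -dreM zy.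
have [|||qi [_ _ qI _ _]] := @GL2_re_im _ _ hat IntegralC Integral q.
- by move=> y [].
- by move=> y [].
- exact: qP.
have g'P : GL2 setT (c *m g *m z%:M *m q) by do 3?apply: GL2T_mul.
have E : mx_re (c *m g *m z%:M *m q) = mx_re c *m mx_re g *m (dre z)%:M *m mx_re q.
  by rewrite !mx_reM mx_re_scalar.
rewrite (hitchin_term (finite_higgs (GL2T_re g'P)) g'P) //.
rewrite (hitchin_term (finite_higgs gP0) gP) // E.
rewrite (reindex_fsbig (fun f : M2 => mx_re c *m f *m mx_re ci)
  [set f | is_higgs (mx_re g) f]).
  apply: eq_fsbigr => f /set_mem /= hf.
  have P0 : pairing (Ad 1%:M (bundle_class c)) (mx_re c *m f *m mx_re ci) = 0.
    rewrite Ad1; apply: pairing_principal.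
      rewrite /bundle_class (mxinvE c1 c2).
      exact: (sring_mul (principal_subring hat)).
    have hp := principal_subring hat; have [pf _ _] := is_higgs_phi hf.
    have [? [_ _ cI _]] := c0P.
    by move=> i j; apply: (sring_mul hp) => // {}i {}j; exact: (sring_mul hp).
  apply: (etrans (hecke_term_right _ GL2_1T (GL2T_mul cT gP) zP qP)).
  apply: (etrans (hecke_term_left _ GL2_1T cT gP)).
  rewrite P0 psi0 mul1r; apply: etrans (hecke_term_conj f GL2_1T gP c0P c1 c2).
  by rewrite mul1mx mulmx1.
split=> [f /= hf|f f' _ _ /= ff|f' /= hf'].
- by have [] := higgs_transport gP0 c0P c1 c2 zP0 qI hf.
- have K h : mx_re ci *m (mx_re c *m h *m mx_re ci) *m mx_re c = h.
    by rewrite !mulmxA c2 mul1mx -mulmxA c2 mulmx1.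
  by rewrite -[f]K ff K.
- have K : mx_re c *m (mx_re ci *m f' *m mx_re c) *m mx_re ci = f'.
    by rewrite !mulmxA c1 mul1mx -mulmxA c1 mulmx1.
  exists (mx_re ci *m f' *m mx_re c); last exact: K.
  by apply: (higgs_transport_inv gP0 c0P c1 c2 zP0 qI); rewrite K.
Qed.

Lemma eta_const (s : k) x : eta (padele hat (const C s) * x) = s * eta x.
Proof. exact: wfunZ. Qed.

(** Constants of k scale the pairing, which is 4 times the nonzero value [b], and 4 is invertible in
    k. *)
Lemma pairing_onto (N : M2) i j y a : \tr N = 0 -> eta (N i j * y) != 0 ->
  exists s : k, pairing ((padele hat (const C s) * y) *: delta_mx j i) N = a.
Proof.
move=> tN e0; set b := eta _ in e0.
have f0 : (4%:R : k) != 0 by rewrite (_ : 4%:R = 2%:R * 2%:R) ?mulf_neq0 // -natrM.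
have key (s : k) : 4%:R * (padele hat (const C s) * y * N i j) =
    padele hat (const C (4%:R * s)) * (N i j * y).
  by rewrite !rmorphM !rmorph_nat; ring.
exists (a / (4%:R * b)); rewrite pairing_def killing_delta // key.
by rewrite eta_const -/b; field; rewrite e0 f0.
Qed.

Lemma psi_nontrivial : exists a, psi a != 1.
Proof. by have [_ _] := psi_char. Qed.

Lemma eta_principal_neq0 (e : K) : e != 0 -> exists y, eta (padele hat e * y) != 0.
Proof.
move=> e0; have [x ex] := eta_neq0; exists (padele hat e^-1 * x).
by rewrite mulrA -rmorphM divff // rmorph1 mul1r.
Qed.

Lemma is_phi_10 f : is_phi f -> exists2 e : K, e != 0 & f 1 0 = padele hat e.
Proof.
move=> [pf tf df]; have [e fe] := (principalP (f 1 0)).1 (pf 1 0).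
exists e => //; apply/eqP => e0.
have f11 : f 1 1 = - f 0 0 by apply/eqP; rewrite -addr_eq0 addrC -mxtrace2 tf.
apply: (alpha_nonsquare alphaA' alpha_simple (pf 0 0)).
by rewrite -df det_mx2 fe e0 rmorph0 f11; ring.
Qed.

Lemma hitchin_cuspidal : strongly_cuspidal (hitchin_function psi chi).
Proof.
split; first exact: hitchin_bun.
move=> g gP; have gP0 := GL2T_re gP; have fin := finite_higgs gP0.
(* [nil_unip x] keeps the reduction and adds [x *: delta_mx 0 1] to the class, so the term of [f] is
   multiplied by this character of [x], which sees only the nonzero entry [f 1 0]. *)
pose ch (f : M2) (x : A) := psi (pairing (x *: delta_mx 0 1) f).
pose c (f : M2) := psi (pairing (bundle_class g) f) * weight (mx_re g) f.
apply: (@haar_eq0 _ _ hat R _ _ (fset_set [set f | is_higgs (mx_re g) f]) c ch #|k|).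
- exact: card_finfield_gt0.
- by move=> f x y; rewrite /ch scalerDl pairingD psiD.
- by move=> f x; exact: psi_exp.
- move=> f; rewrite in_fset_set // => /set_mem /= /is_higgs_phi hf.
  have [e e0 fe] := is_phi_10 hf; have [y ey] := eta_principal_neq0 e0.
  have [_ tf _] := hf; have [a a1] := psi_nontrivial.
  rewrite -fe in ey; have [s sa] := pairing_onto a tf ey.
  by exists (padele hat (const C s) * y); rewrite /ch sa.
move=> x; have nE : mx2 0 x 0 0 = x *: delta_mx 0 1 :> M2.
  by apply: mx2P; rewrite !mxE /= ?mulr0 ?mulr1.
have nP : GL2 setT (nil_unip x).
  by rewrite nil_unipE -dual_setT; apply: GL2_dmx_eps => //; exact: subring_setT.
have re : mx_re (nil_unip x *m g) = mx_re g by rewrite mx_reM nil_unipE mx_re_dmx mul1mx.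
have cl : bundle_class (nil_unip x *m g) = x *: delta_mx 0 1 + bundle_class g.
  apply: (etrans (bundle_class_mul nP gP)); congr (_ + _).
    by rewrite nil_unipE bundle_class_dmx_eps.
  by rewrite nil_unipE mx_re_dmx Ad1.
have HP f : is_higgs (mx_re (nil_unip x *m g)) f ->
    [set f | is_higgs (mx_re g) f] f by rewrite re.
apply: (etrans (hitchinE fin (GL2T_mul nP gP) HP)).
rewrite re cl fsbig_finite //=; apply: eq_bigr => f _.
by rewrite pairingD psiD /c /ch -mulrA mulrCA [RHS]mulrAC -mulrA.
Qed.

Lemma gL_higgs : exists x : higgs eta alpha,
  [/\ hg x = gL, hphi x = S & chi (higgs_class x) = 1].
Proof.
have s1 : spec_idele alpha 1%:M by exact: spec_idele1.
have [x [xS xg]] := higgs_intro alphaA' uw ou iu s1.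
rewrite mul1mx in xg; exists x; split=> //.
have [c1 _] := chi_char; apply: c1.
by apply/(pushforwardE alphaA' uw ou iu _ s1); exists x; rewrite mul1mx.
Qed.

Lemma hitchin_neq0 : exists2 g, GL2 setT g & hitchin_function psi chi g != 0.
Proof.
apply: contrapT => nex.
have f0 g : GL2 setT g -> hitchin_function psi chi g = 0.
  by move=> gP; apply/eqP/negPn/negP => h; apply: nex; exists g.
have [x0 [xg xf x1]] := gL_higgs.
have hS : is_higgs gL S by exists x0.
have fin := finite_higgs (gLP uw).
have [_ tS _] := is_higgs_phi hS.
(* After a twist by psi of minus the pairing of Y with [S], the term of [f] varies with Y by this
   character, which is trivial only for f = S. Averaging isolates the term of [S], whose weight is
   1. *)
pose ch (f : M2) (Y : M2) := psi (pairing Y (f - S)).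
pose L := [seq f <- fset_set [set f | is_higgs gL f] | f != S].
have [||||s [s0 sP]] := @averaging_list _ _ _ ch #|k| _ _ _ L.
- exact: card_finfield_gt0.
- by move=> f Y Z; rewrite /ch pairingD psiD.
- by move=> f Y; exact: psi_exp.
- move=> f; rewrite mem_filter => /andP[fS].
  rewrite in_fset_set // => /set_mem /= /is_higgs_phi [pf tf df].
  have [pS _ _] := is_higgs_phi hS.
  have [i [j fij]] : exists i j, (f - S) i j != 0.
    apply: contrapT => nij; move/eqP: fS; apply; apply/matrixP => i j.
    apply/eqP; rewrite -subr_eq0; apply/negPn/negP => h; apply: nij.
    by exists i, j; rewrite !mxE; move: h; rewrite !mxE.
  have [e eE] := (principalP ((f - S) i j)).1 (mprincipalB pf pS i j).
  have e0 : e != 0 by apply: contraNneq fij => e0; rewrite eE e0 rmorph0.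
  have [y ey] := eta_principal_neq0 e0; rewrite -eE in ey.
  have [a a1] := psi_nontrivial.
  have tfS : \tr (f - S) = 0 by rewrite raddfB /= tf tS subrr.
  have [t ta] := pairing_onto a tfS ey.
  by exists ((padele hat (const C t) * y) *: delta_mx j i); rewrite /ch ta.
have psiN x : psi (- x) * psi x = 1 by rewrite -psiD addNr psi0.
have pB Y f f' : pairing Y (f - f') = pairing Y f - pairing Y f'.
  by rewrite !pairing_def killingBr (raddfB eta).
pose g Y := dmx 1%:M Y *m dmx gL 0.
have epsP (Y : M2) : GL2 setT (dmx 1%:M Y).
  by rewrite -dual_setT; apply: GL2_dmx_eps => //; exact: subring_setT.
have constP : GL2 setT (dmx gL 0).
  by rewrite -dual_setT; apply: GL2_dmx_const => //; exact: (gLP uw).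
have gP Y : GL2 setT (g Y) := GL2T_mul (epsP Y) constP.
have : \sum_(Y <- s) psi (- pairing Y S) * hitchin_function psi chi (g Y) = 0.
  by apply: big1 => Y _; rewrite (f0 _ (gP Y)) mulr0.
have re Y : mx_re (g Y) = gL by rewrite mx_reM !mx_re_dmx mul1mx.
have cl Y : bundle_class (g Y) = Y.
  apply: (etrans (bundle_class_mul (epsP Y) constP)).
  by rewrite bundle_class_dmx_eps mx_re_dmx Ad1 bundle_class_dmx_const addr0.
have E Y : psi (- pairing Y S) * hitchin_function psi chi (g Y) =
    \sum_(f <- fset_set [set f | is_higgs gL f]) weight gL f * ch f Y.
  have HP f : is_higgs (mx_re (g Y)) f -> [set f | is_higgs gL f] f by rewrite re.
  rewrite (hitchinE fin (gP Y) HP) re cl fsbig_finite //= mulr_sumr.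
  apply: eq_bigr => f _; rewrite /ch pB psiD mulrA [RHS]mulrC.
  by rewrite [psi (pairing Y f) * _]mulrC.
under eq_bigr do rewrite E.
rewrite exchange_big /= (bigD1_seq S) ?fset_uniq //=; last first.
  by rewrite in_fset_set //; apply/mem_set.
rewrite [X in _ + X](_ : _ = 0) ?addr0; last first.
  rewrite -big_filter big_seq big1 // => f fL; rewrite -mulr_sumr sP ?mulr0 //.
rewrite -mulr_sumr -{1}xf -{1}xg weightE x1 mul1r.
under eq_bigr do rewrite /ch pB subrr psi0.
rewrite big_const_seq count_predT iter_addr_0 => /eqP.
by rewrite pnatr_eq0 eqn0Ngt s0.
Qed.

(** * Hecke operators and their eigenvalues *)

Section Hecke.
Variable h : 'M[dual A]_2 -> CC.
Hypothesis hP : hecke_measure h.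

Definition hecke_support : set (set DM) :=
  [set c | GA_mod_GO c /\ exists2 x, c x & h x != 0].
Local Notation Qh := hecke_support.
Definition repr (c : set DM) : DM := xget 1%:M c.

Lemma GL2C_1 : GL2 IntegralC (1%:M : DM).
Proof.
rewrite -dmx1; apply: GL2_dmx_const; last exact: GL2_1 (integral_subring hat).
exact: (sring0 (integral_subring hat)).
Qed.

Lemma unitsC_1 : units (1 : dual A).
Proof. by exists 1; rewrite mulr1. Qed.

Lemma GO_coset_refl (x : DM) : GO_coset x x.
Proof.
by exists 1, 1%:M; rewrite !mulmx1; split=> //; [exact: unitsC_1|exact: GL2C_1].
Qed.

Lemma h_right (x q : DM) (z : dual A) : GL2 setT x -> units z ->
  GL2 IntegralC q -> h (x *m z%:M *m q) = h x.
Proof.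
move=> xP zP qP; have [hinv _] := hP.
by have := hinv 1%:M x z q GL2C_1 xP zP qP; rewrite mul1mx.
Qed.

Lemma h_left (x q : DM) : GL2 setT x -> GL2 IntegralC q -> h (q *m x) = h x.
Proof.
move=> xP qP; have [hinv _] := hP.
by have := hinv q x 1 1%:M qP xP unitsC_1 GL2C_1; rewrite !mulmx1.
Qed.

Lemma repr_coset c : GA_mod_GO c -> GL2 setT (repr c) /\ exists x z q,
  [/\ GL2 setT x, units z, GL2 IntegralC q, c = GO_coset x &
      repr c = x *m z%:M *m q].
Proof.
move=> [x xP cE]; have cr : c (repr c).
  by apply: (@xgetPex _ 1%:M c); exists x; rewrite cE; exact: GO_coset_refl.
move: (cr); rewrite {1}cE => -[z [q [zP qP rE]]]; split.
  rewrite rE; exact: (GL2T_mul (GL2T_mul xP (GL2_unit zP)) (GL2T qP)).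
by exists x, z, q.
Qed.

(** Left multiplication by [q] permutes the cosets in the support. The representatives chosen before
    and after differ by central units and integral factors on the right, which neither [h] nor [F]
    sees. *)
Lemma sum_left_translate (F : DM -> CC) (q : DM) : GL2 IntegralC q ->
  (forall x z q, GL2 setT x -> units z -> GL2 IntegralC q ->
     F (x *m z%:M *m q) = F x) ->
  \sum_(c \in Qh) h (repr c) * F (repr c) =
  \sum_(c \in Qh) h (repr c) * F (q *m repr c).
Proof.
move=> qP Finv.
have [qi [qiP q1 q2]] := GL2_inv qP.
pose tau (a : DM) (c : set DM) : set DM := [set a *m x | x in c].
have tauK a b c : b *m a = 1%:M -> tau b (tau a c) = c.
  move=> ba; apply/seteqP; split=> [_ [_ [x cx <-] <-]|x cx].
    by rewrite mulmxA ba mul1mx.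
  by exists (a *m x); [exists x|rewrite mulmxA ba mul1mx].
have tauG a x : tau a (GO_coset x) = GO_coset (a *m x).
  apply/seteqP; split=> [_ [_ [z [b [zP bP ->]]] <-]|_ [z [b [zP bP ->]]]].
    by exists z, b; rewrite !mulmxA.
  by exists (x *m z%:M *m b); [exists z, b|rewrite !mulmxA].
have tauQ a c : GL2 IntegralC a -> Qh c -> Qh (tau a c).
  move=> aP [[x xP cE] [y cy hy]]; split.
    exists (a *m x).
      exact: (GL2T_mul (GL2T aP) xP).
    rewrite cE.
    exact: tauG.
  have yP : GL2 setT y.
    move: cy; rewrite cE => -[z [b [zP bP ->]]].
    exact: (GL2T_mul (GL2T_mul xP (GL2_unit zP)) (GL2T bP)).
  by exists (a *m y); [exists y|rewrite (h_left yP aP)].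
rewrite (reindex_fsbig (tau q) Qh Qh).
  apply: eq_fsbigr => c /set_mem Qc; have [cG _] := Qc.
  have [tG _] := tauQ q c qP Qc.
  have [rP [x [z [b [xP zP bP cE rE]]]]] := repr_coset cG.
  have [_ [x' [z' [b' [xP' zP' bP' cE' rE']]]]] := repr_coset tG.
  have qT := GL2T qP.
  have : GO_coset (q *m x) x' by rewrite -tauG -cE cE'; exact: GO_coset_refl.
  case=> z2 [b2 [zP2 bP2 E2]].
  have qx := GL2T_mul qT xP.
  have hh : h (repr (tau q c)) = h (repr c).
    rewrite rE rE'; apply: (etrans (h_right xP' zP' bP')).
    rewrite E2; apply: (etrans (h_right qx zP2 bP2)).
    by apply: (etrans (h_left xP qP)); rewrite (h_right xP zP bP).
  have FF : F (repr (tau q c)) = F (q *m repr c).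
    rewrite rE rE'; apply: (etrans (Finv _ _ _ xP' zP' bP')).
    rewrite E2; apply: (etrans (Finv _ _ _ qx zP2 bP2)).
    by rewrite -(Finv _ _ _ qx zP bP) !mulmxA.
  by rewrite hh FF.
split=> [c Qc|c c' _ _ E|c Qc]; first exact: tauQ.
  by rewrite -(tauK q qi c) // E tauK.
by exists (tau qi c); [exact: tauQ|exact: tauK].
Qed.

Definition hecke_sum (g0 f : M2) : CC := \sum_(c \in Qh) h (repr c) * hecke_term g0 (repr c) f.

Lemma hecke_sum_left (g0 f : M2) (q : DM) : GL2 setT g0 -> GL2 IntegralC q ->
  hecke_sum g0 f = psi (pairing (Ad g0 (bundle_class q)) f) * hecke_sum (g0 *m mx_re q) f.
Proof.
move=> gP qP; rewrite /hecke_sum (sum_left_translate qP (F := fun x => hecke_term g0 x f)); last first.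
  by move=> x z b xP zP bP; exact: hecke_term_right.
rewrite mulr_fsumr; apply: eq_fsbigr => c /set_mem [/repr_coset[rP _] _].
by rewrite (hecke_term_left f gP (GL2T qP) rP) mulrCA.
Qed.

Lemma hecke_sum_conj (c ci g0 f : M2) : GL2 setT g0 -> GL2 Principal c ->
  c *m ci = 1%:M -> ci *m c = 1%:M -> hecke_sum (c *m g0) (c *m f *m ci) = hecke_sum g0 f.
Proof.
move=> gP cP c1 c2; apply: eq_fsbigr => X /set_mem [/repr_coset[rP _] _].
by rewrite (hecke_term_conj f gP rP cP c1 c2).
Qed.

(* h is invariant under 1 + eps Z for Z integral, which multiplies the sum by a
   character of Z that is trivial only if f is regular. *)
Lemma hecke_sum_not_higgs g0 f : GL2 setT g0 -> is_phi f -> ~ is_higgs g0 f -> hecke_sum g0 f = 0.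
Proof.
move=> gP hf nf; have [gi [g1 g2 _ _]] := gP; have [pf tf df] := hf.
have [i [j nij]] : exists i j, ~ Integral (u * (gi *m f *m g0) i j).
  apply: contrapT => nex; apply: nf; apply/(is_higgsP f g1 g2); split=> // i j.
  by apply: contrapT => nr; apply: nex; exists i, j.
have [y iy ey] : exists2 y, integral y & eta ((gi *m f *m g0) i j * y) != 0.
  apply: contrapT => nex; apply: nij; apply/(regularE ou) => y iy.
  by apply/eqP/negPn/negP => ne; apply: nex; exists y.
have tB : \tr (gi *m f *m g0) = 0 by rewrite mxtrace_mulC mulmxA g1 mul1mx.
have [a a1] := psi_nontrivial; have [s sa] := pairing_onto a tB ey.
set Z := _ *: _ in sa; have hi := integral_subring hat.
have iZ i' j' : Integral (Z i' j').
  rewrite mxE; apply: (sringM hi).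
    apply: (sringM hi) => // p; apply/vge_emb; exact: vge_const.
  by rewrite mxE; case: (_ && _); [exact: (sring1 hi)|exact: (sring0 hi)].
have := hecke_sum_left f gP (GL2_dmx_eps hi iZ).
rewrite bundle_class_dmx_eps mx_re_dmx mulmx1 (pairing_Ad _ _ g1 g2) sa.
move/eqP; rewrite -subr_eq0 -{1}[hecke_sum g0 f]mul1r -mulrBl mulf_eq0.
by rewrite subr_eq0 eq_sym (negPf a1) => /eqP.
Qed.

(** As [m] commutes with [S], (m g, S) is a Higgs bundle exactly when (g, S) is. The factor [c] of
    the normal form of g commutes with [S], hence with [m]; so if n is the idele of (g, S), that of
    (m g, S) is m n, and [chi] is multiplicative. *)
Lemma weight_twist m g : spec_idele alpha m -> GL2 setT g ->
  weight (m *m g) S = weight (m *m gL) S * weight g S.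
Proof.
move=> mP gP.
have [mi [miP m1 m2]] := spec_idele_inv mP.
have mS := spec_idele_comm mP.
have [x [xS xg]] := higgs_intro alphaA' uw ou iu mP.
have [gi [g1 g2 _ _]] := gP.
have e1 : (m *m g) *m (gi *m mi) = 1%:M.
  by rewrite mulmxA -[_ *m g *m gi]mulmxA g1 mulmx1.
have e2 : (gi *m mi) *m (m *m g) = 1%:M.
  by rewrite mulmxA -[_ *m mi *m m]mulmxA m2 mulmx1.
have conjE : gi *m mi *m S *m (m *m g) = gi *m S *m g.
  rewrite !mulmxA -[_ *m S *m m]mulmxA mS mulmxA -[_ *m mi *m m]mulmxA m2.
  by rewrite mulmx1.
have [hgS|ng] := pselect (is_higgs g S); last first.
  rewrite (weight0 ng) mulr0 weight0 // => /(is_higgsP S e1 e2)[hS].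
  by rewrite conjE => rS; apply: ng; apply/(is_higgsP S g1 g2).
have [y [yg yS]] := hgS.
have [c [n [q [cP nP qP yE cS]]]] :=
  higgs_normal_form char_k alphaA' alpha_simple uw ou nu y.
rewrite yS in cS.
have hmg : is_higgs (m *m g) S.
  apply/(is_higgsP S e1 e2); rewrite conjE; exact/(is_higgsP S g1 g2).
have [t [tg tS]] := hmg; have nm := spec_idele_mul mP nP.
have [x2 [x2S x2g]] := higgs_intro alphaA' uw ou iu nP.
have [x3 [x3S x3g]] := higgs_intro alphaA' uw ou iu nm.
have u1 : units (1 : A) by exists 1; rewrite mulr1.
have iso2 : higgs_class y = higgs_class x2.
  apply/higgs_class_eq; apply: higgs_iso_sym; exists c, 1, q; split=> //.
    by rewrite yE x2g mulmx1 !mulmxA.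
  by rewrite yS x2S.
have cm : m *m c = c *m m.
  have [_ [a [b ->]]] := mP; rewrite (spec_mx_commutant (esym cS)).
  by rewrite spec_mxC.
have iso3 : higgs_class t = higgs_class x3.
  apply/higgs_class_eq; apply: higgs_iso_sym; exists c, 1, q; split=> //.
    by rewrite tg -yg yE x3g mulmx1 !mulmxA cm.
  by rewrite tS x3S.
rewrite -tg -[X in weight _ X]tS weightE -xg -yg.
rewrite -[X in weight (hg x) X]xS -[X in weight (hg y) X]yS !weightE iso2 iso3.
have [_ cM] := chi_char; apply: (cM m n) => //.
- by apply/(pushforwardE alphaA' uw ou iu _ mP); exists x.
- by apply/(pushforwardE alphaA' uw ou iu _ nP); exists x2.
- by apply/(pushforwardE alphaA' uw ou iu _ nm); exists x3.
Qed.

Lemma hecke_sum_twist m : spec_idele alpha m -> hecke_sum (m *m gL) S = weight (m *m gL) S * hecke_sum gL S.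
Proof.
move=> mP; have [mi [miP m1 m2]] := spec_idele_inv mP.
have gP := gLP uw.
rewrite /hecke_sum mulr_fsumr; apply: eq_fsbigr => c /set_mem [/repr_coset[rP _] _].
rewrite !hecke_term_def -mulmxA weight_twist //; last by apply: GL2T_mul => //; exact: GL2T_re.
have -> : pairing (Ad (m *m gL) (bundle_class (repr c))) S =
    pairing (Ad gL (bundle_class (repr c))) S.
  rewrite -[S in LHS]mulmx1 -m1 mulmxA (spec_idele_comm mP).
  by rewrite pairing_conj.
by ring.
Qed.

(* The normal form g0 = c m gL q, f = c S c^-1 and the invariance of h under q
   turn the sum at (g0, f) into the one at (m gL, S), from which chi m factors
   out. *)
Lemma hecke_sum_eigen g0 f : GL2 setT g0 -> is_phi f -> hecke_sum g0 f = hecke_sum gL S * weight g0 f.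
Proof.
move=> gP hf; have [hgf|ngf] := pselect (is_higgs g0 f); last first.
  by rewrite hecke_sum_not_higgs // (weight0 ngf) mulr0.
have [y [yg yf]] := hgf.
have [c [m [q [cP mP qP yE cS]]]] :=
  higgs_normal_form char_k alphaA' alpha_simple uw ou nu y.
have [ci [_ c1 c2]] := GL2_inv cP; have [mG _] := mP.
have gLG := gLP uw; have mgL := GL2T_mul mG gLG.
have qT := GL2T qP.
have fE : f = c *m S *m ci by rewrite -cS yf -mulmxA c1 mulmx1.
have gE : g0 = c *m (m *m gL *m q) by rewrite -yg yE !mulmxA.
have wE : weight g0 f = weight (m *m gL) S.
  rewrite fE gE weight_conj //; last exact: GL2T_mul.
  have u1 : units (1 : A) by exists 1; rewrite mulr1.
  by have := weight_right S mgL u1 qP; rewrite mulmx1.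
rewrite wE mulrC -hecke_sum_twist // fE gE hecke_sum_conj //; last exact: GL2T_mul.
have qC : GL2 IntegralC (dmx q 0).
  by apply: GL2_dmx_const => //; exact: (sring0 (integral_subring hat)).
rewrite [RHS](hecke_sum_left S mgL qC) mx_re_dmx bundle_class_dmx_const.
rewrite (_ : Ad _ 0 = 0); last by rewrite Ad_def mulmx0 mul0mx.
by rewrite (_ : (0 : M2) = 0%:M) ?pairing_scalar ?psi0 ?mul1r // raddf0.
Qed.

(** [P] collects the Higgs fields of the bundle and of its modifications by the support of [h]. A
    field in [P] that is not one of the bundle itself contributes 0, by [hecke_sum_eigen]. *)
Lemma hecke_eigenvalue g : GL2 setT g ->
  hecke_act h (hitchin_function psi chi) g = hecke_sum gL S * hitchin_function psi chi g.
Proof.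
move=> gP; have gP0 := GL2T_re gP; have [_ Qfin] := hP.
pose P := [set f | is_higgs (mx_re g) f] `|`
  \bigcup_(c in Qh) [set f | is_higgs (mx_re g *m mx_re (repr c)) f].
have Pfin : finite_set P.
  rewrite finite_setU; split; first exact: finite_higgs.
  apply: bigcup_finite => [|c [/repr_coset[rP _] _]]; first exact: Qfin.
  by apply: finite_higgs; apply: GL2T_mul => //; exact: GL2T_re.
have Pphi f : P f -> is_phi f by case=> [|[c _]] /is_higgs_phi.
(* Off the support, [h] vanishes at the chosen element of the coset, so finitely many cosets
   remain. *)
rewrite /hecke_act -(fsbig_widen Qh); first last.
- move=> c [cG nQ] /=; have [rP [x [z [q [xP zP qP cE rE]]]]] := repr_coset cG.
  suff -> : h (xget 1%:M c) = 0 by rewrite mul0r.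
  apply/eqP/negPn/negP => hn; apply: nQ; split=> //.
  have : GO_coset x (repr c) by rewrite rE; exists z, q.
  by rewrite -cE => cr; exists (repr c).
- by move=> c [].
rewrite (hitchinE Pfin gP) => [|f hf]; last by left.
transitivity (\sum_(c \in Qh) \sum_(f \in P)
   h (repr c) * (psi (pairing (bundle_class g) f) * hecke_term (mx_re g) (repr c) f)).
  apply: eq_fsbigr => c /set_mem Qc; have [/repr_coset[rP _] _] := Qc.
  rewrite (hitchin_term Pfin) ?mulr_fsumr; first last.
  - by move=> f; rewrite mx_reM => hf; right; exists c.
  - exact: GL2T_mul.
  apply: eq_fsbigr => f _; rewrite hecke_term_left //; last exact: GL2_1T.
  by rewrite Ad1 mul1mx.
rewrite exchange_fsbig // mulr_fsumr; apply: eq_fsbigr => f /set_mem /Pphi hf.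
transitivity (psi (pairing (bundle_class g) f) * hecke_sum (mx_re g) f).
  by rewrite /hecke_sum mulr_fsumr; apply: eq_fsbigr => c _; ring.
by rewrite hecke_sum_eigen //; ring.
Qed.

End Hecke.

Lemma hitchin_eigenvector : hecke_eigenvector (hitchin_function psi chi).
Proof.
split; [exact: hitchin_cuspidal|exact: hitchin_neq0|move=> h hP].
by exists (hecke_sum h gL S) => g; exact: hecke_eigenvalue.
Qed.

End HitchinFunction.

Theorem theoremF (R : realType) (k : finFieldType) (char_k : 2%:R != 0 :> k)
    (Cbar : curve k) (hat : forall p : place Cbar, completion p)
    (eta : weil_differential hat) (eta_neq0 : exists x, eta x != 0)
    (psi : k -> R[i]) (psi_char : nontrivial_character psi)
    (alpha : adele hat) (alphaA' : nonsquare_quad_diff eta alpha)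
    (alpha_simple : simple_zeros eta alpha) :
  is_basis (@finitely_supported _ _ _ eta R alpha)
           (@HF_character _ _ _ eta R alpha) /\
  forall chi : HF eta alpha -> R[i], HF_character chi ->
    hecke_eigenvector (hitchin_function psi chi).
Proof.
have [u [w [uw ou iu nu]]] := order_idele alphaA' alpha_simple.
split; first exact: (HF_characters_basis char_k eta_neq0 alphaA' alpha_simple uw ou iu nu).
move=> chi chi_char.
exact: (hitchin_eigenvector char_k eta_neq0 alphaA' alpha_simple uw ou iu nu
          psi_char chi_char).
Qed.
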